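(* Let $G$ be a countable discrete group and $\mu$ an admissible probability measure on $G$ with $H(\mu)<\infty$. Then for any conjugation-invariant Borel probability measure $\lambda\in\mathcal M(\mathrm{Sub}_G)$, $$h_\mu(\lambda)=\lim_{n\to\infty}\frac1n\int H(\mu^n_K)\,d\lambda(K)=\inf_n\frac1n\int H(\mu^n_K)\,d\lambda(K)$$ $$=\lim_{n\to\infty}\int\left(H(\mu^n_K)-H(\mu^{n-1}_K)\right)d\lambda(K)=\inf_n\int\left(H(\mu^n_K)-H(\mu^{n-1}_K)\right)d\lambda(K).$$
   Context: $\mu$ is admissible if its support generates $G$ as a semigroup (the paper's further requirement, that some convolution power be absolutely continuous with respect to Haar measure, is automatic for discrete $G$). $\mu^n$ is the $n$-fold convolution power of $\mu$ (with $\mu^0=\delta_e$). For a subgroup $K<G$, $\mu^n_K$ is the pushforward of $\mu^n$ under the quotient map $G\to K\backslash G$. For a probability measure $\omega$ on a countable set $W$, $H(\omega):=-\sum_{w\in W}\omega(\{w\})\log\omega(\{w\})$ with $0\log0=0$. $\mathrm{Sub}_G$ is the compact metrizable space of subgroups of $G$ (a closed subspace of $2^G$), on which $G$ acts by conjugation, $K^\gamma=\gamma K\gamma^{-1}$; $\mathcal M(\mathrm{Sub}_G)$ is the space of conjugation-invariant Borel probability measures on it. Let $X_1,X_2,\dots$ be i.i.d. with law $\mu$; $\mathbb P_K$ is the law of $(K,KX_1,KX_1X_2,\ldots)$ on $(K\backslash G)^{\mathbb N}$. Let $\widetilde{\mathrm{Sub}_G}=\{(K;Kg_0,Kg_1,\ldots):K\in\mathrm{Sub}_G,\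 g_0,g_1,\ldots\in G\}$ and let $\mathbb P_\lambda$ be the measure on it given by $d\mathbb P_\lambda(K;Kg_0,Kg_1,\ldots)=d\mathbb P_K(Kg_0,Kg_1,\ldots)\,d\lambda(K)$. $G$ acts on $\widetilde{\mathrm{Sub}_G}$ by $\gamma(K;Kg_0,Kg_1,\ldots)=(K^\gamma;\gamma Kg_0,\gamma Kg_1,\ldots)$, commuting with the shift $\tilde\sigma(K;Kg_0,Kg_1,\ldots)=(K;Kg_1,Kg_2,\ldots)$. The Poisson boundary $(B(\mathrm{Sub}_G),\nu_\lambda)$ is the space of ergodic components of $\tilde\sigma$: a standard Borel probability space with a nonsingular $G$-action and a $G$-equivariant Borel map $\mathrm{bnd}$ from a conull subset of $\widetilde{\mathrm{Sub}_G}$ to $B(\mathrm{Sub}_G)$ such that $\mathrm{bnd}_*\mathbb P_\lambda=\nu_\lambda$ and the pullback of the Borel $\sigma$-algebra is the $\sigma$-algebra of $\tilde\sigma$-invariant Borel sets, modulo null sets. The measure $\nu_\lambda$ is $\mu$-stationary, i.e. $\nu_\lambda=\sum_g\mu(g)g_*\nu_\lambda$. Finally $h_\mu(\lambda):=h_\mu(B(\mathrm{Sub}_G),\nu_\lambda)$, where for a $\mu$-stationary space $(X,\eta)$, $h_\mu(X,\eta):=\iint-\log\frac{d\eta\circ g}{d\eta}(x)\,d\eta(x)\,d\mu(g)$ with $\eta\circ g(E)=\eta(gE)$. *)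

(* Defs.v *)
From HB Require Import structures.
From mathcomp Require Import all_boot all_order all_algebra.
From mathcomp Require Import all_classical all_reals all_analysis.

Set Implicit Arguments.
Unset Strict Implicit.
Unset Printing Implicit Defensive.

Import Order.TTheory GRing.Theory Num.Theory.
Import numFieldNormedType.Exports.

Local Open Scope classical_set_scope.
Local Open Scope charge_scope.
Local Open Scope ring_scope.

(* Probability measures on a countable discrete group are given by their mass
   functions. *)

Section MassFunctions.
Variables (R : realType) (G : groupType).
Implicit Types mu : G -> R.

Definition is_pmf mu : Prop :=
  (forall g, 0 <= mu g) /\ (\esum_(g in [set: G]) (mu g)%:E = 1)%E.

Definition admissible mu : Prop :=
  forall S : set G,
    [set g | mu g != 0] `<=` S ->
    (forall g h, S g -> S h -> S (g * h)%g) ->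
    S = [set: G].

Definition convolution mu1 mu2 : G -> R :=
  fun g => fine (\esum_(h in [set: G]) (mu1 h * mu2 (h^-1 * g)%g)%:E).

Fixpoint convolution_power mu (n : nat) : G -> R :=
  if n is m.+1 then convolution (convolution_power mu m) mu
  else fun g => (g == 1%g)%:R.

Definition pmf_integral mu (f : G -> \bar R) : \bar R :=
  (\esum_(g in [set: G]) ((mu g)%:E * f^\+ g)
   - \esum_(g in [set: G]) ((mu g)%:E * f^\- g))%E.

End MassFunctions.

(* The convention 0 log 0 = 0 holds since [ln 0 = 0]. *)
Definition entropy (R : realType) (T : choiceType) (W : set T) (w : T -> R)
    : \bar R :=
  \esum_(x in W) (- (w x * ln (w x)))%:E.

Notation borel T := (g_sigma_algebraType (@open T)).

Section Subgroups.
Variable G : groupType.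

(* The compact space 2^G; right cosets K g are points of it as well. *)
Definition subsets := {ptws G -> bool}.

HB.instance Definition _ := Topological.on subsets.

Definition is_subgroup (K : subsets) : Prop :=
  group_closed (K : {pred G}).

Definition SubG := set_type [set K : subsets | is_subgroup K].

HB.instance Definition _ := Topological.on SubG.

Definition rcoset_by (K : subsets) (g : G) : subsets := fun x => K (x * g^-1)%g.

(* K \ G *)
Definition rcosets_by (K : subsets) : set subsets := range (rcoset_by K).

Definition conj_by (g : G) (K : subsets) : subsets :=
  fun x => K (g^-1 * x * g)%g.

Definition translate_by (g : G) (S : subsets) : subsets :=
  fun x => S (g^-1 * x)%g.

Lemma is_subgroup1 : is_subgroup (pred1 1%g : subsets).
Proof.
split=> [|x y]; rewrite !unfold_in ?eqxx// => /eqP-> /eqP->.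
by rewrite divg1.
Qed.

HB.instance Definition _ := isPointed.Build SubG
  (exist _ (pred1 1%g : subsets) (mem_set is_subgroup1)).

Lemma is_subgroup_conj g (K : SubG) : is_subgroup (conj_by g (val K)).
Proof.
case: K => K /= /set_mem [K1 KB]; split=> [|x y Kx Ky].
  by rewrite unfold_in /conj_by mulg1 mulVg.
have := KB _ _ Kx Ky; rewrite !unfold_in /conj_by.
by rewrite !invgM invgK !mulgA mulgK.
Qed.

Definition conj_SubG (g : G) (K : SubG) : SubG :=
  exist _ (conj_by g (val K)) (mem_set (is_subgroup_conj g K)).

Definition is_coset_path (p : SubG * {ptws nat -> subsets}) : Prop :=
  forall n, rcosets_by (val p.1) (p.2 n).

Definition tSubG := set_type [set p | is_coset_path p].

HB.instance Definition _ := Topological.on tSubG.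

Lemma coset_path_subproof (K : SubG) (g : nat -> G) :
  is_coset_path (K, fun n => rcoset_by (val K) (g n)).
Proof. by move=> n; exists (g n). Qed.

(* (K; K g_0, K g_1, ...) *)
Definition coset_path (K : SubG) (g : nat -> G) : tSubG :=
  exist _ (K, fun n => rcoset_by (val K) (g n) : subsets)
    (mem_set (coset_path_subproof K g)).

HB.instance Definition _ := isPointed.Build tSubG
  (coset_path point (fun=> 1%g)).

Lemma shift_subproof (p : tSubG) :
  is_coset_path ((val p).1, fun n => (val p).2 n.+1).
Proof. by case: p => p /= /set_mem Hp n; exact: Hp. Qed.

Definition path_shift (p : tSubG) : tSubG :=
  exist _ ((val p).1, fun n => (val p).2 n.+1 : subsets)
    (mem_set (shift_subproof p)).

Lemma act_tSub_subproof (g : G) (p : tSubG) :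
  is_coset_path
    (conj_SubG g (val p).1, fun n => translate_by g ((val p).2 n)).
Proof.
case: p => p /= /set_mem Hp n /=; have [h _ <-] := Hp n.
exists (g * h)%g => //; apply: funext => x.
by rewrite /rcoset_by /conj_by /translate_by invgM !mulgA mulgVK.
Qed.

Definition act_tSubG (g : G) (p : tSubG) : tSubG :=
  exist _ (conj_SubG g (val p).1, fun n => translate_by g ((val p).2 n) : subsets)
    (mem_set (act_tSub_subproof g p)).

End Subgroups.

(* mu_K, the image of mu under the quotient map G -> K \ G. *)
Definition coset_law (R : realType) (G : groupType) (mu : G -> R)
    (K : subsets G) : subsets G -> R :=
  fun C => fine (\esum_(g in rcoset_by K @^-1` [set C]) (mu g)%:E).

(* H(mu^n_K) *)
Definition coset_entropy (R : realType) (G : groupType) (mu : G -> R)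
    (n : nat) (K : SubG G) : \bar R :=
  entropy (rcosets_by (val K)) (coset_law (convolution_power mu n) (val K)).

Section RandomWalk.
Context (R : realType) (G : groupType) (d : measure_display)
        (Omega : measurableType d) (P : probability Omega R).
Variable X : nat -> Omega -> G.

(* Here X i stands for X_{i+1}. *)
Record iid_with_law (mu : G -> R) : Prop := {
  iid_measurable : forall i (A : set G), measurable (X i @^-1` A) ;
  iid_law : forall i g, P (X i @^-1` [set g]) = (mu g)%:E ;
  iid_independent : forall (J : seq nat) (A : nat -> set G), uniq J ->
    P (\bigcap_(i in [set` J]) X i @^-1` A i)
    = (\prod_(i <- J) P (X i @^-1` A i))%E }.

Fixpoint walk (w : Omega) (n : nat) : G :=
  if n is m.+1 then (walk w m * X m w)%g else 1%g.

(* The law of (K; K, K X_1, K X_1 X_2, ...). *)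
Definition P_ (K : SubG G) : set (tSubG G) -> \bar R :=
  fun E => P [set w | E (coset_path K (walk w))].

Definition P_int (lambda : probability (borel (SubG G)) R) :
    set (tSubG G) -> \bar R :=
  fun E => (\int[lambda]_K P_ K E)%E.

End RandomWalk.

Definition conj_invariant (R : realType) (G : groupType)
    (lambda : probability (borel (SubG G)) R) : Prop :=
  forall g (A : set (borel (SubG G))), measurable A ->
    lambda (conj_SubG g @^-1` A) = lambda A.

Definition standard_borel (R : realType) (d : measure_display)
    (B : measurableType d) : Prop :=
  exists (T : completePseudoMetricType R) (f : B -> T),
    [/\ hausdorff_space T,
        exists2 D : set T, countable D & dense D,
        bijective f &
        forall A : set B, measurable A <-> <<s @open T >> (f @` A)].

Section Boundary.
Context (R : realType) (G : groupType) (d : measure_display)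
        (B : measurableType d).
Implicit Types (act : G -> {mfun B >-> B}) (nu : probability B R).

Definition is_measurable_action act : Prop :=
  (forall b, act 1%g b = b) /\
  (forall g h b, act (g * h)%g b = act g (act h b)).

Definition nonsingular act nu : Prop :=
  forall g (A : set B), measurable A -> nu (act g @^-1` A) = 0%E <-> nu A = 0%E.

(* E |-> nu (g E) *)
Definition nu_comp act nu (g : G) : probability B R :=
  distribution nu (act (g^-1)%g).

Definition furstenberg_entropy (mu : G -> R) act nu : \bar R :=
  pmf_integral mu (fun g =>
    \int[nu]_x
      (- lne (('d (charge_of_finite_measure (nu_comp act nu g)) '/d nu) x)))%E.

(* [P] is carried by the paths (K; K g_0, K g_1, ...) with K g_0 = K and its
   image under g by those with K g_0 = K g, so [P] is not G-quasi-invariant.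
   "Modulo null sets" refers to the G-invariant class of the sets that are null
   for all the translates of [P].  For shift-invariant Borel sets this is the
   same as being [P]-null when mu is admissible, but comparing the pullback of a
   set under bnd with an invariant set only up to [P]-null sets would put no
   constraint on the action of G on the boundary: for trivial K, any map on the
   paths issued from e extends equivariantly, whatever that action is. *)
Definition null_path_set (P : set (tSubG G) -> \bar R) (E : set (tSubG G)) : Prop :=
  forall g, P (act_tSubG g @^-1` E) = 0%E.

Record is_poisson_boundary (P : set (tSubG G) -> \bar R) act nu
    (D : set (borel (tSubG G))) (bnd : borel (tSubG G) -> B) : Prop := {
  bnd_standard : standard_borel R B ;
  bnd_action : is_measurable_action act ;
  bnd_nonsingular : nonsingular act nu ;
  bnd_dom_measurable : measurable D ;
  bnd_dom_conull : P (~` D) = 0%E ;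
  bnd_dom_invariant : forall g x, D x -> D (act_tSubG g x) ;
  bnd_measurable : measurable_fun D bnd ;
  bnd_equivariant : forall g x, D x -> bnd (act_tSubG g x) = act g (bnd x) ;
  bnd_law : forall A, measurable A -> nu A = P (D `&` bnd @^-1` A) ;
  bnd_pullback_invariant : forall A, measurable A ->
    exists I : set (borel (tSubG G)),
      [/\ measurable I, @path_shift G @^-1` I = I &
          null_path_set P ((D `&` bnd @^-1` A) `+` I)] ;
  bnd_invariant_pullback : forall I : set (borel (tSubG G)),
    measurable I -> @path_shift G @^-1` I = I ->
    exists A, measurable A /\ null_path_set P ((D `&` bnd @^-1` A) `+` I) }.

End Boundary.

(* Main.v *)
From HB Require Import structures.
Require Import Defs.
From mathcomp Require Import all_boot all_order all_algebra.
From mathcomp Require Import all_classical all_reals all_analysis.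
From mathcomp Require Import zify measurable_realfun.
From Stdlib Require Import Ring.

(** For a mass function p on G, let M_p be the law of (K; Kx, KxX_1, ...) with
    K ~ lambda and x ~ p independent, and let kappa_p be the p-mass of the first
    coset of a path.  Then int kappa_p / kappa_q * F dM_q = int F dM_p for p
    dominated by q, the shift sends M_p to M_(p * mu), and conjugation invariance
    of lambda makes g send M_p to M_(gp).  With L(p, q) = - int ln kappa_q dM_p,
    the integral of H(mu^n_K) is a_n = L(mu^n, mu^n).

    If p commutes with mu, then L(p * mu, p * mu) - L(p, p) is the mu-average over
    g of the divergences D(gp, p * mu), which decrease when p is replaced by
    p * mu (data processing).  So the increments of a_n decrease to the common
    limit h' of both pairs of limits and infima.

    To identify h' with the Furstenberg entropy, fix k > 0 with mu^k(1) > 0 and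
    replace mu^n by beta_n = (mu^n + ... + mu^(n+k-1)) / k.  The entropies change
    by a bounded amount, so their increments have the same limit, and
    |beta_(n+m) - beta_n| -> 0 for every m, by comparison of consecutive binomial
    distributions.  The densities V_n = (kappa_(g beta_n) / kappa_(beta_(n+1))) o
    shift^n are a bounded reverse martingale under M_(beta_1), hence Cauchy in L^2,
    and V_n o shift^m is close to V_(n+m), so the limit Psi can be chosen
    shift-invariant.  It is the density of P_g (x = g) with respect to P_1 on invariant
    sets, so it comes from the density f of g nu with respect to nu on the
    boundary, and lim D(g beta_n, beta_(n+1)) = int (f ln f - f + 1) dnu is the
    Furstenberg term of g.  Summing over g gives h = h'. *)

Set Implicit Arguments.
Unset Strict Implicit.
Unset Printing Implicit Defensive.

Import Order.TTheory GRing.Theory Num.Theory.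
Import numFieldNormedType.Exports.

Local Open Scope classical_set_scope.
Local Open Scope ring_scope.
Local Open Scope ereal_scope.

(** * Borel structure of the space of coset paths *)

(** The averages are forced by periodicity: for a walk on the integers with odd steps, mu^n and
    mu^(n+1) are mutually singular for every n, so |mu^(n+m) - mu^n| -> 0 fails. When mu^k(1) > 0, a
    step of mu^k is lazy, which makes mu^(n+k) and mu^n close, and beta_(n+1) - beta_n = (mu^(n+k) -
    mu^n) / k inherits this for a single step.

    The bound behind all limit theorems is mu(g) g beta_n <= mu * beta_n = beta_(n+1), so V_n <= 1 /
    mu(g). It only needs mu(g) > 0, and other g carry no weight in the final sum.

    Entropies live in [0, +oo], where subtraction is delicate. Divergences therefore use v ln v - v
    + 1 >= 0, which has the same integral as v ln v because densities integrate to 1, and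
    inequalities are stated between sums of nonnegative integrals, finiteness being used only to
    cancel at the end.

    Psi has to be invariant at every point and not only almost everywhere: the boundary is tied to
    sets that equal their preimage under the shift. This is why Psi is built as an iterated upper
    limit along the orbit. *)

Lemma cvg_initial (S : choiceType) (T : topologicalType) (f : S -> T)
    (F : set_system S) (s : S) :
  Filter F -> f @ F --> f s -> F --> (s : initial_topology f).
Proof.
move=> FF cvfFfs A /= [_ [[B Bop <-] Bfs sBfA]].
rewrite nbhs_filterE; apply: filterS sBfA _; apply: cvfFfs.
exact: open_nbhs_nbhs.
Qed.

Lemma cvg_ptws (I : Type) (T : topologicalType) (F : set_system (I -> T))
    (f : I -> T) :
  Filter F -> (forall i, g i @[g --> F] --> f i) ->
  F --> (f : {ptws I -> T}).
Proof.
by move=> FF Fi; apply/cvg_sup => i; apply: cvg_initial; exact: Fi.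
Qed.

Lemma countable_seq (I : Type) :
  countable [set: I] -> countable [set: seq (I * bool)].
Proof. by move=> /Pcountable[I' ->]; exact: countableP. Qed.

Section CountableCylinders.
Context (T : topologicalType) (I : choiceType) (ev : I -> T -> bool).
Hypothesis I_countable : countable [set: I].
Hypothesis cvg_ev : forall (F : set_system T) (p : T), Filter F ->
  (forall i, F [set q | ev i q = ev i p]) -> F --> p.

Let cyl (L : seq (I * bool)) : set T :=
  [set q | forall i, i \in L -> ev i.1 q = i.2].

(** Cylinders around p form a filter on which every coordinate is eventually constant, so [cvg_ev]
    makes it finer than the neighbourhood filter of p. *)
Let around (p : T) : set_system T :=
  [set U | exists2 L, cyl L p & cyl L `<=` U].

Let around_filter p : Filter (around p).
Proof.
split.
- by exists [::].
- move=> U V [L Lp LU] [L' L'p L'V]; exists (L ++ L').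
    by move=> i; rewrite mem_cat => /orP[/Lp|/L'p].
  move=> q Lq; split; [apply: LU|apply: L'V] => i iL; apply: Lq;
    by rewrite mem_cat iL ?orbT.
- by move=> U V UV [L Lp LU]; exists L => //; exact: subset_trans LU UV.
Qed.

Let open_cylE (U : set T) : open U ->
  U = \bigcup_(L in [set L | cyl L `<=` U]) cyl L.
Proof.
move=> oU; apply/seteqP; split=> [p Up|p [L LU /LU]//].
have := @cvg_ev (around p) p (around_filter p).
have Fi : forall i, around p [set q | ev i q = ev i p].
  move=> i; exists [:: (i, ev i p)].
    by move=> j; rewrite inE => /eqP ->.
  by move=> q /(_ (i, ev i p)); apply; rewrite inE.
move=> /(_ Fi U); rewrite nbhs_filterE => H.
have [L Lp LU] : around p U by apply: H; apply: open_nbhs_nbhs.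
by exists L.
Qed.

(** Cylinders are indexed by the countable set of finite lists, so every open set is a countable
    union of them, and measurability into the Borel structure can be tested on the Boolean
    coordinates alone. *)
Lemma measurable_borel d (S : measurableType d) (f : S -> T) :
  (forall i, measurable [set s | ev i (f s)]) ->
  forall U : set T, <<s @open T >> U -> measurable (f @^-1` U).
Proof.
move=> fm.
have evm i b : measurable [set s | ev i (f s) = b].
  case: b; first exact: fm.
  rewrite (_ : [set _ | _] = ~` [set s | ev i (f s)]).
    exact: measurableC.
  by apply/seteqP; split=> s /=; case: (ev i (f s)).
have cylm L : measurable (f @^-1` cyl L).
  elim: L => [|[i b] L IHL].
    by rewrite (_ : _ @^-1` _ = setT)//; apply/seteqP; split=> s.
  rewrite (_ : _ @^-1` _ = [set s | ev i (f s) = b] `&` f @^-1` cyl L).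
    exact: measurableI.
  apply/seteqP; split=> s.
    move=> Ls; split; first by apply: (Ls (i, b)); rewrite inE eqxx.
    by move=> j jL; apply: Ls; rewrite inE jL orbT.
  by move=> [/= s1 s2] j; rewrite inE => /orP[/eqP->|/s2].
suff : <<s @open T >> `<=` [set U | measurable (f @^-1` U)] by exact.
apply: smallest_sub.
  split.
  - by rewrite /= preimage_set0; exact: measurable0.
  - by move=> A mA; rewrite /= setTD -preimage_setC; exact: measurableC.
  - by move=> F mF; rewrite /= preimage_bigcup; apply: bigcup_measurable => n _; exact: mF.
move=> U oU /=; rewrite (open_cylE oU) preimage_bigcup bigcup_mkcond.
apply: countable_bigcupT_measurable; first exact: countable_seq.
by move=> L; case: ifPn => // _; exact: cylm.
Qed.
End CountableCylinders.

Lemma cvg_SubG (G : groupType) (F : set_system (SubG G)) (K : SubG G) :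
  Filter F -> (forall z, F [set K' | val K' z = val K z]) -> F --> K.
Proof.
move=> FF FK; apply: (@cvg_initial _ _ (@set_val _ _)).
apply: (@cvg_ptws _ _ (set_val @ F)) => z U /nbhs_singleton Uz.
change (F [set K' : SubG G | U (set_val K' z)]).
by apply: (filterS _ (FK z)) => K' K'z; move: Uz; rewrite /= -[X in U X]K'z.
Qed.

Section PathSpace.
Variable G : groupType.

(** A path is a point of a countable power of bool: index [None] reads the subgroup and [Some n] its
    n-th coset. *)
Definition coord (i : option nat * G) (p : tSubG G) : bool :=
  if i.1 is Some n then (val p).2 n i.2 else val (val p).1 i.2.

Lemma cvg_tSubG (F : set_system (tSubG G)) (p : tSubG G) :
  Filter F -> (forall i, F [set q | coord i q = coord i p]) -> F --> p.
Proof.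
move=> FF Fp; apply: (@cvg_initial _ _ (@set_val _ _)).
have F1 : (set_val q).1 @[q --> F] --> (set_val p).1.
  apply: cvg_SubG => z; apply: (filterS _ (Fp (None, z))) => q; exact.
have F2 : (set_val q).2 @[q --> F] --> ((set_val p).2 : {ptws nat -> subsets G}).
  apply: cvg_ptws => n.
  apply: (@cvg_ptws _ _ ((set_val q).2 n @[q --> F])) => z U /nbhs_singleton Uz.
  change (F [set q : tSubG G | U ((set_val q).2 n z)]).
  by apply: (filterS _ (Fp (Some n, z))) => q qz; move: Uz; rewrite /= -[X in U X]qz.
have := cvg_pair F1 F2.
have -> : (fun q : tSubG G => ((set_val q).1, (set_val q).2)) = set_val.
  by apply/funext => q; case: (set_val q).
move=> H; have {}H := H _ _ _.
by case: (set_val p) H => a b; apply.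
Qed.
End PathSpace.

Section BorelStructure.
Variable G : groupType.
Hypothesis G_countable : countable [set: G].

Lemma open_SubG_mem z : open [set K : SubG G | val K z].
Proof.
have -> : [set K : SubG G | val K z] =
    set_val @^-1` ((fun f : subsets G => f z) @^-1` [set true]).
  by apply/seteqP; split => K.
apply: open_comp; first by move=> ? _; exact: initial_continuous.
apply: open_comp; first by move=> ? _; exact: proj_continuous.
exact: discrete_open.
Qed.

Lemma open_coord (i : option nat * G) : open [set p : tSubG G | coord i p].
Proof.
case: i => -[n|] z; last first.
  have -> : [set p : tSubG G | coord (None, z) p] =
      set_val @^-1` (fst @^-1` [set K : SubG G | val K z]).
    by apply/seteqP; split => K.
  apply: open_comp; first by move=> ? _; exact: initial_continuous.
  apply: open_comp; first by move=> ? _; exact: cvg_fst.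
  exact: open_SubG_mem.
have -> : [set p : tSubG G | coord (Some n, z) p] =
    set_val @^-1` (snd @^-1` ((fun f : {ptws nat -> subsets G} => f n) @^-1`
      ((fun f : subsets G => f z) @^-1` [set true]))).
  by apply/seteqP; split => K.
apply: open_comp; first by move=> ? _; exact: initial_continuous.
apply: open_comp; first by move=> ? _; exact: cvg_snd.
apply: open_comp; first by move=> ? _; exact: proj_continuous.
apply: open_comp; first by move=> ? _; exact: proj_continuous.
exact: discrete_open.
Qed.

Lemma measurable_SubG_mem z : measurable [set K : borel (SubG G) | val K z].
Proof. by apply: sub_sigma_algebra; exact: open_SubG_mem. Qed.

Lemma measurable_coord i : measurable [set p : borel (tSubG G) | coord i p].
Proof. by apply: sub_sigma_algebra; exact: open_coord. Qed.

Lemma measurable_fun_SubG d (S : measurableType d) (f : S -> borel (SubG G)) :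
  (forall z, measurable [set s | val (f s) z]) -> measurable_fun setT f.
Proof.
move=> fm _ U mU; rewrite setTI.
exact: (@measurable_borel _ _ (fun z (K : SubG G) => val K z) G_countable
  (@cvg_SubG G) _ _ f fm U mU).
Qed.

Lemma measurable_fun_tSubG d (S : measurableType d) (f : S -> borel (tSubG G)) :
  (forall i, measurable [set s | coord i (f s)]) -> measurable_fun setT f.
Proof.
move=> fm _ U mU; rewrite setTI.
have cI : countable [set: option nat * G].
  by rewrite -setXTT; apply: countableX => //; exact: countableP.
exact: (@measurable_borel _ _ (@coord G) cI (@cvg_tSubG G) _ _ f fm U mU).
Qed.

Lemma measurable_path_shift :
  measurable_fun setT (@path_shift G : borel (tSubG G) -> borel (tSubG G)).
Proof.
apply: measurable_fun_tSubG => -[[n|] z].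
  exact: (measurable_coord (Some n.+1, z)).
exact: (measurable_coord (None, z)).
Qed.

Lemma measurable_act_tSubG g :
  measurable_fun setT (@act_tSubG G g : borel (tSubG G) -> borel (tSubG G)).
Proof.
apply: measurable_fun_tSubG => -[[n|] z].
  exact: (measurable_coord (Some n, g^-1 * z)%g).
exact: (measurable_coord (None, g^-1 * z * g)%g).
Qed.

Lemma measurable_conj_SubG g :
  measurable_fun setT (@conj_SubG G g : borel (SubG G) -> borel (SubG G)).
Proof.
by apply: measurable_fun_SubG => z; exact: (measurable_SubG_mem (g^-1 * z * g)%g).
Qed.

Lemma measurable_fun_coset_path d (S : measurableType d)
    (K : S -> borel (SubG G)) (w : S -> nat -> G) :
  measurable_fun setT K ->
  (forall n g, measurable [set s | w s n = g]) ->
  measurable_fun setT (fun s => coset_path (K s) (w s) : borel (tSubG G)).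
Proof.
move=> mK mw.
have mKz z : measurable [set s | val (K s) z].
  by rewrite -[X in measurable X]setTI; exact: (mK measurableT _ (measurable_SubG_mem z)).
apply: measurable_fun_tSubG => -[[n|] z]; last exact: mKz.
(* The coset K g contains z exactly when z g^-1 lies in K; splitting over the countably many values
   of g separates K from g. *)
have -> : [set s | coord (Some n, z) (coset_path (K s) (w s))] =
    \bigcup_g ([set s | val (K s) (z * g^-1)%g] `&` [set s | w s n = g]).
  apply/seteqP; split => [s sz|s [g _ [/= sz sg]]]; first by exists (w s n).
  by rewrite /coord/= sg.
apply: countable_bigcupT_measurable => // g.
exact: measurableI.
Qed.
End BorelStructure.

(** * Sums over a countable group and convolution *)

Section EsumTools.
Variable R : realType.

Lemma esum_exchange (T1 T2 : choiceType) (a : T1 -> T2 -> \bar R) :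
  (forall x y, 0 <= a x y) ->
  \esum_(x in [set: T1]) \esum_(y in [set: T2]) a x y =
  \esum_(y in [set: T2]) \esum_(x in [set: T1]) a x y.
Proof.
move=> a0; rewrite !esum_esum//.
rewrite (reindex_esum ([set: T2] `*`` (fun=> [set: T1])) _ (fun k => (k.2, k.1)))//.
split=> //; first by move=> [x y] [x' y'] _ _ [-> ->].
by move=> [x y] _; exists (y, x).
Qed.

Let esumZl_fin (T : choiceType) (S : set T) (c : R) (a : T -> \bar R) :
  (0 <= c)%R -> (forall x, 0 <= a x) ->
  \esum_(x in S) (c%:E * a x) = c%:E * \esum_(x in S) a x.
Proof.
move=> c0 a0.
(* One inequality suffices: it is used for c, and then for c^-1 to obtain the reverse one. *)
have H (c' : R) (b : T -> \bar R) : (0 <= c')%R -> (forall x, 0 <= b x) ->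
    \esum_(x in S) (c'%:E * b x) <= c'%:E * \esum_(x in S) b x.
  move=> c'0 b0; apply: ge_ereal_sup => _ [X [finX XS] <-].
  rewrite -ge0_mule_fsumr//; apply: lee_wpmul2l; first by rewrite lee_fin.
  by apply: ereal_sup_ubound; exists X.
move: c0; rewrite le_eqVlt => /predU1P[<-|c0].
  by rewrite mul0e esum1// => x _; rewrite mul0e.
apply/eqP; rewrite eq_le; apply/andP; split; first by apply: H => //; exact: ltW.
rewrite -[leRHS]mul1e -(divff (lt0r_neq0 c0)) EFinM -muleA.
apply: lee_wpmul2l; first by rewrite lee_fin ltW.
apply: le_trans (H _ _ _ _); last 2 first.
- by rewrite invr_ge0 ltW.
- by move=> x; rewrite mule_ge0// lee_fin ltW.
by apply: le_esum => x _; rewrite muleA -EFinM mulVf ?gt_eqF// mul1e.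
Qed.

Lemma esumZl (T : choiceType) (S : set T) (c : \bar R) (a : T -> \bar R) :
  0 <= c -> (forall x, 0 <= a x) ->
  \esum_(x in S) (c * a x) = c * \esum_(x in S) a x.
Proof.
case: c => [c c0 a0|_ a0|//]; first exact: esumZl_fin.
have := @esum_ge0 _ _ S a (fun x _ => a0 x).
rewrite le_eqVlt => /predU1P[S0|Sgt0].
  rewrite -S0 mule0 esum1// => x Sx.
  suff -> : a x = 0 by rewrite mule0.
  apply/eqP; rewrite eq_le a0 andbT S0; apply: esum_ge.
  by exists [set x]; [split=> //; move=> _ ->|rewrite fsbig_set1].
rewrite gt0_mulye//; apply/eqP; rewrite -leye_eq.
have [x Sx ax] : exists2 x, S x & 0 < a x.
  apply/not_exists2P => H; move: Sgt0; rewrite esum1 ?ltxx// => x Sx.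
  by apply/eqP; rewrite eq_le a0 andbT leNgt; apply/negP; case: (H x).
apply: esum_ge; exists [set x]; first by split=> //; move=> _ ->.
by rewrite fsbig_set1 gt0_mulye.
Qed.

Lemma esum_ge_term (T : choiceType) (a : T -> \bar R) (x : T) :
  (forall x, 0 <= a x) -> a x <= \esum_(y in [set: T]) a y.
Proof.
move=> a0; rewrite -(esum_set1 (a0 x)) [leLHS]esum_mkcond.
by apply: le_esum => y _; case: ifP.
Qed.

Lemma esum_indic1 (T : choiceType) (x : T) (a : T -> \bar R) : 0 <= a x ->
  \esum_(y in [set: T]) (if y == x then a y else 0) = a x.
Proof.
move=> a0; rewrite -[RHS](esum_set1 a0) [RHS]esum_mkcond.
apply: eq_esum => y _; case: eqVneq => [->|yx]; first by rewrite mem_set.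
by rewrite memNset//=; apply/eqP.
Qed.

(* An enumeration of a countable type, which may be finite. *)
Lemma countable_enum (T : choiceType) : countable [set: T] ->
  exists e : nat -> option T, forall a : T -> \bar R, (forall x, 0 <= a x) ->
    \esum_(x in [set: T]) a x = \sum_(n <oo) oapp a 0 (e n).
Proof.
move=> /countable_injP[f finj].
pose e n : option T := if pselect (exists x, f x = n) is left H
  then Some (projT1 (cid H)) else None.
have ef x : e (f x) = Some x.
  rewrite /e; case: pselect => [H|]; last by case; exists x.
  by case: cid => y /= fy; congr Some; apply: finj; rewrite ?inE.
exists e => a a0.
rewrite nneseries_esumT; last by move=> n; case: (e n) => /=.
transitivity (\esum_(n in range f) oapp a 0 (e n)).
  rewrite (reindex_esum setT _ f); last by split; [move=> x _; exists x|move=> x y _ _ /finj->; rewrite ?inE|].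
  by apply: eq_esum => x _; rewrite ef.
rewrite esum_mkcond; apply: eq_esum => n _; case: ifPn => // /negP nf.
rewrite /e; case: pselect => //= -[x fx]; exfalso; apply: nf.
by rewrite inE; exists x.
Qed.

Lemma measurable_fun_esum d (S : measurableType d) (T : choiceType)
    (D : set S) (F : T -> S -> \bar R) : countable [set: T] ->
  (forall x s, 0 <= F x s) -> (forall x, measurable_fun D (F x)) ->
  measurable_fun D (fun s => \esum_(x in [set: T]) F x s).
Proof.
move=> /countable_enum[e eE] F0 mF.
under eq_fun do rewrite eE//.
apply: ge0_emeasurable_sum.
  by move=> n s _ _; case: (e n) => /=.
by move=> n _; case: (e n) => [x|]/=; [exact: mF|exact: measurable_cst].
Qed.

Lemma integral_esum d (S : measurableType d) (m : {measure set S -> \bar R})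
    (T : choiceType) (F : T -> S -> \bar R) : countable [set: T] ->
  (forall x s, 0 <= F x s) -> (forall x, measurable_fun setT (F x)) ->
  \int[m]_s (\esum_(x in [set: T]) F x s) = \esum_(x in [set: T]) (\int[m]_s F x s).
Proof.
move=> /countable_enum[e eE] F0 mF.
rewrite eE; last by move=> x; exact: integral_ge0.
under eq_integral do rewrite eE//.
rewrite integral_nneseries//.
- apply: eq_eseriesr => n _; case: (e n) => //=; first by rewrite integral0.
- by move=> n; case: (e n) => [x|]/=; [exact: mF|exact: measurable_cst].
- by move=> n s _; case: (e n) => /=.
Qed.

End EsumTools.

Section MassFunctions.
Context (R : realType) (G : groupType).
Implicit Types (p q mu : G -> R) (F : G -> \bar R).

Definition mass_function p :=
  (forall x, (0 <= p x)%R) /\ \esum_(x in [set: G]) (p x)%:E < +oo.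

Definition wsum p F := \esum_(x in [set: G]) ((p x)%:E * F x).

Definition left_translate (g : G) p : G -> R := fun x => p (g^-1 * x)%g.

Lemma pmf_mass p : is_pmf p -> mass_function p.
Proof. by move=> [p0 p1]; split => //; rewrite p1 ltry. Qed.

Lemma wsum_ge0 p F : mass_function p -> (forall x, 0 <= F x) -> 0 <= wsum p F.
Proof. by move=> [p0 _] F0; apply: esum_ge0 => x _; rewrite mule_ge0 ?lee_fin. Qed.

Lemma le_wsum p F F' : mass_function p -> (forall x, (0 < p x)%R -> F x <= F' x) ->
  wsum p F <= wsum p F'.
Proof.
move=> [p0 _] FF'; apply: le_esum => x _.
have := p0 x; rewrite le_eqVlt => /predU1P[<-|px]; first by rewrite !mul0e.
by apply: lee_wpmul2l; rewrite ?FF' ?lee_fin.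
Qed.

Lemma eq_wsum p F F' : mass_function p -> (forall x, (0 < p x)%R -> F x = F' x) ->
  wsum p F = wsum p F'.
Proof. by move=> mp FF'; apply/eqP; rewrite eq_le !le_wsum// => x /FF'->. Qed.

Lemma wsumD p F F' : mass_function p -> (forall x, 0 <= F x) ->
  (forall x, 0 <= F' x) -> wsum p (fun x => F x + F' x) = wsum p F + wsum p F'.
Proof.
move=> [p0 _] F0 F'0; rewrite /wsum -esumD; last 2 first.
- by move=> x _; rewrite mule_ge0 ?lee_fin.
- by move=> x _; rewrite mule_ge0 ?lee_fin.
by apply: eq_esum => x _; rewrite ge0_muleDr.
Qed.

Lemma wsumZ p c F : mass_function p -> 0 <= c -> (forall x, 0 <= F x) ->
  wsum p (fun x => c * F x) = c * wsum p F.
Proof.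
move=> [p0 _] c0 F0; rewrite /wsum -esumZl//; last first.
  by move=> x; rewrite mule_ge0 ?lee_fin.
by apply: eq_esum => x _; rewrite muleCA.
Qed.

Lemma wsum_cst p c : mass_function p -> 0 <= c ->
  wsum p (cst c) = c * \esum_(x in [set: G]) (p x)%:E.
Proof.
move=> [p0 _] c0; rewrite -esumZl//.
by apply: eq_esum => x _; rewrite muleC.
Qed.

Lemma pmf_wsum_cst p c : is_pmf p -> 0 <= c -> wsum p (cst c) = c.
Proof. by move=> pp c0; rewrite wsum_cst ?pp.2 ?mule1//; exact: pmf_mass. Qed.

Lemma wsum_point p x : mass_function p ->
  wsum p (fun y => if y == x then 1 else 0) = (p x)%:E.
Proof.
move=> [p0 _]; rewrite -[RHS](@esum_indic1 _ _ x (EFin \o p)) ?lee_fin//.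
by apply: eq_esum => y _ /=; case: ifP; rewrite ?mule1 ?mule0.
Qed.

(** Identities between convolutions are all proved by testing against nonnegative functions, where
    [wsum_convolution] turns them into iterated sums. *)
Lemma wsum_ext p q : mass_function p -> mass_function q ->
  (forall F, (forall x, 0 <= F x) -> wsum p F = wsum q F) -> p = q.
Proof.
move=> mp mq pq; apply/funext => x; apply: EFin_inj.
by rewrite -!wsum_point// pq// => y; case: ifP.
Qed.

Lemma wsum_esum p (T : choiceType) (F : T -> G -> \bar R) : mass_function p ->
  (forall t x, 0 <= F t x) ->
  wsum p (fun x => \esum_(t in [set: T]) F t x) = \esum_(t in [set: T]) wsum p (F t).
Proof.
move=> [p0 _] F0; rewrite /wsum -esum_exchange; last first.
  by move=> x t; rewrite mule_ge0 ?lee_fin.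
by apply: eq_esum => x _; rewrite esumZl ?lee_fin.
Qed.

Lemma wsum_exchange p q (F : G -> G -> \bar R) : mass_function p -> mass_function q ->
  (forall x y, 0 <= F x y) ->
  wsum p (fun x => wsum q (F x)) = wsum q (fun y => wsum p (F ^~ y)).
Proof.
move=> mp mq F0; rewrite {2}/wsum wsum_esum//; last first.
  by move=> t x; rewrite mule_ge0// lee_fin; exact: mq.1.
by apply: eq_esum => y _; rewrite -wsumZ// lee_fin; exact: mq.1.
Qed.

Lemma wsum_translate g p F :
  wsum (left_translate g p) F = wsum p (fun x => F (g * x)%g).
Proof.
rewrite /wsum (reindex_esum setT setT (fun x => g * x)%g).
  by apply: eq_esum => x _; rewrite /left_translate mulKg.
split=> // [x y _ _|x _]; first exact: mulgI.
by exists (g^-1 * x)%g; rewrite ?mulVKg.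
Qed.

Lemma left_translate_mass g p : mass_function p -> mass_function (left_translate g p).
Proof.
move=> [p0 pfin]; split=> [x|]; first exact: p0.
have := wsum_translate g p (cst 1).
rewrite /wsum; under eq_esum do rewrite mule1.
by move=> ->; under eq_esum do rewrite mule1.
Qed.

Lemma left_translate_pmf g p : is_pmf p -> is_pmf (left_translate g p).
Proof.
move=> [p0 p1]; split=> [x|]; first exact: p0.
have := wsum_translate g p (cst 1).
rewrite /wsum; under eq_esum do rewrite mule1.
by move=> ->; under eq_esum do rewrite mule1.
Qed.

(** The [fine] in the definition is harmless: each value of q is at most its total mass, which
    bounds the sum by a finite product. *)
Lemma convolutionE p q x : mass_function p -> mass_function q ->
  (convolution p q x)%:E = wsum p (fun h => (q (h^-1 * x)%g)%:E).
Proof.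
move=> mp mq; rewrite /convolution fineK//.
set Q := \esum_(y in [set: G]) (q y)%:E.
have Q0 : 0 <= Q by apply: esum_ge0 => y _; rewrite lee_fin; exact: mq.1.
have Qfin : Q \is a fin_num by rewrite ge0_fin_numE//; exact: mq.2.
rewrite ge0_fin_numE; last first.
  by apply: esum_ge0 => y _; rewrite lee_fin mulr_ge0//; [exact: mp.1|exact: mq.1].
apply: (@le_lt_trans _ _ (wsum p (cst Q))).
  apply: le_esum => y _; rewrite EFinM; apply: lee_wpmul2l.
    by rewrite lee_fin; exact: mp.1.
  by apply: (@esum_ge_term _ _ (EFin \o q)) => z; rewrite lee_fin; exact: mq.1.
by rewrite wsum_cst// lte_mul_pinfty//; exact: mp.2.
Qed.

Lemma wsum_convolution p q F : mass_function p -> mass_function q ->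
  (forall x, 0 <= F x) ->
  wsum (convolution p q) F = wsum p (fun y => wsum q (fun z => F (y * z)%g)).
Proof.
move=> mp mq F0.
have -> : wsum (convolution p q) F = \esum_(x in [set: G])
    wsum p (fun h => (q (h^-1 * x)%g)%:E * F x).
  apply: eq_esum => x _; rewrite convolutionE// muleC -wsumZ//; last first.
    by move=> y; rewrite lee_fin; exact: mq.1.
  by congr wsum; apply/funext => y; rewrite muleC.
rewrite -wsum_esum//; last first.
  by move=> x y; rewrite mule_ge0// lee_fin; exact: mq.1.
by congr wsum; apply/funext => y; exact: wsum_translate.
Qed.

Lemma convolution_mass p q : mass_function p -> mass_function q ->
  mass_function (convolution p q).
Proof.
move=> mp mq; split=> [x|].
  rewrite -lee_fin convolutionE// wsum_ge0// => y.
  by rewrite lee_fin; exact: mq.1.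
have := @wsum_convolution p q (cst 1) mp mq (fun=> lee01).
rewrite {1}/wsum; under eq_esum do rewrite mule1.
move=> ->.
have -> : (fun y => wsum q (fun z => cst 1 (y * z)%g)) = cst (wsum q (cst 1)).
  by apply/funext => y.
rewrite [X in cst X]wsum_cst// mul1e wsum_cst//.
  rewrite lte_mul_pinfty ?mp.2 ?ge0_fin_numE ?mq.2//;
    by apply: esum_ge0 => *; rewrite lee_fin; exact: mq.1.
by apply: esum_ge0 => *; rewrite lee_fin; exact: mq.1.
Qed.

Lemma convolution_pmf p q : is_pmf p -> is_pmf q -> is_pmf (convolution p q).
Proof.
move=> pp pq; have mp := pmf_mass pp; have mq := pmf_mass pq.
split; first exact: (convolution_mass mp mq).1.
have := @wsum_convolution p q (cst 1) mp mq (fun=> lee01).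
rewrite {1}/wsum; under eq_esum do rewrite mule1.
move=> ->; rewrite -[RHS](@pmf_wsum_cst p 1)//.
by congr wsum; apply/funext => y; exact: pmf_wsum_cst.
Qed.

Lemma convolutionA p q r : mass_function p -> mass_function q -> mass_function r ->
  convolution (convolution p q) r = convolution p (convolution q r).
Proof.
move=> mp mq mr; have mpq := convolution_mass mp mq.
have mqr := convolution_mass mq mr.
apply: wsum_ext; [exact: convolution_mass|exact: convolution_mass|move=> F F0].
rewrite !wsum_convolution//; last by move=> x; exact: wsum_ge0.
congr wsum; apply/funext => x; rewrite wsum_convolution//.
by congr wsum; apply/funext => y; congr wsum; apply/funext => z; rewrite mulgA.
Qed.

Lemma left_translate_convolution g p q : mass_function p -> mass_function q ->
  convolution (left_translate g p) q = left_translate g (convolution p q).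
Proof.
move=> mp mq; have mgp := left_translate_mass g mp.
apply: wsum_ext; [exact: convolution_mass| |move=> F F0].
  by apply: left_translate_mass; exact: convolution_mass.
rewrite wsum_convolution// !wsum_translate wsum_convolution//.
by congr wsum; apply/funext => x; congr wsum; apply/funext => y; rewrite mulgA.
Qed.

Definition mixture (k : nat) (P : nat -> G -> R) : G -> R :=
  fun x => (k%:R^-1 * \sum_(i < k) P i x)%R.

Lemma wsum_mixture k (P : nat -> G -> R) F : (forall i, mass_function (P i)) ->
  (forall x, 0 <= F x) ->
  wsum (mixture k P) F = (k%:R^-1)%:E * \sum_(i < k) wsum (P i) F.
Proof.
move=> mP F0.
have PF0 i x : 0 <= (P i x)%:E * F x by rewrite mule_ge0// lee_fin; exact: (mP i).1.
rewrite /wsum -esum_sum; last by move=> *; exact: PF0.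
rewrite -esumZl ?lee_fin ?invr_ge0 ?ler0n//; last by move=> x; exact: sume_ge0.
apply: eq_esum => x _; rewrite /mixture EFinM -muleA; congr (_ * _).
by rewrite -sumEFin ge0_sume_distrl// => i _; rewrite lee_fin; exact: (mP i).1.
Qed.

Lemma mixture_ge0 k (P : nat -> G -> R) x : (forall i, mass_function (P i)) ->
  (0 <= mixture k P x)%R.
Proof.
move=> mP; rewrite mulr_ge0 ?invr_ge0 ?ler0n// sumr_ge0// => i _.
exact: (mP i).1.
Qed.

Lemma mixture_pmf k (P : nat -> G -> R) : (0 < k)%N -> (forall i, is_pmf (P i)) ->
  is_pmf (mixture k P).
Proof.
move=> k0 pP; have mP i := pmf_mass (pP i).
split=> [x|]; first exact: mixture_ge0.
have := @wsum_mixture k P (cst 1) mP (fun=> lee01).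
rewrite {1}/wsum; under eq_esum do rewrite mule1.
move=> ->; under eq_bigr do rewrite pmf_wsum_cst//.
by rewrite sumEFin sumr_const card_ord -EFinM mulVf// pnatr_eq0 -lt0n.
Qed.

Lemma mixture_le k (P : nat -> G -> R) i x : (forall i, mass_function (P i)) ->
  (i < k)%N -> (P i x <= k%:R * mixture k P x)%R.
Proof.
move=> mP ik; rewrite /mixture mulrA divff ?mul1r; last first.
  by rewrite pnatr_eq0 -lt0n; case: k ik.
rewrite (bigD1 (Ordinal ik))//= lerDl sumr_ge0// => j _; exact: (mP j).1.
Qed.

Lemma convolution_mixture k (P : nat -> G -> R) q : (0 < k)%N ->
  (forall i, is_pmf (P i)) -> is_pmf q ->
  convolution (mixture k P) q = mixture k (fun i => convolution (P i) q).
Proof.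
move=> k0 pP pq; have mP i := pmf_mass (pP i); have mq := pmf_mass pq.
have mM := pmf_mass (mixture_pmf k0 pP).
have mPq i := convolution_mass (mP i) mq.
apply: wsum_ext => [||F F0]; first exact: convolution_mass.
  by apply: pmf_mass; apply: mixture_pmf => // i; exact: convolution_pmf.
rewrite wsum_convolution// !wsum_mixture//; last by move=> x; exact: wsum_ge0.
by congr (_ * _); apply: eq_bigr => i _; rewrite wsum_convolution.
Qed.

Lemma mixture_convolution k (P : nat -> G -> R) q : (0 < k)%N ->
  (forall i, is_pmf (P i)) -> is_pmf q ->
  convolution q (mixture k P) = mixture k (fun i => convolution q (P i)).
Proof.
move=> k0 pP pq; have mP i := pmf_mass (pP i); have mq := pmf_mass pq.
have mM := pmf_mass (mixture_pmf k0 pP).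
have mPq i := convolution_mass mq (mP i).
apply: wsum_ext => [||F F0]; first exact: convolution_mass.
  by apply: pmf_mass; apply: mixture_pmf => // i; exact: convolution_pmf.
rewrite wsum_convolution// wsum_mixture//.
under eq_bigr do rewrite wsum_convolution//.
transitivity (wsum q (fun y => (k%:R^-1)%:E * \sum_(i < k) wsum (P i) (fun z => F (y * z)%g))).
  by congr wsum; apply/funext => y; rewrite wsum_mixture.
have W0 i y : 0 <= wsum (P i) (fun z => F (y * z)%g) by exact: wsum_ge0.
rewrite wsumZ ?lee_fin ?invr_ge0 ?ler0n//; last by move=> y; exact: sume_ge0.
congr (_ * _); rewrite /wsum -esum_sum; last first.
  by move=> y i _ _; apply: mule_ge0; [rewrite lee_fin; exact: mq.1|exact: W0].
apply: eq_esum => y _; rewrite ge0_sume_distrr//.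
by move=> i _; exact: W0.
Qed.

Lemma convolution_power_pmf mu n : is_pmf mu -> is_pmf (convolution_power mu n).
Proof.
move=> pmu; elim: n => [|n IHn]; last exact: convolution_pmf.
split=> [x|]; first by rewrite /= ler0n.
apply: etrans (@esum_indic1 R G 1%g (cst 1) lee01).
by apply: eq_esum => x _ /=; case: eqVneq.
Qed.

Lemma wsum_power0 mu F : (forall x, 0 <= F x) -> wsum (convolution_power mu 0) F = F 1%g.
Proof.
move=> F0; rewrite -(@esum_indic1 R G 1%g F)//.
by apply: eq_esum => x _ /=; case: eqVneq => _; rewrite ?mul1e ?mul0e.
Qed.

Lemma convolution1p p mu : mass_function p -> is_pmf mu ->
  convolution (convolution_power mu 0) p = p.
Proof.
move=> mp pmu; have m1 := pmf_mass (convolution_power_pmf 0 pmu).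
apply: wsum_ext => // [|F F0]; first exact: convolution_mass.
rewrite wsum_convolution// wsum_power0; last by move=> x; exact: wsum_ge0.
by congr wsum; apply/funext => y; rewrite mul1g.
Qed.

Lemma convolutionp1 p mu : mass_function p -> is_pmf mu ->
  convolution p (convolution_power mu 0) = p.
Proof.
move=> mp pmu; have m1 := pmf_mass (convolution_power_pmf 0 pmu).
apply: wsum_ext => // [|F F0]; first exact: convolution_mass.
rewrite wsum_convolution//; congr wsum; apply/funext => y.
by rewrite wsum_power0// mulg1.
Qed.

Lemma convolution_powerD mu m n : is_pmf mu ->
  convolution_power mu (m + n) =
  convolution (convolution_power mu m) (convolution_power mu n).
Proof.
move=> pmu; have mP i := pmf_mass (convolution_power_pmf i pmu).
have mmu := pmf_mass pmu.
elim: n => [|n IHn]; first by rewrite addn0 convolutionp1.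
by rewrite addnS [LHS]/= IHn [in RHS]/= convolutionA.
Qed.

Lemma convolution_le p q x y : mass_function p -> mass_function q ->
  (p x * q y <= convolution p q (x * y)%g)%R.
Proof.
move=> mp mq; rewrite -lee_fin convolutionE//.
rewrite -[in leLHS](mulKg x y) EFinM.
apply: (@esum_ge_term _ _ (fun h => (p h)%:E * (q (h^-1 * (x * y))%g)%:E)) => h.
by rewrite mule_ge0// lee_fin; [exact: mp.1|exact: mq.1].
Qed.

(** At g = 1 this yields the number k > 0 of averaged powers; n = 0 is excluded because mu^0(1) = 1
    would make the claim empty there. *)
Lemma admissible_power mu : is_pmf mu -> admissible mu ->
  forall g, exists2 n, (0 < n)%N & (0 < convolution_power mu n g)%R.
Proof.
move=> pmu amu; have mP i := pmf_mass (convolution_power_pmf i pmu).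
suff S : [set g | exists2 n, (0 < n)%N & (0 < convolution_power mu n g)%R] = [set: G].
  by move=> g; have : [set: G] g by []; rewrite -S.
apply: amu => [g /= mug|g h [m m0 mg] [n n0 nh]].
  exists 1%N => //; rewrite [X in (0 < X g)%R](convolution1p (pmf_mass pmu) pmu).
  by rewrite lt0r mug pmu.1.
exists (m + n)%N; first by rewrite addn_gt0 m0.
rewrite convolution_powerD//; apply: lt_le_trans (convolution_le _ _ _ _) => //.
exact: mulr_gt0.
Qed.

End MassFunctions.

(** * The random walk *)

Definition sequence (G : groupType) := nat -> G.
HB.instance Definition _ (G : groupType) := Choice.on (sequence G).
HB.instance Definition _ (G : groupType) :=
  isPointed.Build (sequence G) (fun=> 1%g).

Section Sequences.
Context (R : realType) (G : groupType).
Hypothesis G_countable : countable [set: G].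

Definition cylinder (t : seq G) : set (sequence G) :=
  [set s | forall i, (i < size t)%N -> s i = nth 1%g t i].

(** The empty set is included to make the family closed under intersection, as uniqueness of
    measures requires of a generator. *)
Definition cylinders : set (set (sequence G)) :=
  [set A | A = set0 \/ exists t, A = cylinder t].

Definition sequences := g_sigma_algebraType cylinders.

Lemma cylinder_nil : cylinder [::] = setT.
Proof. by apply/seteqP; split. Qed.

Lemma setI_cylinders : setI_closed cylinders.
Proof.
move=> A B [->|[t ->]]; first by left; rewrite set0I.
move=> [->|[t' ->]]; first by left; rewrite setI0.
wlog tt' : t t' / (size t <= size t')%N.
  by move=> H; have /orP[/H//|/H] := leq_total (size t) (size t'); rewrite setIC.
have [H|H] := pselect (forall i, (i < size t)%N -> nth 1%g t i = nth 1%g t' i).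
  right; exists t'; apply/seteqP; split=> [s [_ st']//|s st']; split=> // i it.
  by rewrite H// st'// (leq_trans it).
left; apply/seteqP; split=> // s [st st']; apply: H => i it.
by rewrite -st// st'// (leq_trans it).
Qed.

Lemma measurable_seq_coord d (T : measurableType d) (Y : nat -> T -> G) :
  (forall i g, measurable (Y i @^-1` [set g])) ->
  measurable_fun setT (fun w => (Y ^~ w : sequences)).
Proof.
move=> mY; apply: measurability => // _ [A [->|[t ->]] <-].
  by rewrite preimage_set0 setI0.
rewrite setTI; elim/last_ind: t => [|t g IHt].
  by rewrite cylinder_nil preimage_setT.
rewrite (_ : _ @^-1` _ = ((fun w => Y ^~ w) @^-1` cylinder t) `&` (Y (size t) @^-1` [set g])).
  exact: measurableI.
apply/seteqP; split=> w /=.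
  move=> H; split; last first.
    by have := H (size t); rewrite size_rcons ltnSn nth_rcons ltnn eqxx; exact.
  move=> i it; have := H i; rewrite size_rcons ltnS (ltnW it) nth_rcons it; exact.
move=> [H1 H2] i; rewrite size_rcons ltnS leq_eqVlt nth_rcons => /predU1P[->|it].
  by rewrite ltnn eqxx.
by rewrite it; exact: H1.
Qed.

Lemma measurable_sequence_coord i g : measurable [set s : sequences | s i = g].
Proof.
rewrite (_ : [set _ | _] = \bigcup_(t : seq G)
    (if (size t == i.+1) && (nth 1%g t i == g) then cylinder t else set0)).
  apply: countable_bigcupT_measurable.
    by move/Pcountable : G_countable => [G' ->]; exact: countableP.
  move=> t; case: ifP => // _.
  by apply: sub_sigma_algebra; right; exists t.
apply/seteqP; split=> [s /= sg|s /= [t _]].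
  exists (mkseq s i.+1) => //; rewrite size_mkseq eqxx nth_mkseq// sg eqxx /=.
  by move=> j; rewrite size_mkseq => ji; rewrite nth_mkseq.
by case: ifP => // /andP[/eqP ti /eqP <-]; apply; rewrite ti.
Qed.

Fixpoint partial_products (s : sequence G) (n : nat) : G :=
  if n is m.+1 then (partial_products s m * s m)%g else 1%g.

Lemma measurable_partial_products n g :
  measurable [set s : sequences | partial_products s n = g].
Proof.
elim: n g => [|n IHn] g /=.
  have [->|g1] := eqVneq 1%g g.
    by rewrite (_ : [set _ | _] = setT)//; apply/seteqP.
  by rewrite (_ : [set _ | _] = set0)//; apply/seteqP; split=> // w /= /eqP; rewrite (negbTE g1).
rewrite (_ : [set _ | _] = \bigcup_h ([set s : sequences | partial_products s n = h] `&`
    [set s : sequences | s n = h^-1 * g]%g)).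
  apply: countable_bigcupT_measurable => // h; apply: measurableI => //.
  exact: measurable_sequence_coord.
apply/seteqP; split=> [s /= <-|s /= [h _ [<- ->]]]; last by rewrite mulVKg.
by exists (partial_products s n) => //; split=> //=; rewrite mulKg.
Qed.

Lemma measurable_fun_sequence_path K x : measurable_fun setT
  (fun s : sequences => coset_path K (fun n => x * partial_products s n)%g : borel (tSubG G)).
Proof.
apply: measurable_fun_coset_path => // n g.
rewrite (_ : [set _ | _] = [set s : sequences | partial_products s n = x^-1 * g]%g).
  exact: measurable_partial_products.
by apply/seteqP; split=> [z /= <-|z /= ->]; [rewrite mulKg|rewrite mulVKg].
Qed.

End Sequences.

Notation law m mf :=
  (measure_function_pushforward__canonical__measure_function_Measure m mf).

(** * Markov property of the coset paths *)

Section Markov.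
Context (R : realType) (G : groupType).
Hypothesis G_countable : countable [set: G].
Context (d : measure_display) (Omega : measurableType d) (Pr : probability Omega R).
Context (X : nat -> Omega -> G) (mu : G -> R).
Hypothesis mu_pmf : is_pmf mu.
Hypothesis X_iid : iid_with_law Pr X mu.

Lemma walkE w : walk X w = partial_products (X ^~ w).
Proof. by apply/funext; elim=> //= n ->. Qed.

Lemma walk_shift w n :
  walk X w n.+1 = (X 0 w * partial_products (fun i => X i.+1 w) n)%g.
Proof.
elim: n => [|n IHn]; first by rewrite /= mul1g mulg1.
rewrite [LHS](congr1 (fun g => (g * X n.+1 w)%g) IHn).
by rewrite [in RHS]/= mulgA.
Qed.

Lemma measurable_X i g : measurable (X i @^-1` [set g]).
Proof. exact: iid_measurable X_iid _ _. Qed.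

Definition increments (w : Omega) : sequences G := X ^~ w.

Definition later_increments (w : Omega) : sequences G := fun i => X i.+1 w.

Lemma measurable_increments : measurable_fun setT increments.
Proof. by apply: measurable_seq_coord => i g; exact: measurable_X. Qed.

Lemma measurable_later_increments : measurable_fun setT later_increments.
Proof.
by apply: (@measurable_seq_coord _ _ _ (fun i => X i.+1)) => i g; exact: measurable_X.
Qed.

Lemma increments_cylinder t :
  Pr (increments @^-1` cylinder t) = \prod_(i < size t) (mu (nth 1%g t i))%:E.
Proof.
have -> : increments @^-1` cylinder t =
    \bigcap_(i in [set` iota 0 (size t)]) X i @^-1` [set nth 1%g t i].
  apply/seteqP; split=> [w wt i /=|w wt i it]; first by rewrite mem_iota => it; exact: wt.
  by apply: wt => /=; rewrite mem_iota.
rewrite (iid_independent X_iid) ?iota_uniq// -[in LHS](subn0 (size t)).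
rewrite -/(index_iota 0 (size t)) big_mkord; apply: eq_bigr => i _; exact: (iid_law X_iid).
Qed.

(** X_0 is independent of the later increments, which have the same joint law as all the increments.
    Both sides are finite measures in A that agree on cylinders, because prefixing t with y gives
    the cylinder of y :: t. *)
Lemma shift_law y (A : set (sequences G)) : measurable A ->
  Pr (later_increments @^-1` A `&` X 0 @^-1` [set y]) =
  (mu y)%:E * Pr (increments @^-1` A).
Proof.
have mu0 := mu_pmf.1 y.
have mX := measurable_X 0 y.
move=> mA.
pose m1 := law (mrestr Pr mX) measurable_later_increments.
pose m2 : {measure set (sequences G) -> \bar R} :=
  mscale (NngNum mu0) (law Pr measurable_increments).
apply: (@g_sigma_algebra_measure_unique _ R (sequences G) (@cylinders G) _
  (fun=> setT) _ _ m1 m2) => //.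
- by move=> B cB; exact: sub_sigma_algebra.
- by move=> _; right; exists [::]; rewrite cylinder_nil.
- by rewrite bigcup_const//; exists 0%N.
- exact: setI_cylinders.
- move=> _ [->|[t ->]]; first by rewrite !measure0.
  rewrite /m1 /m2 /= /mscale /= /pushforward /mrestr.
  rewrite increments_cylinder (_ : _ `&` _ = increments @^-1` cylinder (y :: t)).
    by rewrite increments_cylinder big_ord_recl.
  apply/seteqP; split=> w /=.
    by move=> [wt w0] [|i] //= /wt.
  by move=> wt; split=> [i it|]; [exact: (wt i.+1)|exact: (wt 0%N)].
- move=> _; rewrite /m1/= /pushforward /mrestr preimage_setT setTI.
  by rewrite (le_lt_trans (probability_le1 _ mX))// ltry.
Qed.

Variable lambda : probability (borel (SubG G)) R.

Lemma measurable_walk n g : measurable [set w | walk X w n = g].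
Proof.
rewrite -[X in measurable X]setTI.
rewrite (_ : [set _ | _] = increments @^-1` [set s | partial_products s n = g]).
  by apply: measurable_increments => //; exact: measurable_partial_products.
by apply/seteqP; split=> w /=; rewrite walkE.
Qed.

Definition path_from (x : G) (z : borel (SubG G) * Omega) : borel (tSubG G) :=
  coset_path z.1 (fun n => x * walk X z.2 n)%g.

Lemma measurable_path_from x : measurable_fun setT (path_from x).
Proof.
apply: measurable_fun_coset_path => // n g.
rewrite (_ : [set _ | _] = setT `*` [set w | walk X w n = x^-1 * g]%g).
  by apply: measurableX => //; exact: measurable_walk.
apply/seteqP; split=> [z /= <-|z /= [_ ->]]; first by rewrite mulKg.
by rewrite mulVKg.
Qed.

Lemma measurable_path_from2 x K : measurable_fun setT (fun w => path_from x (K, w)).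
Proof. exact: measurableT_comp (measurable_path_from x) (pair1_measurable K). Qed.

(* The law of (K; K x, K x X_1, K x X_1 X_2, ...), with K of law lambda. *)
Definition path_law x : {measure set (borel (tSubG G)) -> \bar R} :=
  law (lambda \x Pr) (measurable_path_from x).

Lemma path_lawE x E : measurable E ->
  path_law x E = \int[lambda]_K Pr [set w | E (path_from x (K, w))].
Proof.
move=> mE; rewrite /path_law /= /pushforward /product_measure1.
by apply: eq_integral => K _ /=; congr (Pr _); apply/seteqP; split=> w /=;
  rewrite /xsection /= inE.
Qed.

Lemma integral_path_law x F : (forall p, 0 <= F p) -> measurable_fun setT F ->
  \int[path_law x]_p F p = \int[lambda]_K \int[Pr]_w F (path_from x (K, w)).
Proof.
move=> F0 mF; rewrite ge0_integral_pushforward//; last exact: measurable_path_from.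
rewrite preimage_setT fubini_tonelli1//; last by move=> z; exact: F0.
exact: measurableT_comp mF (measurable_path_from x).
Qed.

Lemma Pr_partition (A : set Omega) : measurable A ->
  Pr A = \esum_(y in [set: G]) Pr (A `&` X 0 @^-1` [set y]).
Proof.
move=> mA; have mAX y : measurable (A `&` X 0 @^-1` [set y]).
  by apply: measurableI => //; exact: measurable_X.
transitivity (\int[Pr]_w \esum_(y in [set: G]) (\1_(A `&` X 0 @^-1` [set y]) w)%:E).
  rewrite -[in LHS](setIT A) -[LHS]integral_indic//; apply: eq_integral => w _.
  rewrite -[LHS](@esum_indic1 R G (X 0 w) (cst (\1_A w)%:E)) ?lee_fin//.
  apply: eq_esum => y _; rewrite !indicE in_setI; case: eqVneq => [->|yX].
    by rewrite [X in _ && X]mem_set// andbT.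
  by rewrite [X in _ && X]memNset ?andbF//= => /esym/eqP; rewrite (negbTE yX).
rewrite integral_esum//.
- by apply: eq_esum => y _; rewrite integral_indic// setIT.
- move=> y; apply/measurable_EFinP; exact: measurable_indic.
Qed.

Lemma path_shift_coset_path K (g : nat -> G) :
  path_shift (coset_path K g) = coset_path K (fun n => g n.+1).
Proof. exact: val_inj. Qed.

(** The Markov property at time one: on X_0 = y the shifted path starts at K x y and is driven by
    fresh increments of the same law. *)
Lemma path_law_shift x (E : set (borel (tSubG G))) : measurable E ->
  path_law x (@path_shift G @^-1` E) =
  wsum mu (fun y => path_law (x * y)%g E).
Proof.
move=> mE; have mmu := pmf_mass mu_pmf.
have mPr y : measurable_fun setT (fun K => Pr [set w | E (path_from y (K, w))]).
  have mE' : measurable (path_from y @^-1` E).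
    by rewrite -[X in measurable X]setTI; exact: measurable_path_from.
  have := measurable_fun_xsection Pr mE'.
  by congr (measurable_fun _ _); apply/funext => K /=; congr (Pr _);
    apply/seteqP; split=> w /=; rewrite /xsection /= inE.
rewrite path_lawE; last first.
  by rewrite -[X in measurable X]setTI; exact: measurable_path_shift.
transitivity (\esum_(y in [set: G])
    \int[lambda]_K ((mu y)%:E * Pr [set w | E (path_from (x * y)%g (K, w))])); last first.
  apply: eq_esum => y _; rewrite path_lawE// ge0_integralZl_EFin//.
  exact: mu_pmf.1.
rewrite -integral_esum//; last 2 first.
- by move=> y K; rewrite mule_ge0// lee_fin mu_pmf.1.
- by move=> y; exact: measurable_funeM.
apply: eq_integral => K _.
have mf y : measurable ((fun s : sequences G =>
    coset_path K (fun n => y * partial_products s n)%g) @^-1` E).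
  by rewrite -[X in measurable X]setTI; exact: measurable_fun_sequence_path.
rewrite Pr_partition; last first.
  have := @measurable_path_from2 x K measurableT (@path_shift G @^-1` E).
  rewrite setTI; apply; rewrite -[X in measurable X]setTI.
  exact: measurable_path_shift.
apply: eq_esum => y _.
transitivity (Pr (later_increments @^-1` ((fun s : sequences G =>
    coset_path K (fun n => x * y * partial_products s n)%g) @^-1` E) `&`
    X 0 @^-1` [set y])).
  congr (Pr _); apply/seteqP; split=> w /= [Ew w0]; split=> //; move: Ew;
  rewrite /path_from /= path_shift_coset_path; congr (E (coset_path K _));
  by apply/funext => n; rewrite walk_shift w0 mulgA.
rewrite shift_law//; congr (_ * Pr _).
by apply/seteqP; split=> w /=; rewrite /path_from /= walkE.
Qed.
End Markov.

(** * Coset masses and path measures *)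

Lemma measurable_inv (R : realType) : measurable_fun setT (@GRing.inv R).
Proof.
have m0 : measurable [set 0%R : R] by exact: measurable_set1.
rewrite -(setUv [set 0%R : R]); apply/measurable_funU => //; first exact: measurableC.
split; first exact: measurable_fun_set1.
apply: open_continuous_measurable_fun.
  by apply: closed_openC; exact: accessible_closed_set1 (@hausdorff_accessible R (@Rhausdorff R)) 0%R.
by move=> x; rewrite inE/= => x0; apply: inv_continuous; exact/eqP.
Qed.

Section CosetMass.
Context (R : realType) (G : groupType).
Implicit Types (p q : G -> R) (C : subsets G).

(* The mass that [p] gives to the set [C]; on a right coset of [K] this is the
   value of the pushforward of [p] to [K \ G]. *)
Definition mass p C : R := fine (wsum p (fun x => (C x)%:R%:E)).

Lemma massE p C : mass_function p -> (mass p C)%:E = wsum p (fun x => (C x)%:R%:E).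
Proof.
move=> mp; rewrite /mass fineK// ge0_fin_numE.
  apply: le_lt_trans mp.2; apply: le_esum => x _.
  by rewrite -EFinM lee_fin; case: (C x); rewrite ?mulr1// mulr0 mp.1.
by apply: wsum_ge0 => // x; rewrite lee_fin ler0n.
Qed.

Lemma mass_ge0 p C : mass_function p -> (0 <= mass p C)%R.
Proof.
by move=> mp; rewrite -lee_fin massE//; apply: wsum_ge0 => // x; rewrite lee_fin ler0n.
Qed.

Lemma mass_le1 p C : is_pmf p -> (mass p C <= 1)%R.
Proof.
move=> pp; have mp := pmf_mass pp; rewrite -lee_fin massE//.
rewrite -(@pmf_wsum_cst _ _ p 1)//; apply: le_wsum => // x _.
by rewrite lee_fin; case: (C x).
Qed.

Lemma mass_ge_point p C x : mass_function p -> C x -> (p x <= mass p C)%R.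
Proof.
move=> mp Cx; rewrite -lee_fin massE// -wsum_point//; apply: le_wsum => // y _.
by case: eqVneq => [->|_]; rewrite ?Cx ?lee_fin ?ler0n.
Qed.

Lemma le_mass p q C (c : R) : mass_function p -> mass_function q -> (0 <= c)%R ->
  (forall x, p x <= c * q x)%R -> (mass p C <= c * mass q C)%R.
Proof.
move=> mp mq c0 pq; rewrite -lee_fin EFinM !massE//.
have C0 x : 0 <= (C x)%:R%:E :> \bar R by rewrite lee_fin ler0n.
rewrite -wsumZ//; apply: le_esum => x _.
by rewrite muleCA muleA -!EFinM lee_fin ler_wpM2r ?ler0n.
Qed.

Lemma mass_dist_le p q C : mass_function p -> mass_function q ->
  (`|mass p C - mass q C| <= mass (fun x => `|p x - q x|) C)%R.
Proof.
move=> mp mq.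
have mr : mass_function (fun x => `|p x - q x|)%R.
  split=> // ; apply: (@le_lt_trans _ _ (\esum_(x in [set: G]) ((p x)%:E + (q x)%:E))).
    apply: le_esum => x _; rewrite -EFinD lee_fin (le_trans (ler_normB _ _))//.
    by rewrite !ger0_norm ?mp.1 ?mq.1.
  by rewrite esumD ?lte_add_pinfty ?mp.2 ?mq.2// => x _; rewrite lee_fin ?mp.1 ?mq.1.
have H p' q' : mass_function p' -> mass_function q' ->
    mass_function (fun x => `|p' x - q' x|)%R ->
    (mass p' C - mass q' C <= mass (fun x => `|p' x - q' x|) C)%R.
  move=> mp' mq' mr'; rewrite lerBlDr -lee_fin EFinD !massE//.
  rewrite /wsum -esumD; last 2 first.
  - by move=> x _; rewrite -EFinM lee_fin mulr_ge0// ler0n.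
  - by move=> x _; rewrite -EFinM lee_fin mulr_ge0 ?ler0n// mq'.1.
  apply: le_esum => x _; rewrite -!EFinM -EFinD lee_fin -mulrDl ler_wpM2r ?ler0n//.
  by rewrite -lerBlDr ler_norm.
rewrite ler_norml H// andbT lerNl opprB.
have -> : (fun x => `|p x - q x|)%R = (fun x => `|q x - p x|)%R.
  by apply/funext => x; rewrite distrC.
apply: H => //; rewrite (_ : (fun _ => _) = (fun x => `|p x - q x|)%R)//.
by apply/funext => x; rewrite distrC.
Qed.

(** The kappa_p of the overview, a function of the first coset of the path. *)
Definition cmass p (a : borel (tSubG G)) : R := mass p ((val a).2 0%N).

Lemma measurable_cmass p : countable [set: G] -> mass_function p ->
  measurable_fun setT (cmass p : borel (tSubG G) -> R).
Proof.
move=> cG mp.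
rewrite (_ : cmass p = fine \o (fun a : borel (tSubG G) =>
  \esum_(x in [set: G]) ((p x)%:E * ((val a).2 0%N x)%:R%:E)))//.
apply: measurableT_comp => //; apply: measurable_fun_esum => //.
  by move=> x a; rewrite mule_ge0// lee_fin ?mp.1.
move=> x; apply: measurable_funeM; apply/measurable_EFinP.
rewrite (_ : (fun _ => _) = \1_[set a : borel (tSubG G) | coord (Some 0%N, x) a]).
  by apply: measurable_indic; exact: measurable_coord.
apply/funext => a; rewrite indicE; congr (_%:R).
congr nat_of_bool.
by apply/idP/idP => [ax|]; [rewrite mem_set|rewrite inE].
Qed.

Lemma rcoset_byE (K : SubG G) x y : rcoset_by (val K) x y -> rcoset_by (val K) x = rcoset_by (val K) y.
Proof.
case: K => K /= /set_mem [K1 KB]; rewrite /rcoset_by => Kyx; apply/funext => z.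
have KI h : K h -> K h^-1%g.
  by move=> Kh; have := KB _ _ K1 Kh; rewrite !unfold_in mul1g.
have KM g h : K g -> K h -> K (g * h)%g.
  by move=> Kg Kh; have := KB _ _ Kg (KI _ Kh); rewrite !unfold_in invgK.
apply/idP/idP => H.
  have := KM _ _ H (KI _ Kyx); rewrite invgM invgK !mulgA mulgVK; exact.
by have := KM _ _ H Kyx; rewrite mulgA mulgVK.
Qed.

Lemma rcoset_by_refl (K : SubG G) x : rcoset_by (val K) x x.
Proof. by case: K => K /= /set_mem [K1 _]; rewrite /rcoset_by mulgV. Qed.

Lemma rcoset_by_sym (K : SubG G) x y : rcoset_by (val K) x y = rcoset_by (val K) y x.
Proof.
apply/idP/idP => H; first by rewrite -(rcoset_byE H); exact: rcoset_by_refl.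
by rewrite -(rcoset_byE H); exact: rcoset_by_refl.
Qed.

Lemma cmass_coset_path p (K : SubG G) (g : nat -> G) :
  cmass p (coset_path K g) = mass p (rcoset_by (val K) (g 0%N)).
Proof. by []. Qed.

(* Exchanging the two sums, weighted by the equivalence relation [K x = K y]. *)
Lemma coset_transport (K : SubG G) p q (J : G -> \bar R) :
  mass_function p -> mass_function q -> (forall x, 0 <= J x) ->
  (forall x y, rcoset_by (val K) x y -> J x = J y) ->
  wsum q (fun x => (mass p (rcoset_by (val K) x) / mass q (rcoset_by (val K) x))%:E * J x) =
  wsum p (fun x => if mass q (rcoset_by (val K) x) == 0%R then 0 else J x).
Proof.
move=> mp mq J0 JK; pose C x := rcoset_by (val K) x.
have Cxy x y : C x y -> C x = C y by exact: rcoset_byE.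
have H0 x y : 0 <= (mass q (C x))^-1%:E * J x * (C x y)%:R%:E.
  by rewrite !mule_ge0// lee_fin ?invr_ge0 ?mass_ge0// ler0n.
transitivity (wsum q (fun x => wsum p (fun y => (mass q (C x))^-1%:E * J x * (C x y)%:R%:E))).
  apply: eq_wsum => // x _; rewrite wsumZ//.
  - by rewrite -massE// EFinM -muleA muleC.
  - by rewrite mule_ge0// lee_fin invr_ge0 mass_ge0.
rewrite wsum_exchange//; apply: eq_wsum => // y _.
transitivity (wsum q (fun x => (mass q (C y))^-1%:E * J y * (C y x)%:R%:E)).
  apply: eq_wsum => // x _; rewrite [C y x]rcoset_by_sym -/(C x y).
  by have [Kxy|_] := boolP (C x y); [rewrite (Cxy _ _ Kxy) (JK _ _ Kxy)|rewrite !mule0].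
rewrite wsumZ//; last by rewrite mule_ge0// lee_fin invr_ge0 mass_ge0.
rewrite -massE// muleAC -EFinM; case: eqVneq => [->|q0]; first by rewrite mulr0 mul0e.
by rewrite mulVf// mul1e.
Qed.

End CosetMass.

(** * Path measures: shift, group action and densities *)

Section PathMeasure.
Context (R : realType) (G : groupType).
Hypothesis G_countable : countable [set: G].
Context (d : measure_display) (Omega : measurableType d) (Pr : probability Omega R).
Context (X : nat -> Omega -> G) (mu : G -> R).
Hypothesis mu_pmf : is_pmf mu.
Hypothesis X_iid : iid_with_law Pr X mu.
Variable lambda : probability (borel (SubG G)) R.
Hypothesis lambda_invariant : conj_invariant lambda.
Implicit Types (p q : G -> R) (F : borel (tSubG G) -> \bar R).

Local Notation path_law := (path_law G_countable X_iid lambda).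

Let enum_G : nat -> option G := projT1 (cid (countable_enum R G_countable)).

Let esum_G (a : G -> \bar R) : (forall x, 0 <= a x) ->
  \esum_(x in [set: G]) a x = \sum_(n <oo) oapp a 0 (enum_G n).
Proof. exact: (projT2 (cid (countable_enum R G_countable))). Qed.

(* The law of the path (K; K Y, K Y X_1, K Y X_1 X_2, ...) where K and Y have
   laws [lambda] and [p]. *)
Definition path_measure p : {measure set (borel (tSubG G)) -> \bar R} :=
  mseries (fun n => if enum_G n is Some x
    then mscale (NngNum (normr_ge0 (p x))) (path_law x) : {measure set _ -> \bar R}
    else mzero) 0.

Lemma path_measureE p E : mass_function p ->
  path_measure p E = wsum p (path_law ^~ E).
Proof.
move=> mp; rewrite /wsum esum_G; last by move=> x; rewrite mule_ge0// lee_fin mp.1.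
apply: eq_eseriesr => n _; case: (enum_G n) => //= x.
by rewrite /mscale/= ger0_norm// mp.1.
Qed.

Lemma integral_path_measure p F : mass_function p -> (forall a, 0 <= F a) ->
  measurable_fun setT F ->
  \int[path_measure p]_a F a = wsum p (fun x => \int[path_law x]_a F a).
Proof.
move=> mp F0 mF; rewrite ge0_integral_measure_series//.
rewrite /wsum esum_G; last first.
  by move=> x; rewrite mule_ge0 ?lee_fin ?mp.1// integral_ge0.
apply: eq_eseriesr => n _; case: (enum_G n) => [x|]/=; last by rewrite integral_measure_zero.
by rewrite ge0_integral_mscale//= ger0_norm// mp.1.
Qed.

Lemma path_measure_shift p (E : set (borel (tSubG G))) : mass_function p -> measurable E ->
  path_measure p (@path_shift G @^-1` E) = path_measure (convolution p mu) E.
Proof.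
move=> mp mE; have mmu := pmf_mass mu_pmf.
rewrite [LHS]path_measureE// [RHS]path_measureE; last exact: convolution_mass.
rewrite wsum_convolution//.
by apply: eq_wsum => // x _; rewrite path_law_shift.
Qed.

Lemma integral_path_shift p F : mass_function p -> (forall a, 0 <= F a) ->
  measurable_fun setT F ->
  \int[path_measure p]_a F (path_shift a) = \int[path_measure (convolution p mu)]_a F a.
Proof.
move=> mp F0 mF; have mS := measurable_path_shift G_countable.
rewrite -[LHS](@ge0_integral_pushforward _ _ _ _ _ _ mS _ setT F)//.
apply: (@eq_measure_integral _ _ _ _ _ (law (path_measure p) mS)) => E mE _.
exact: (path_measure_shift mp mE).
Qed.

Lemma act_coset_path g (K : SubG G) (w : nat -> G) :
  act_tSubG g (coset_path K w) = coset_path (conj_SubG g K) (fun n => g * w n)%g.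
Proof.
apply: val_inj => /=; congr pair; apply/funext => n; apply/funext => x.
by rewrite /translate_by /rcoset_by /conj_by invgM !mulgA mulgVK.
Qed.

(** Acting by g replaces K by its conjugate and x by g x; the invariance of lambda absorbs the
    conjugation. *)
Lemma path_law_act g x (E : set (borel (tSubG G))) : measurable E ->
  path_law x (act_tSubG g @^-1` E) = path_law (g * x)%g E.
Proof.
move=> mE; rewrite !path_lawE//; last first.
  by rewrite -[X in measurable X]setTI; exact: measurable_act_tSubG.
have mC := measurable_conj_SubG G_countable g.
have mE' y : measurable (path_from X y @^-1` E).
  by rewrite -[X in measurable X]setTI; exact: (measurable_path_from G_countable X_iid).
have mf y : measurable_fun setT (fun K => Pr [set w | E (path_from X y (K, w))]).
  have := measurable_fun_xsection Pr (mE' y).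
  by congr (measurable_fun _ _); apply/funext => K /=; congr (Pr _);
    apply/seteqP; split=> w /=; rewrite /xsection /= inE.
transitivity (\int[law lambda mC]_K Pr [set w | E (path_from X (g * x)%g (K, w))]).
  rewrite ge0_integral_pushforward//; apply: eq_integral => K _ /=.
  congr (Pr _); apply/seteqP; split=> w /=; rewrite /path_from /= act_coset_path;
  by congr (E (coset_path _ _)); apply/funext => n; rewrite mulgA.
by apply: eq_measure_integral => A mA _; exact: lambda_invariant.
Qed.

Lemma path_measure_act g p (E : set (borel (tSubG G))) : mass_function p -> measurable E ->
  path_measure p (act_tSubG g @^-1` E) = path_measure (left_translate g p) E.
Proof.
move=> mp mE; rewrite [LHS]path_measureE// [RHS]path_measureE; last exact: left_translate_mass.
by rewrite wsum_translate; apply: eq_wsum => // x _; rewrite path_law_act.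
Qed.

Lemma integral_path_act g p F : mass_function p -> (forall a, 0 <= F a) ->
  measurable_fun setT F ->
  \int[path_measure p]_a F (act_tSubG g a) = \int[path_measure (left_translate g p)]_a F a.
Proof.
move=> mp F0 mF; have mS := measurable_act_tSubG G_countable g.
rewrite -[LHS](@ge0_integral_pushforward _ _ _ _ _ _ mS _ setT F)//.
apply: (@eq_measure_integral _ _ _ _ _ (law (path_measure p) mS)) => E mE _.
exact: (path_measure_act g mp mE).
Qed.

Lemma integral_path_measure_subgroups p F : mass_function p -> (forall a, 0 <= F a) ->
  measurable_fun setT F ->
  \int[path_measure p]_a F a =
  \int[lambda]_K wsum p (fun x => \int[Pr]_w F (path_from X x (K, w))).
Proof.
move=> mp F0 mF; rewrite integral_path_measure//.
have mFp x : measurable_fun setT (F \o path_from X x).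
  exact: measurableT_comp mF (measurable_path_from G_countable X_iid x).
have mJ x : measurable_fun setT (fun K => \int[Pr]_w F (path_from X x (K, w))).
  apply: (@measurable_fun_fubini_tonelli_F _ _ _ _ _ Pr (F \o path_from X x) (mFp x)).
  by move=> z; exact: F0.
have J0 x K : 0 <= \int[Pr]_w F (path_from X x (K, w)) by exact: integral_ge0.
rewrite /wsum integral_esum//; last 2 first.
- by move=> x K; apply: mule_ge0; [rewrite lee_fin mp.1|exact: J0].
- by move=> x; exact: measurable_funeM.
apply: eq_esum => x _; rewrite integral_path_law// ge0_integralZl_EFin//.
exact: mp.1.
Qed.

Lemma measurable_if_cmass_eq0 q F : mass_function q -> measurable_fun setT F ->
  measurable_fun setT (fun a => if cmass q a == 0%R then 0 else F a).
Proof.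
move=> mq mF; apply: measurable_fun_ifT => //.
by apply: measurable_fun_eqr; [exact: measurable_cmass|exact: measurable_cst].
Qed.

(** Given K, the law of the path depends on the starting point x only through the coset K x. Hence
    M_p and M_q differ only in how they weight cosets, and the density is the ratio of the coset
    masses, by [coset_transport]. Where kappa_q vanishes the quotient is 0 by convention, which
    accounts for the truncation on the right. *)
Lemma integral_cmass_ratio p q F : mass_function p -> mass_function q ->
  (forall a, 0 <= F a) -> measurable_fun setT F ->
  \int[path_measure q]_a ((cmass p a / cmass q a)%:E * F a) =
  \int[path_measure p]_a (if cmass q a == 0%R then 0 else F a).
Proof.
move=> mp mq F0 mF.
have mcp := measurable_cmass G_countable mp.
have mcq := measurable_cmass G_countable mq.
have cp0 a : (0 <= cmass p a)%R by exact: mass_ge0.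
have cq0 a : (0 <= cmass q a)%R by exact: mass_ge0.
have r0 a : 0 <= (cmass p a / cmass q a)%:E * F a.
  by rewrite mule_ge0// lee_fin divr_ge0.
have i0 a : 0 <= if cmass q a == 0%R then 0 else F a by case: ifP.
have mr : measurable_fun setT (fun a => (cmass p a / cmass q a)%:E * F a).
  apply: emeasurable_funM => //; apply/measurable_EFinP.
  apply: measurable_funM => //; exact: measurableT_comp (@measurable_inv R) mcq.
have mi : measurable_fun setT (fun a => if cmass q a == 0%R then 0 else F a).
  exact: measurable_if_cmass_eq0.
rewrite (integral_path_measure_subgroups mq r0 mr).
rewrite (integral_path_measure_subgroups mp i0 mi); apply: eq_integral => K _.
pose J x := \int[Pr]_w F (path_from X x (K, w)).
have mFp x : measurable_fun setT (fun w => F (path_from X x (K, w))).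
  exact: measurableT_comp mF (measurable_path_from2 G_countable X_iid x K).
transitivity (wsum q (fun x =>
    (mass p (rcoset_by (val K) x) / mass q (rcoset_by (val K) x))%:E * J x)).
  apply: eq_wsum => [//|x _]; rewrite -[RHS]ge0_integralZl_EFin; last first.
  - by rewrite divr_ge0// mass_ge0.
  - exact: mFp.
  - by move=> w _; exact: F0.
  - exact: measurableT.
  by apply: eq_integral => w _; rewrite /path_from !cmass_coset_path/= mulg1.
rewrite coset_transport//; last 2 first.
- by move=> x; exact: integral_ge0.
- move=> x y Kxy; apply: eq_integral => w _; congr F; apply: val_inj.
  rewrite /=; congr pair; apply/funext => n.
  by apply: rcoset_byE; move: Kxy; rewrite /rcoset_by invgM mulgA mulgK.
apply: eq_wsum => // x _; case: ifPn => [/eqP q0|q0].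
  rewrite integral0_eq// => w _.
  by rewrite /path_from cmass_coset_path/= mulg1 q0 eqxx.
apply: eq_integral => w _.
by rewrite /path_from cmass_coset_path/= mulg1 (negbTE q0).
Qed.

Lemma le_integral_cmass_ratio p q F : mass_function p -> mass_function q ->
  (forall a, 0 <= F a) -> measurable_fun setT F ->
  \int[path_measure q]_a ((cmass p a / cmass q a)%:E * F a) <=
  \int[path_measure p]_a F a.
Proof.
move=> mp mq F0 mF; rewrite integral_cmass_ratio//.
apply: ge0_le_integral => //.
- by move=> a _; case: ifP.
- exact: measurable_if_cmass_eq0.
- by move=> a _; case: ifP.
Qed.

(** Domination by c q removes the truncation: M_p is carried by paths starting at some x with p x >
    0, and there kappa_q is positive. *)
Lemma integral_cmass_ratio_eq p q F (c : R) : mass_function p -> mass_function q ->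
  (0 <= c)%R -> (forall x, p x <= c * q x)%R ->
  (forall a, 0 <= F a) -> measurable_fun setT F ->
  \int[path_measure q]_a ((cmass p a / cmass q a)%:E * F a) =
  \int[path_measure p]_a F a.
Proof.
move=> mp mq c0 pq F0 mF; rewrite integral_cmass_ratio//.
have i0 a : 0 <= if cmass q a == 0%R then 0 else F a by case: ifP.
rewrite (integral_path_measure_subgroups mp i0 (measurable_if_cmass_eq0 mq mF)).
rewrite (integral_path_measure_subgroups mp F0 mF).
apply: eq_integral => K _; apply: eq_wsum => // x px; apply: eq_integral => w _.
rewrite ifF//; apply/negbTE; rewrite gt_eqF// /path_from cmass_coset_path/= mulg1.
have := mass_ge_point mq (rcoset_by_refl K x); apply: lt_le_trans.
rewrite lt0r mq.1 andbT; apply: contraTN px => /eqP qx.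
by rewrite -leNgt (le_trans (pq x))// qx mulr0.
Qed.
End PathMeasure.

(** * Entropy and divergence *)

Section RingIdentities.
Variable R : realType.
Local Open Scope ring_scope.

Let T : Type := R.
Let radd (x y : T) : T := x + y.
Let rmul (x y : T) : T := x * y.
Let rsub (x y : T) : T := x - y.
Let ropp (x : T) : T := - x.
Let r0 : T := 0.
Let r1 : T := 1.

Let real_ring_theory : ring_theory r0 r1 radd rmul rsub ropp (@eq T).
Proof.
by split=> *; rewrite /r0 /r1 /radd /rmul /rsub /ropp /=
  ?add0r ?addrA ?mul1r ?mulrA ?mulrDl ?subrr//; [exact: addrC|exact: mulrC].
Qed.

Add Ring real_ring : real_ring_theory.

(* [ring] only recognizes the operations of a declared ring syntactically. *)
Ltac real_ring := repeat match goal with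
  | |- context [@GRing.add _ ?x (GRing.opp ?y)] =>
    change (@GRing.add _ x (GRing.opp y)) with (rsub x y)
  | |- context [@GRing.add _ ?x ?y] => change (@GRing.add _ x y) with (radd x y)
  | |- context [@GRing.mul _ ?x ?y] => change (@GRing.mul _ x y) with (rmul x y)
  | |- context [@GRing.opp _ ?x] => change (@GRing.opp _ x) with (ropp x)
  | |- context [@GRing.one _] => change (@GRing.one _) with r1
  | |- context [@GRing.zero _] => change (@GRing.zero _) with r0
  end; match goal with |- @eq _ ?a ?b => change (@eq T a b) end; ring.

Lemma log_ratio_identity (v a b : R) :
  v * - b + 1 = v * (a - b) - v + 1 + v * - a + v.
Proof. real_ring. Qed.

Lemma log_sub_identity (a b c e t : R) :
  t - 1 - (a - b + (c - e)) = - a - c + t - (- b - e + 1).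
Proof. real_ring. Qed.

Lemma size_bias_identity (c s n a b : R) :
  c * (n * c * a + (c * a + s * b)) + s * (n * c * b) =
  (n + 1) * c * (c * a + s * b).
Proof. real_ring. Qed.

Lemma deviation_identity (z y : R) :
  (1 - z * y) * (1 - z * y) = 1 + (- (z + z) * y + z * z * (y * y)).
Proof. real_ring. Qed.

Lemma deviation_sum_identity (z y c a : R) :
  1 + (- (z + z) * y + z * z * (y * (a * c + 1))) =
  (1 - z * y) * (1 - z * y) + (z * y) * (z * (1 - c)) +
  (z * y) * (z * ((a + 1) * c) - z * y).
Proof. real_ring. Qed.

Lemma square_shuffle_identity (a c e : R) : a * c * (e * e) = c * (e * (e * a)).
Proof. real_ring. Qed.

Lemma square_sub_identity (a b : R) :
  (a - b) ^+ 2 + (a * b + a * b) = a * a + b * b.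
Proof. rewrite expr2; real_ring. Qed.

End RingIdentities.

(** Used in place of the Cauchy-Schwarz inequality to pass from L^2 bounds to L^1 bounds. *)
Lemma norm_le_square (R : realType) (e t : R) : (0 < e -> `|t| <= e + e^-1 * t ^+ 2)%R.
Proof.
move=> e0; have [te|te] := leP `|t|%R e.
  by rewrite (le_trans te)// lerDl mulr_ge0 ?sqr_ge0// invr_ge0 ltW.
apply: le_trans (_ : e^-1 * t ^+ 2 <= _)%R; last by rewrite lerDr ltW.
by rewrite ler_pdivlMl// -real_normK ?num_real// expr2 ler_pM2r ?ltW// (lt_trans e0).
Qed.

Opaque path_measure path_law.

Section EntropyFunction.
Context (R : realType).
Implicit Types u v : R.
Local Open Scope ring_scope.

Lemma ln_le_sub1 v : 0 < v -> ln v <= v - 1.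
Proof.
move=> v0; have := @le_ln1Dx R (v - 1); rewrite [1 + _]addrC subrK; apply.
by rewrite ltrBrDl subrr.
Qed.

(** The affine terms make v ln v nonnegative, so that its integral against any measure is defined in
    [0, +oo]. At 0 the value is 1, because [ln 0 = 0]. *)
Definition ent v : R := v * ln v - v + 1.

Lemma ent_ge0 v : 0 <= v -> 0 <= ent v.
Proof.
rewrite le_eqVlt => /predU1P[<-|v0]; first by rewrite /ent mul0r subr0 add0r.
have := @ln_le_sub1 v^-1; rewrite invr_gt0 => /(_ v0).
rewrite lnV// -(ler_pM2l v0) mulrBr divff ?gt_eqF// mulr1 mulrN lerNl opprB => H.
by rewrite /ent -addrA (addrC (- v)) -opprB subr_ge0.
Qed.

Lemma ent_ratio u v : 0 <= u -> 0 < v ->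
  u / v * - ln v + 1 = ent (u / v) + u / v * - ln u + u / v.
Proof.
rewrite le_eqVlt => /predU1P[<-|u0] v0.
  by rewrite /ent !mul0r subr0 !add0r addr0 addr0.
by rewrite /ent ln_div ?posrE//; exact: log_ratio_identity.
Qed.

Lemma measurable_ent : measurable_fun setT ent.
Proof.
apply: measurable_funD; last exact: measurable_cst.
by apply: measurable_funB => //; exact: measurable_funM.
Qed.

End EntropyFunction.

(** * Cross entropy and divergence of path measures *)

Section Divergence.
Context (R : realType) (G : groupType).
Hypothesis G_countable : countable [set: G].
Context (d : measure_display) (Omega : measurableType d) (Pr : probability Omega R).
Context (X : nat -> Omega -> G) (mu : G -> R).
Hypothesis mu_pmf : is_pmf mu.
Hypothesis X_iid : iid_with_law Pr X mu.
Variable lambda : probability (borel (SubG G)) R.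
Hypothesis lambda_invariant : conj_invariant lambda.
Implicit Types (p q : G -> R) (F : borel (tSubG G) -> \bar R).

Local Notation M := (path_measure G_countable X_iid lambda).
Local Notation next p := (convolution p mu).

(** The L(p, q) of the overview. *)
Definition cross_entropy p q : \bar R := \int[M p]_a (- ln (cmass q a))%:E.

(** When p is a probability dominated by q, this is the relative entropy of M_p with respect to
    M_q. *)
Definition divergence p q : \bar R := \int[M q]_a (ent (cmass p a / cmass q a))%:E.

Lemma path_measure_total p : mass_function p -> M p setT = \esum_(x in [set: G]) (p x)%:E.
Proof.
move=> mp; rewrite path_measureE//.
rewrite -[RHS]mul1e -wsum_cst//; apply: eq_wsum => // x _.
rewrite path_lawE//; transitivity (\int[lambda]_K cst (1 : \bar R) K).
  by apply: eq_integral => K _; exact: (@probability_setT _ _ _ Pr).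
by rewrite integral_cst// [X in _ * X](@probability_setT _ _ _ lambda) mul1e.
Qed.

Lemma path_measure_setT p : is_pmf p -> M p setT = 1.
Proof. by move=> pp; rewrite path_measure_total; [exact: pp.2|exact: pmf_mass]. Qed.

Lemma integral_path_cst p (c : \bar R) : is_pmf p -> \int[M p]_a c = c.
Proof. by move=> pp; rewrite integral_cst// path_measure_setT ?mule1. Qed.

Lemma measurable_cmass_ratio p q : mass_function p -> mass_function q ->
  measurable_fun setT (fun a => (cmass p a / cmass q a)%R).
Proof.
move=> mp mq; apply: measurable_funM; first exact: measurable_cmass.
exact: measurableT_comp (@measurable_inv R) (measurable_cmass G_countable mq).
Qed.

Lemma measurable_comp_shift d' (T : measurableType d') (f : borel (tSubG G) -> T) :
  measurable_fun setT f -> measurable_fun setT (fun a : borel (tSubG G) => f (path_shift a)).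
Proof. by move=> mf; exact: measurableT_comp mf (measurable_path_shift G_countable). Qed.

Lemma nlcmass_ge0 p a : is_pmf p -> 0 <= (- ln (cmass p a))%:E.
Proof. by move=> pp; rewrite lee_fin oppr_ge0 ln_le0// mass_le1. Qed.

Lemma measurable_nlcmass p : mass_function p ->
  measurable_fun setT (fun a => (- ln (cmass p a))%:E).
Proof.
move=> mp; apply/measurable_EFinP; apply: measurableT_comp => //.
exact: measurableT_comp (@measurable_ln R) (measurable_cmass G_countable mp).
Qed.

(** The density formula for p against itself: the quotient kappa_p / kappa_p is 0, not 1, where
    kappa_p vanishes, so that set has integral 0. *)
Lemma cmass_gt0_ae p : mass_function p -> {ae M p, forall a, (0 < cmass p a)%R}.
Proof.
move=> mp; have mcp := measurable_cmass G_countable mp.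
have mE : measurable [set a | cmass p a = 0%R].
  have := mcp measurableT _ (measurable_set1 0%R).
  by rewrite setTI; congr measurable; apply/seteqP; split.
exists [set a | cmass p a = 0%R]; split => //; last first.
  move=> a /= /negP; rewrite lt0r mass_ge0// andbT negbK; exact: eqP.
transitivity (\int[M p]_a (\1_[set a | cmass p a = 0%R] a)%:E).
  by rewrite integral_indic// setIT.
rewrite -[LHS](@integral_cmass_ratio_eq _ _ _ _ _ _ _ _ X_iid lambda p p
  (fun a => (\1_[set a | cmass p a = 0%R] a)%:E) 1%R)//.
- rewrite integral0_eq// => a _; rewrite indicE.
  case: (boolP (a \in _)) => [|_]; last by rewrite mule0.
  by rewrite inE/= => ->; rewrite mul0r mul0e.
- by move=> x; rewrite mul1r.
- by apply/measurable_EFinP; exact: measurable_indic.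
Qed.

Lemma ae_shift p (P : set (borel (tSubG G))) : mass_function p ->
  {ae M (next p), forall a, P a} -> {ae M p, forall a, P (path_shift a)}.
Proof.
move=> mp [N [mN N0 NP]]; exists (@path_shift G @^-1` N); split => //.
- by rewrite -[X in measurable X]setTI; exact: measurable_path_shift.
- by rewrite path_measure_shift.
- by move=> a /= Pa; exact: NP.
Qed.

Lemma dominated_cmass_gt0 p q (c : R) a : mass_function p -> mass_function q ->
  (0 <= c)%R -> (forall x, p x <= c * q x)%R -> (0 < cmass p a)%R -> (0 < cmass q a)%R.
Proof.
move=> mp mq c0 pq pa; rewrite lt0r mass_ge0// andbT.
apply: contraTN pa => /eqP qa; rewrite -leNgt.
have := le_mass (p := p) (q := q) ((val a).2 0%N) mp mq c0 pq.
by rewrite [mass q _]qa mulr0.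
Qed.

Lemma integral_cmass_ratio1 p q (c : R) : is_pmf p -> mass_function q ->
  (0 <= c)%R -> (forall x, p x <= c * q x)%R ->
  \int[M q]_a (cmass p a / cmass q a)%:E = 1.
Proof.
move=> pp mq c0 pq; have mp := pmf_mass pp.
apply: etrans (integral_path_cst 1 pp).
have /= <- := integral_cmass_ratio_eq G_countable X_iid lambda mp mq c0 pq
  (fun _ => lee01) (measurable_cst (1 : \bar R)).
by apply: eq_integral => a _; rewrite mule1.
Qed.

Lemma divergence_ge0 p q : mass_function p -> mass_function q -> 0 <= divergence p q.
Proof.
move=> mp mq; apply: integral_ge0 => a _.
by rewrite lee_fin ent_ge0// divr_ge0// mass_ge0.
Qed.

Lemma cross_entropy_ge0 p q : is_pmf q -> 0 <= cross_entropy p q.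
Proof. by move=> pq; apply: integral_ge0 => a _; exact: nlcmass_ge0. Qed.

Lemma divergence_cross_entropy p q (c : R) : is_pmf p -> is_pmf q ->
  (0 <= c)%R -> (forall x, p x <= c * q x)%R ->
  cross_entropy p q = divergence p q + cross_entropy p p.
Proof.
move=> pp pq c0 domp; have mp := pmf_mass pp; have mq := pmf_mass pq.
pose v a := (cmass p a / cmass q a)%R.
have v0 a : (0 <= v a)%R by rewrite divr_ge0// mass_ge0.
have mv : measurable_fun setT v by exact: measurable_cmass_ratio.
have mev : measurable_fun setT (fun a => (ent (v a))%:E).
  by apply/measurable_EFinP; exact: measurableT_comp (@measurable_ent R) mv.
have ev0 a : 0 <= (ent (v a))%:E by rewrite lee_fin ent_ge0.
have lnp0 a := nlcmass_ge0 a pp; have lnq0 a := nlcmass_ge0 a pq.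
have mlnp := measurable_nlcmass mp; have mlnq := measurable_nlcmass mq.
have mvE : measurable_fun setT (EFin \o v) by exact/measurable_EFinP.
have vE0 a : 0 <= (v a)%:E by rewrite lee_fin.
have L r : is_pmf r -> cross_entropy p r = \int[M q]_a ((v a)%:E * (- ln (cmass r a))%:E).
  move=> pr; rewrite /cross_entropy.
  rewrite -(integral_cmass_ratio_eq G_countable X_iid lambda mp mq c0 domp
    (fun a => nlcmass_ge0 a pr) (measurable_nlcmass (pmf_mass pr))).
  by [].
rewrite (L _ pp) (L _ pq) /divergence.
have m1 r : is_pmf r -> measurable_fun setT (fun a => (v a)%:E * (- ln (cmass r a))%:E).
  by move=> pr; apply: emeasurable_funM => //; apply: measurable_nlcmass; exact: pmf_mass.
have p1 r a : is_pmf r -> 0 <= (v a)%:E * (- ln (cmass r a))%:E.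
  by move=> pr; apply: mule_ge0 => //; exact: nlcmass_ge0.
(* Adding 1 to both sides avoids any subtraction: it is the integral of 1 on the left and of the
   density v on the right, and the integrands then agree wherever kappa_q > 0 by [ent_ratio]. *)
suff : \int[M q]_a ((v a)%:E * (- ln (cmass q a))%:E) + 1 =
    \int[M q]_a (ent (v a))%:E + \int[M q]_a ((v a)%:E * (- ln (cmass p a))%:E) + 1.
  by move=> /(congr1 (fun z => z - 1)); rewrite !addeK.
rewrite -[in LHS](integral_path_cst 1 pq) -[1 in RHS](integral_cmass_ratio1 pp mq c0 domp).
rewrite -!ge0_integralD//; do ?[exact: m1|by move=> a _; exact: p1].
- apply: ge0_ae_eq_integral => //.
  + apply: emeasurable_funD => //; exact: m1.
  + apply: emeasurable_funD => //; apply: emeasurable_funD => //; exact: m1.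
  + by move=> a _; rewrite adde_ge0// p1.
  + by move=> a _; apply: adde_ge0; [apply: adde_ge0; [|exact: p1]|exact: vE0].
  + apply: filterS (cmass_gt0_ae mq) => a qa _ /=.
    rewrite -!EFinM -!EFinD; congr EFin; apply: ent_ratio => //.
    exact: mass_ge0.
- by move=> a _; rewrite adde_ge0// p1.
- apply: emeasurable_funD => //; exact: m1.
- by move=> a _; exact: vE0.
Qed.

End Divergence.

Opaque integral.

Lemma lee_cancel (R : realType) (a b x y : \bar R) : a \is a fin_num -> b \is a fin_num ->
  a + (x + b) <= y + a + b -> x <= y.
Proof. by move=> fa fb; rewrite addeA leeD2rE// [y + a]addeC leeD2lE. Qed.

Lemma ae_le_integral3 d (T : measurableType d) (R : realType)
    (m : {measure set T -> \bar R}) (f g h f' g' h' : T -> \bar R) :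
  (forall x, 0 <= f x) -> measurable_fun setT f ->
  (forall x, 0 <= g x) -> measurable_fun setT g ->
  (forall x, 0 <= h x) -> measurable_fun setT h ->
  (forall x, 0 <= f' x) -> measurable_fun setT f' ->
  (forall x, 0 <= g' x) -> measurable_fun setT g' ->
  (forall x, 0 <= h' x) -> measurable_fun setT h' ->
  {ae m, forall x, f x + g x + h x <= f' x + g' x + h' x} ->
  \int[m]_x f x + \int[m]_x g x + \int[m]_x h x <=
  \int[m]_x f' x + \int[m]_x g' x + \int[m]_x h' x.
Proof.
move=> f0 mf g0 mg h0 mh f'0 mf' g'0 mg' h'0 mh' H.
have mfg : measurable_fun setT (f \+ g) by exact: emeasurable_funD.
have mfg' : measurable_fun setT (f' \+ g') by exact: emeasurable_funD.
rewrite -!ge0_integralD//; do ?[by move=> x _; exact: adde_ge0].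
apply: ae_ge0_le_integral => //.
- by move=> x _; rewrite !adde_ge0.
- exact: emeasurable_funD.
- by move=> x _; rewrite !adde_ge0.
- exact: emeasurable_funD.
- by apply: filterS H => x.
Qed.

(** * Data processing and entropy increments *)

Section DataProcessing.
Context (R : realType) (G : groupType).
Hypothesis G_countable : countable [set: G].
Context (d : measure_display) (Omega : measurableType d) (Pr : probability Omega R).
Context (X : nat -> Omega -> G) (mu : G -> R).
Hypothesis mu_pmf : is_pmf mu.
Hypothesis X_iid : iid_with_law Pr X mu.
Variable lambda : probability (borel (SubG G)) R.
Hypothesis lambda_invariant : conj_invariant lambda.
Implicit Types (p q : G -> R) (F : borel (tSubG G) -> \bar R).

Local Notation M := (path_measure G_countable X_iid lambda).
Local Notation next p := (convolution p mu).
Local Notation cross_entropy := (cross_entropy G_countable X_iid lambda).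
Local Notation divergence := (divergence G_countable X_iid lambda).

(** This is ln t <= t - 1 for t = (kq / kp) (up / uq), with the logarithms distributed so that each
    term can be integrated separately. *)
Lemma data_processing_pointwise (kp kq up uq : R) : (0 < kp)%R -> (0 < kq)%R ->
  (0 < up)%R -> (0 < uq)%R ->
  (- ln kp - ln uq + 1 <= - ln kq - ln up + kq / kp * (up / uq))%R.
Proof.
move=> kp0 kq0 up0 uq0; have t0 : (0 < kq / kp * (up / uq))%R.
  by rewrite mulr_gt0// divr_gt0.
have := ln_le_sub1 t0; rewrite lnM ?posrE ?divr_gt0// !ln_div ?posrE//.
by rewrite -subr_ge0 -[in X in _ -> X]subr_ge0 log_sub_identity.
Qed.

Lemma cross_entropy_next p q : mass_function p -> is_pmf q ->
  cross_entropy (next p) q = \int[M p]_a (- ln (cmass q (path_shift a)))%:E.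
Proof.
move=> mp pq; apply/esym.
exact: (integral_path_shift G_countable mu_pmf X_iid lambda mp
  (fun a => nlcmass_ge0 a pq) (measurable_nlcmass G_countable (pmf_mass pq))).
Qed.

Lemma next_pmf p : is_pmf p -> is_pmf (next p).
Proof. by move=> pp; exact: convolution_pmf. Qed.

Lemma next_dominated p q (c : R) : mass_function p -> mass_function q -> (0 <= c)%R ->
  (forall x, p x <= c * q x)%R -> forall x, (next p x <= c * next q x)%R.
Proof.
move=> mp mq c0 pq x; have mmu := pmf_mass mu_pmf.
rewrite -lee_fin EFinM !convolutionE//.
have mu0 y : 0 <= (mu (y^-1 * x)%g)%:E by rewrite lee_fin mu_pmf.1.
rewrite -wsumZ//; apply: le_esum => y _.
by rewrite muleCA muleA -!EFinM lee_fin ler_wpM2r ?mu_pmf.1.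
Qed.

(** The additive form of D(next p, next q) <= D(p, q): the shift sends M_p and M_q to the measures
    of [next p] and [next q], and a common map cannot increase divergence. *)
Lemma cross_entropy_next_le p q (c : R) : is_pmf p -> is_pmf q ->
  (0 <= c)%R -> (forall x, p x <= c * q x)%R ->
  cross_entropy p p + cross_entropy (next p) (next q) <=
  cross_entropy p q + cross_entropy (next p) (next p).
Proof.
move=> pp pq c0 domp; have mp := pmf_mass pp; have mq := pmf_mass pq.
have pnp := next_pmf pp; have pnq := next_pmf pq.
have mnp := pmf_mass pnp; have mnq := pmf_mass pnq.
rewrite (cross_entropy_next mp pnq) (cross_entropy_next mp pnp) /cross_entropy.
pose t a := (cmass q a / cmass p a *
  (cmass (next p) (path_shift a) / cmass (next q) (path_shift a)))%R.
have t0 a : 0 <= (t a)%:E by rewrite lee_fin mulr_ge0// divr_ge0// mass_ge0.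
have mu' : measurable_fun setT
    (fun a => (cmass (next p) a / cmass (next q) a)%:E).
  by apply/measurable_EFinP; exact: measurable_cmass_ratio.
have u0 a : 0 <= (cmass (next p) a / cmass (next q) a)%:E.
  by rewrite lee_fin divr_ge0// mass_ge0.
have mt : measurable_fun setT (fun a => (t a)%:E).
  apply/measurable_EFinP; apply: measurable_funM; first exact: measurable_cmass_ratio.
  exact: (measurable_comp_shift G_countable (measurable_cmass_ratio G_countable mnp mnq)).
(* The factor kappa_q / kappa_p changes M_p into at most M_q, the shift changes M_q into the measure
   of [next q], and the remaining ratio integrates there to at most the mass of [next p], which is
   1. *)
have t1 : \int[M p]_a (t a)%:E <= 1.
  apply: (@le_trans _ _ (\int[M q]_a (cmass (next p) (path_shift a) / cmass (next q) (path_shift a))%:E)).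
    have := le_integral_cmass_ratio G_countable X_iid lambda mq mp
      (fun a => u0 (path_shift a)) (measurable_comp_shift G_countable mu').
    by apply: le_trans; rewrite le_eqVlt; apply/orP; left; apply/eqP; apply: eq_integral.
  have H := integral_path_shift G_countable mu_pmf X_iid lambda mq u0 mu'.
  apply: le_trans (_ : \int[M (next q)]_a (cmass (next p) a / cmass (next q) a)%:E <= 1).
    by rewrite le_eqVlt; apply/orP; left; apply/eqP; exact: H.
  have := le_integral_cmass_ratio G_countable X_iid lambda mnp mnq
    (fun _ => lee01) (measurable_cst (1 : \bar R)).
  rewrite [leRHS](integral_path_cst G_countable X_iid lambda 1 pnp) => H1; refine (le_trans _ H1).
  by rewrite le_eqVlt; apply/orP; left; apply/eqP; apply: eq_integral => a _; rewrite mule1.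
suff : \int[M p]_a (- ln (cmass p a))%:E + \int[M p]_a (- ln (cmass (next q) (path_shift a)))%:E + 1 <=
    \int[M p]_a (- ln (cmass q a))%:E + \int[M p]_a (- ln (cmass (next p) (path_shift a)))%:E
    + \int[M p]_a (t a)%:E.
  by move=> /le_trans/(_ (leeD2l _ t1)); rewrite leeD2rE.
have ns (r : G -> R) (a : borel (tSubG G)) : is_pmf r -> 0 <= (- ln (cmass r (path_shift a)))%:E.
  by move=> pr; exact: nlcmass_ge0.
have mns (r : G -> R) : is_pmf r -> measurable_fun setT (fun a : borel (tSubG G) => (- ln (cmass r (path_shift a)))%:E).
  move=> pr; exact: (measurable_comp_shift G_countable (measurable_nlcmass G_countable (pmf_mass pr))).
have E1 := integral_path_cst G_countable X_iid lambda 1 pp.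
have H : {ae M p, forall a, (- ln (cmass p a))%:E + (- ln (cmass (next q) (path_shift a)))%:E
    + 1 <= (- ln (cmass q a))%:E + (- ln (cmass (next p) (path_shift a)))%:E + (t a)%:E}.
  apply: filterS2 (cmass_gt0_ae G_countable X_iid lambda mp) (ae_shift mu_pmf (G_countable := G_countable) (X_iid := X_iid) (lambda := lambda) (P := [set a | (0 < cmass (next p) a)%R]) mp (cmass_gt0_ae G_countable X_iid lambda mnp)) => a pa npa.
  rewrite -!EFinD lee_fin; apply: data_processing_pointwise => //.
    exact: dominated_cmass_gt0 domp pa.
  exact: dominated_cmass_gt0 (next_dominated mp mq c0 domp) npa.
have := ae_le_integral3 (fun a => nlcmass_ge0 a pp) (measurable_nlcmass G_countable mp)
  (fun a => ns _ a pnq) (mns _ pnq) (fun=> lee01) (measurable_cst (1 : \bar R))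
  (fun a => nlcmass_ge0 a pq) (measurable_nlcmass G_countable mq)
  (fun a => ns _ a pnp) (mns _ pnp) t0 mt H.
by rewrite [X in _ + _ + X <= _]E1.
Qed.

Lemma wsum_mul p (f : G -> R) : wsum p (fun x => (f x)%:E) = \esum_(x in [set: G]) (p x * f x)%:E.
Proof. by apply: eq_esum => x _; rewrite EFinM. Qed.

Lemma pmf_le1 p x : is_pmf p -> (p x <= 1)%R.
Proof.
move=> pp; rewrite -lee_fin -pp.2.
by apply: (@esum_ge_term _ _ (EFin \o p)) => y; rewrite lee_fin pp.1.
Qed.

Lemma nlpmf_ge0 p x : is_pmf p -> 0 <= (- ln (p x))%:E.
Proof. by move=> pp; rewrite lee_fin oppr_ge0 ln_le0// pmf_le1. Qed.

Lemma entropyE p : entropy [set: G] p = wsum p (fun x => (- ln (p x))%:E).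
Proof. by rewrite wsum_mul; apply: eq_esum => x _; rewrite mulrN. Qed.

(** Pointwise p y * mu z <= next p (y z), since the product is a single term of the convolution;
    taking -ln splits the bound. *)
Lemma entropy_next p : is_pmf p ->
  entropy [set: G] (next p) <= entropy [set: G] p + entropy [set: G] mu.
Proof.
move=> pp; have mp := pmf_mass pp; have mmu := pmf_mass mu_pmf.
have pnp := convolution_pmf pp mu_pmf.
rewrite !entropyE wsum_convolution//; last by move=> x; exact: nlpmf_ge0.
have -> : wsum p (fun x => (- ln (p x))%:E) + wsum mu (fun x => (- ln (mu x))%:E) =
    wsum p (fun y => wsum mu (fun z => (- ln (p y))%:E + (- ln (mu z))%:E)).
  transitivity (wsum p (fun y => (- ln (p y))%:E + wsum mu (fun x => (- ln (mu x))%:E))).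
    rewrite wsumD//; last 2 first.
    - by move=> x; exact: nlpmf_ge0.
    - by move=> x; apply: wsum_ge0 => // y; exact: nlpmf_ge0.
    by rewrite [X in _ = _ + X]pmf_wsum_cst//; apply: wsum_ge0 => // y; exact: nlpmf_ge0.
  apply: eq_wsum => // y _; rewrite wsumD//; last 2 first.
  - by move=> x; exact: nlpmf_ge0.
  - by move=> x; exact: nlpmf_ge0.
  by rewrite [X in _ = X + _]pmf_wsum_cst//; exact: nlpmf_ge0.
apply: le_wsum => // y py; apply: le_wsum => // z muz.
rewrite -EFinD lee_fin -opprD lerN2 -lnM ?posrE//.
by rewrite ler_ln ?posrE ?mulr_gt0 ?convolution_le//;
  apply: lt_le_trans (convolution_le _ _ _ _) => //; exact: mulr_gt0.
Qed.

Lemma integral_path_law_le x F (c : R) : (0 <= c)%R -> (forall a, 0 <= F a) -> measurable_fun setT F ->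
  (forall K w, F (path_from X x (K, w)) <= c%:E) ->
  \int[path_law G_countable X_iid lambda x]_a F a <= c%:E.
Proof.
move=> c0 F0 mF Fc; rewrite integral_path_law//.
have mFx : measurable_fun setT (F \o path_from X x).
  exact: measurableT_comp mF (measurable_path_from G_countable X_iid x).
have mFxK K : measurable_fun setT (fun w => F (path_from X x (K, w))).
  exact: measurableT_comp mF (measurable_path_from2 G_countable X_iid x K).
have le1 K : \int[Pr]_w F (path_from X x (K, w)) <= c%:E.
  have <- : \int[Pr]_w (cst c%:E w) = c%:E.
    by rewrite integral_cst// [X in _ * X](@probability_setT _ _ _ Pr) mule1.
  by apply: ge0_le_integral => //; exact: mFxK.
have <- : \int[lambda]_K (cst c%:E K) = c%:E.
  by rewrite integral_cst// [X in _ * X](@probability_setT _ _ _ lambda) mule1.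
apply: ge0_le_integral => //.
- by move=> K _; exact: integral_ge0.
- apply: (@measurable_fun_fubini_tonelli_F _ _ _ _ _ Pr (F \o path_from X x) mFx).
  by move=> z; exact: F0.
Qed.

(** The coset of x has at least the mass of x itself. *)
Lemma cross_entropy_le_entropy p : is_pmf p ->
  cross_entropy p p <= entropy [set: G] p.
Proof.
move=> pp; have mp := pmf_mass pp.
rewrite entropyE /cross_entropy.
rewrite (integral_path_measure G_countable X_iid lambda mp (fun a => nlcmass_ge0 a pp)
  (measurable_nlcmass G_countable mp)).
apply: le_wsum => // x px; apply: integral_path_law_le.
- by have := nlpmf_ge0 x pp; rewrite lee_fin.
- by move=> a; exact: nlcmass_ge0.
- exact: measurable_nlcmass.
- move=> K w; have le1 := mass_ge_point mp (rcoset_by_refl K x).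
  rewrite lee_fin lerN2 /path_from cmass_coset_path /= mulg1.
  by rewrite ler_ln ?posrE//; exact: lt_le_trans px le1.
Qed.

Lemma integral_path_mixture k (P : nat -> G -> R) F : (0 < k)%N -> (forall i, is_pmf (P i)) ->
  (forall a, 0 <= F a) -> measurable_fun setT F ->
  \int[M (mixture k P)]_a F a = (k%:R^-1)%:E * \sum_(i < k) \int[M (P i)]_a F a.
Proof.
move=> k0 pP F0 mF; have mP i := pmf_mass (pP i).
have mM := pmf_mass (mixture_pmf k0 pP).
rewrite (integral_path_measure G_countable X_iid lambda mM F0 mF) wsum_mixture//; last first.
  by move=> x; exact: integral_ge0.
congr (_ * _); apply: eq_bigr => i _; apply/esym.
exact: (integral_path_measure G_countable X_iid lambda (mP i) F0 mF).
Qed.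

(** Domination passes to cosets: kappa_p <= c kappa_q, so -ln kappa_q exceeds -ln kappa_p by at most
    ln c. *)
Lemma cross_entropy_dominated p q (c : R) : is_pmf p -> is_pmf q -> (1 <= c)%R ->
  (forall x, p x <= c * q x)%R -> cross_entropy p q <= cross_entropy p p + (ln c)%:E.
Proof.
move=> pp pq c1 domp; have mp := pmf_mass pp; have mq := pmf_mass pq.
have c0 : (0 < c)%R by exact: lt_le_trans c1.
rewrite -[in leRHS](integral_path_cst G_countable X_iid lambda (ln c)%:E pp).
have ln0 : 0 <= (ln c)%:E by rewrite lee_fin ln_ge0.
rewrite /cross_entropy -ge0_integralD//; last 2 first.
- by move=> a _; exact: nlcmass_ge0.
- exact: measurable_nlcmass.
apply: ae_ge0_le_integral => //.
- by move=> a _; exact: nlcmass_ge0.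
- exact: measurable_nlcmass.
- by move=> a _; apply: adde_ge0 => //; exact: nlcmass_ge0.
- by apply: emeasurable_funD => //; exact: measurable_nlcmass.
apply: filterS (cmass_gt0_ae G_countable X_iid lambda mp) => a pa _.
have qa := dominated_cmass_gt0 mp mq (ltW c0) domp pa.
rewrite -EFinD lee_fin lerNl opprD opprK lerBlDr -lnM ?posrE// mulrC.
rewrite ler_ln ?posrE// ?mulr_gt0//.
exact: le_mass (ltW c0) domp.
Qed.

Lemma cross_entropy_self_le p q (c : R) : is_pmf p -> is_pmf q -> (0 <= c)%R ->
  (forall x, p x <= c * q x)%R -> cross_entropy p p <= cross_entropy p q.
Proof.
move=> pp pq c0 domp; rewrite (divergence_cross_entropy G_countable X_iid lambda pp pq c0 domp).
by rewrite leeDr// divergence_ge0//; exact: pmf_mass.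
Qed.

Lemma cross_entropy_fin_num p : is_pmf p -> cross_entropy p p < +oo ->
  cross_entropy p p \is a fin_num.
Proof. by move=> pp; rewrite (ge0_fin_numE (cross_entropy_ge0 G_countable X_iid lambda p pp)). Qed.

Lemma cmass_act g p (a : borel (tSubG G)) : mass_function p ->
  cmass (left_translate g p) (act_tSubG g a) = cmass p a.
Proof.
move=> mp; rewrite /cmass /mass wsum_translate.
congr fine; congr wsum; apply/funext => x.
by rewrite /= /translate_by mulKg.
Qed.

Lemma cross_entropy_translate g p : is_pmf p ->
  cross_entropy (left_translate g p) (left_translate g p) = cross_entropy p p.
Proof.
move=> pp; have mp := pmf_mass pp; have pgp := left_translate_pmf g pp.
rewrite /cross_entropy -(integral_path_act G_countable X_iid lambda_invariant g mp
  (fun a => nlcmass_ge0 a pgp) (measurable_nlcmass G_countable (pmf_mass pgp))).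
by apply: eq_integral => a _; rewrite cmass_act.
Qed.

(** mu g * p (g^-1 x) is one term of the convolution of mu and p at x. *)
Lemma left_translate_dominated g p : mass_function p -> (0 < mu g)%R ->
  forall x, (left_translate g p x <= (mu g)^-1 * convolution mu p x)%R.
Proof.
move=> mp mug x; rewrite ler_pdivlMl//.
have := convolution_le g (g^-1 * x)%g (pmf_mass mu_pmf) mp.
by rewrite mulVKg.
Qed.

Lemma integral_first_step p F : is_pmf p -> (forall a, 0 <= F a) -> measurable_fun setT F ->
  \int[M (convolution mu p)]_a F a = wsum mu (fun g => \int[M (left_translate g p)]_a F a).
Proof.
move=> pp F0 mF; have mp := pmf_mass pp; have mmu := pmf_mass mu_pmf.
have mc := convolution_mass mmu mp.
rewrite (integral_path_measure G_countable X_iid lambda mc F0 mF) wsum_convolution//; last first.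
  by move=> x; exact: integral_ge0.
apply: eq_wsum => // g _; apply/esym.
rewrite (integral_path_measure G_countable X_iid lambda (left_translate_mass g mp) F0 mF).
exact: wsum_translate.
Qed.

(** Commutation lets the last step of [next p] be read as a first step g. Averaging over g, L(gp,
    next p) = D(gp, next p) + L(gp, gp), and the last term is L(p, p) for every g by invariance of
    lambda. *)
Lemma cross_entropy_increment p : is_pmf p -> convolution mu p = next p ->
  cross_entropy (next p) (next p) =
  wsum mu (fun g => divergence (left_translate g p) (next p)) + cross_entropy p p.
Proof.
move=> pp comm; have mp := pmf_mass pp; have mmu := pmf_mass mu_pmf.
have pnp := convolution_pmf pp mu_pmf.
have nl0 a := nlcmass_ge0 a pnp.
have mnl := measurable_nlcmass G_countable (pmf_mass pnp).
have := integral_first_step pp nl0 mnl; rewrite comm => E1.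
apply: etrans E1 _.
rewrite -(pmf_wsum_cst mu_pmf (cross_entropy_ge0 G_countable X_iid lambda p pp)).
rewrite -wsumD//; last 2 first.
- move=> g; apply: divergence_ge0; [exact: left_translate_mass|exact: pmf_mass].
- by move=> g; exact: cross_entropy_ge0.
apply: eq_wsum => // g mug.
have pgp := left_translate_pmf g pp.
have inv0 : (0 <= (mu g)^-1)%R by rewrite invr_ge0 ltW.
have domp := left_translate_dominated mp mug; rewrite comm in domp.
have := divergence_cross_entropy G_countable X_iid lambda pgp pnp inv0 domp.
by rewrite cross_entropy_translate.
Qed.

(** Data processing for gp against [next p]; left translation commutes with convolution on the
    right, and the finite self entropies cancel. *)
Lemma divergence_next_le p g : is_pmf p -> convolution mu p = next p -> (0 < mu g)%R ->
  cross_entropy p p < +oo -> cross_entropy (next p) (next p) < +oo ->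
  divergence (left_translate g (next p)) (next (next p)) <=
  divergence (left_translate g p) (next p).
Proof.
move=> pp comm mug Lp Lnp; have mp := pmf_mass pp; have mmu := pmf_mass mu_pmf.
have pnp := convolution_pmf pp mu_pmf; have pnnp := convolution_pmf pnp mu_pmf.
have mnp := pmf_mass pnp.
have pgp := left_translate_pmf g pp; have mgp := pmf_mass pgp.
have inv0 : (0 <= (mu g)^-1)%R by rewrite invr_ge0 ltW.
have domp := left_translate_dominated mp mug; rewrite comm in domp.
have gnp : next (left_translate g p) = left_translate g (next p).
  exact: left_translate_convolution.
have ngp := convolution_pmf pgp mu_pmf.
have domnp := next_dominated mgp mnp inv0 domp.
have := cross_entropy_next_le pgp pnp inv0 domp.
rewrite (divergence_cross_entropy G_countable X_iid lambda pgp pnp inv0 domp).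
rewrite (divergence_cross_entropy G_countable X_iid lambda ngp pnnp inv0 domnp).
rewrite gnp (cross_entropy_translate g pp) (cross_entropy_translate g pnp).
have f0 := cross_entropy_fin_num pp Lp.
have f1 := cross_entropy_fin_num pnp Lnp.
exact: (lee_cancel f0 f1).
Qed.

End DataProcessing.

Opaque cross_entropy divergence.

(** * The zero-two law *)

Section BinomialExpectation.
Context (R : realType) (c s : R).
Local Open Scope ring_scope.
Hypotheses (c0 : 0 <= c) (s0 : 0 <= s) (cs1 : c + s = 1).
Implicit Types f : nat -> R.

(* The expectation of [f] at a binomial variable of parameters [m] and [s]. *)
Fixpoint binexp (m : nat) f : R :=
  if m is n.+1 then c * binexp n f + s * binexp n (fun i => f i.+1) else f 0%N.

Lemma binexpS m f :
  binexp m.+1 f = c * binexp m f + s * binexp m (fun i => f i.+1).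
Proof. by []. Qed.

Lemma eq_binexp m f g : f =1 g -> binexp m f = binexp m g.
Proof. by move=> fg; congr binexp; apply/funext. Qed.

Lemma binexpD m f g : binexp m (fun i => f i + g i) = binexp m f + binexp m g.
Proof. by elim: m f g => //= m IHm f g; rewrite !IHm !mulrDr addrACA. Qed.

Lemma binexpZ m (a : R) f : binexp m (fun i => a * f i) = a * binexp m f.
Proof. by elim: m f => //= m IHm f; rewrite !IHm mulrDr !(mulrCA a). Qed.

Lemma binexp_cst m (a : R) : binexp m (fun=> a) = a.
Proof. by elim: m => //= m ->; rewrite -mulrDl cs1 mul1r. Qed.

Lemma binexp_ge0 m f : (forall i, 0 <= f i) -> 0 <= binexp m f.
Proof. by elim: m f => //= m IHm f f0; rewrite addr_ge0// mulr_ge0// IHm. Qed.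

Lemma le_binexp m f g : (forall i, f i <= g i) -> binexp m f <= binexp m g.
Proof.
elim: m f g => [f g|m IHm f g fg] /=; first exact.
by rewrite lerD// ler_wpM2l// IHm.
Qed.

Lemma binexp_norm m f : `|binexp m f| <= binexp m (fun i => `|f i|).
Proof.
rewrite ler_norml; apply/andP; split; last by apply: le_binexp => i; exact: ler_norm.
rewrite lerNl -mulN1r -binexpZ; apply: le_binexp => i.
by rewrite mulN1r -normrN ler_norm.
Qed.

(** The binomial law of parameters m and s is the one of parameters m.+1 and s reweighted by (m.+1 -
    i) / (m.+1 * c). Consecutive binomial laws are thus compared through the deviation of this
    weight from 1. *)
Lemma binexp_size_bias m f :
  binexp m.+1 (fun i => (m.+1%:R - i%:R) * f i) = m.+1%:R * c * binexp m f.
Proof.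
elim: m f => [f|m IHm f].
  by rewrite /= subr0 mulr1n !mul1r subrr mul0r mulr0 addr0.
pose g i := (m.+1%:R - i%:R) * f i.
have -> : binexp m.+2 (fun i => (m.+2%:R - i%:R) * f i) =
    c * binexp m.+1 (fun i => g i + f i) +
    s * binexp m.+1 (fun i => (m.+1%:R - i%:R) * f i.+1).
  rewrite binexpS; congr (_ * _ + _ * _); apply: eq_binexp => i.
    by rewrite /g -[m.+2%:R]natr1 addrAC mulrDl mul1r.
  by rewrite -[m.+2%:R]natr1 -[i.+1%:R]natr1 opprD addrACA subrr addr0.
rewrite binexpD (IHm f) (IHm (fun i => f i.+1)) [binexp m.+1 f]binexpS -[m.+2%:R]natr1.
exact: size_bias_identity.
Qed.

Lemma binexp_mean m : binexp m (fun i => m%:R - i%:R) = m%:R * c.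
Proof.
case: m => [|m]; first by rewrite /= subrr mul0r.
have := binexp_size_bias m (fun=> 1); rewrite binexp_cst mulr1 => <-.
by apply: eq_binexp => i; rewrite mulr1.
Qed.

Lemma binexp_deviation m : (0 < c) ->
  binexp m.+1 (fun i => (1 - (m.+1%:R * c)^-1 * (m.+1%:R - i%:R)) ^+ 2) <= (m.+1%:R * c)^-1.
Proof.
move=> cgt0; set N := m.+1%:R; set z := (N * c)^-1.
have Nc : 0 < N * c by rewrite mulr_gt0// ltr0Sn.
have zNc : z * (N * c) = 1 by rewrite mulVf// gt_eqF.
have z0 : 0 <= z by rewrite invr_ge0 ltW.
have -> : binexp m.+1 (fun i => (1 - z * (N - i%:R)) ^+ 2) =
    1 + (- (z + z) * (N * c) + z * z * (N * c * (m%:R * c + 1))).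
  transitivity (binexp m.+1 (fun i => 1 + (- (z + z) * (N - i%:R) +
      z * z * ((N - i%:R) * (N - i%:R))))).
    by apply: eq_binexp => i; rewrite expr2; exact: deviation_identity.
  rewrite !binexpD binexp_cst !binexpZ binexp_mean binexp_size_bias.
  congr (_ + (_ + _ * (_ * _))).
  transitivity (binexp m (fun i => (m%:R - i%:R) + 1)).
    by apply: eq_binexp => i; rewrite /N -natr1 addrAC.
  by rewrite binexpD binexp_mean binexp_cst.
rewrite deviation_sum_identity natr1 -/N zNc subrr mul0r add0r !mul1r addr0.
by rewrite -[leRHS]mulr1 ler_wpM2l// gerBl.
Qed.

Lemma binexp_abs_deviation m (e : R) : 0 < c -> 0 < e ->
  binexp m.+1 (fun i => `|1 - (m.+1%:R * c)^-1 * (m.+1%:R - i%:R)|) <=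
  e + e^-1 * (m.+1%:R * c)^-1.
Proof.
move=> cgt0 e0; apply: le_trans (_ : binexp m.+1 (fun i =>
    e + e^-1 * (1 - (m.+1%:R * c)^-1 * (m.+1%:R - i%:R)) ^+ 2) <= _).
  by apply: le_binexp => i; exact: norm_le_square.
by rewrite binexpD binexp_cst binexpZ lerD2l ler_wpM2l ?invr_ge0 ?(ltW e0)// binexp_deviation.
Qed.

End BinomialExpectation.

(** * Distances between convolution powers *)

Section ZeroTwoLaw.
Context (R : realType) (G : groupType).
Implicit Types (p q r mu : G -> R).

Definition l1dist p q : \bar R := \esum_(x in [set: G]) `|p x - q x|%:E.

Lemma mass_function_dist p q : mass_function p -> mass_function q ->
  mass_function (fun x => `|p x - q x|)%R.
Proof.
move=> mp mq; split=> //.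
apply: (@le_lt_trans _ _ (\esum_(x in [set: G]) ((p x)%:E + (q x)%:E))).
  apply: le_esum => x _; rewrite -EFinD lee_fin (le_trans (ler_normB _ _))//.
  by rewrite !ger0_norm ?mp.1 ?mq.1.
by rewrite esumD ?lte_add_pinfty ?mp.2 ?mq.2// => x _; rewrite lee_fin ?mp.1 ?mq.1.
Qed.

Lemma convolution_dist_le p q r x : mass_function p -> mass_function q -> mass_function r ->
  (`|convolution p r x - convolution q r x| <= convolution (fun y => `|p y - q y|) r x)%R.
Proof.
move=> mp mq mr; have mpq := mass_function_dist mp mq.
have H p' q' : mass_function p' -> mass_function q' ->
    (convolution p' r x - convolution q' r x <= convolution (fun y => `|p' y - q' y|) r x)%R.
  move=> mp' mq'; have mpq' := mass_function_dist mp' mq'.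
  rewrite lerBlDr -lee_fin EFinD !convolutionE// /wsum -esumD; last 2 first.
  - by move=> y _; rewrite -EFinM lee_fin mulr_ge0// mr.1.
  - by move=> y _; rewrite -EFinM lee_fin mulr_ge0 ?mr.1 ?mq'.1.
  apply: le_esum => y _; rewrite -!EFinM -EFinD lee_fin -mulrDl ler_wpM2r ?mr.1//.
  by rewrite -lerBlDr ler_norm.
rewrite ler_norml H// andbT lerNl opprB.
have -> : (fun y => `|p y - q y|)%R = (fun y => `|q y - p y|)%R.
  by apply/funext => y; rewrite distrC.
exact: H.
Qed.

Lemma l1dist_convolution_le p q r : mass_function p -> mass_function q -> is_pmf r ->
  l1dist (convolution p r) (convolution q r) <= l1dist p q.
Proof.
move=> mp mq pr; have mr := pmf_mass pr; have mpq := mass_function_dist mp mq.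
apply: le_trans (_ : \esum_(x in [set: G]) (convolution (fun y => `|p y - q y|)%R r x)%:E <= _).
  by apply: le_esum => x _; rewrite lee_fin convolution_dist_le.
have := wsum_convolution mpq mr (fun _ => lee01 : 0 <= 1 :> \bar R).
rewrite {1}/wsum; under eq_esum do rewrite mule1.
move=> ->.
have -> : (fun y : G => wsum r (fun=> 1)) = cst (1 : \bar R).
  by apply/funext => y; exact: pmf_wsum_cst.
by rewrite wsum_cst// mul1e.
Qed.

Lemma mass_function_linear (a b : R) p q : (0 <= a)%R -> (0 <= b)%R ->
  mass_function p -> mass_function q -> mass_function (fun x => a * p x + b * q x)%R.
Proof.
move=> a0 b0 mp mq; split=> [x|]; first by rewrite addr_ge0 ?mulr_ge0 ?mp.1 ?mq.1.
have p0 x : 0 <= (p x)%:E by rewrite lee_fin mp.1.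
have q0 x : 0 <= (q x)%:E by rewrite lee_fin mq.1.
under eq_esum do rewrite EFinD !EFinM.
rewrite esumD ?esumZl//; last 2 first.
- by move=> x _; rewrite mule_ge0.
- by move=> x _; rewrite mule_ge0.
by rewrite lte_add_pinfty// lte_mul_pinfty ?mp.2 ?mq.2.
Qed.

Lemma convolution_linear (a b : R) p q r : (0 <= a)%R -> (0 <= b)%R ->
  mass_function p -> mass_function q -> mass_function r ->
  convolution (fun x => a * p x + b * q x)%R r =
  (fun x => a * convolution p r x + b * convolution q r x)%R.
Proof.
move=> a0 b0 mp mq mr; apply/funext => x; apply: EFin_inj.
have mpq := mass_function_linear a0 b0 mp mq.
have r0 y : 0 <= (r y)%:E by rewrite lee_fin mr.1.
have p0 y : 0 <= (p y)%:E by rewrite lee_fin mp.1.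
have q0 y : 0 <= (q y)%:E by rewrite lee_fin mq.1.
rewrite EFinD !EFinM !convolutionE// /wsum -!esumZl//; last 2 first.
- by move=> y; rewrite mule_ge0.
- by move=> y; rewrite mule_ge0.
rewrite -esumD; last 2 first.
- by move=> y _; rewrite !mule_ge0.
- by move=> y _; rewrite !mule_ge0.
by apply: eq_esum => y _; rewrite !muleA -!EFinM -EFinD mulrDl.
Qed.

Section Lazy.
Variables (nu rho : G -> R) (c s : R).
Hypotheses (c0 : (0 < c)%R) (s0 : (0 <= s)%R) (cs1 : (c + s = 1)%R).
Hypotheses (nu_pmf : is_pmf nu) (rho_mass : mass_function rho).
Hypothesis rho_le1 : \esum_(x in [set: G]) (rho x)%:E <= 1.
Local Notation e := (convolution_power nu 0).
Hypothesis nuE : nu = (fun x => c * e x + s * rho x)%R.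

Let c0' : (0 <= c)%R. Proof. exact: ltW. Qed.

Let me : mass_function e. Proof. exact: pmf_mass (convolution_power_pmf 0 nu_pmf). Qed.

Lemma convolution_lazy p : mass_function p ->
  convolution p nu = (fun x => c * p x + s * convolution p rho x)%R.
Proof.
move=> mp; apply/funext => x; apply: EFin_inj.
have := congr1 (fun f => (f x)%:E) (convolutionp1 mp nu_pmf); rewrite /= convolutionE// => pE.
rewrite EFinD !EFinM -pE !convolutionE//; last exact: pmf_mass.
have r0 y : 0 <= (rho y)%:E by rewrite lee_fin rho_mass.1.
have d0 y : 0 <= (((y^-1 * x)%g == 1%g)%:R)%:E :> \bar R by rewrite lee_fin ler0n.
rewrite -[c%:E * _]wsumZ// -[s%:E * _]wsumZ// -wsumD//; last 2 first.
- by move=> y; apply: mule_ge0.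
- by move=> y; apply: mule_ge0.
by congr wsum; apply/funext => y; rewrite nuE -!EFinM -EFinD.
Qed.

Local Notation rhos i p := (iter i (fun q => convolution q rho) p).

Lemma mass_rhos i p : mass_function p -> mass_function (rhos i p).
Proof.
by move=> mp; elim: i => [//|i IHi]; rewrite iterS; exact: (convolution_mass IHi rho_mass).
Qed.

Lemma rhos_linear i p q : mass_function p -> mass_function q ->
  rhos i (fun x => c * p x + s * q x)%R = (fun x => c * rhos i p x + s * rhos i q x)%R.
Proof.
move=> mp mq; elim: i => [//|i IHi]; rewrite !iterS IHi.
exact: (convolution_linear c0' s0 (mass_rhos i mp) (mass_rhos i mq) rho_mass).
Qed.

(** A step of nu stays put with weight c and moves by rho with weight s, so after m steps the number
    i of moves is binomial. *)
Lemma iter_lazy m p x : mass_function p ->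
  iter m (fun q => convolution q nu) p x = binexp c s m (fun i => rhos i p x).
Proof.
elim: m p => // m IHm p mp.
have mpr := convolution_mass mp rho_mass.
rewrite iterSr IHm; last exact: convolution_mass (pmf_mass nu_pmf).
rewrite convolution_lazy// binexpS -!binexpZ -binexpD.
by apply: eq_binexp => i; rewrite rhos_linear// -iterSr.
Qed.

Lemma esum_rhos_le1 i : \esum_(x in [set: G]) (rhos i e x)%:E <= 1.
Proof.
elim: i => [|i IHi]; first by rewrite /= (convolution_power_pmf 0 nu_pmf).2.
have mi := mass_rhos i me.
have := wsum_convolution mi rho_mass (fun _ => lee01 : 0 <= 1 :> \bar R).
rewrite {1}/wsum; under eq_esum do rewrite mule1.
move=> ->; apply: le_trans (_ : wsum (rhos i e) (cst 1) <= _).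
  apply: le_wsum => // y _; rewrite /wsum; under eq_esum do rewrite mule1.
  exact: rho_le1.
by rewrite wsum_cst// mul1e.
Qed.

Lemma esum_binexp_le m (h : nat -> R) (f : nat -> G -> R) : (forall i, 0 <= h i)%R ->
  (forall i, mass_function (f i)) ->
  (forall i, \esum_(x in [set: G]) (f i x)%:E <= 1) ->
  \esum_(x in [set: G]) (binexp c s m (fun i => h i * f i x)%R)%:E <= (binexp c s m h)%:E.
Proof.
elim: m h f => [|m IHm] h f h0 mf f1.
  rewrite /=; under eq_esum do rewrite EFinM.
  rewrite esumZl ?lee_fin//; last by move=> x; rewrite lee_fin (mf _).1.
  by rewrite -[leRHS]mule1 lee_wpmul2l// lee_fin.
have B0 (g : nat -> G -> R) (k : nat -> R) x : (forall i, 0 <= k i)%R ->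
    (forall i, mass_function (g i)) -> 0 <= (binexp c s m (fun i => k i * g i x)%R)%:E.
  by move=> k0 mg; rewrite lee_fin binexp_ge0// => i; rewrite mulr_ge0// (mg i).1.
rewrite binexpS EFinD !EFinM.
under eq_esum do rewrite binexpS EFinD !EFinM.
have B1 x := B0 f h x h0 mf.
have B2 x := B0 (fun i => f i.+1) (fun i => h i.+1) x (fun i => h0 i.+1) (fun i => mf i.+1).
rewrite esumD; last 2 first.
- by move=> x _; rewrite mule_ge0.
- by move=> x _; rewrite mule_ge0.
rewrite !esumZl//; apply: leeD; apply: lee_wpmul2l => //; exact: IHm.
Qed.

Lemma l1dist_lazy_le m (eps : R) : (0 < eps)%R ->
  l1dist (iter m.+1 (fun q => convolution q nu) e) (iter m (fun q => convolution q nu) e) <=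
  (eps + eps^-1 * (m.+1%:R * c)^-1)%:E.
Proof.
move=> eps0; set z := (m.+1%:R * c)^-1%R.
have mc : (m.+1%:R * c != 0)%R by rewrite mulf_neq0 ?gt_eqF.
apply: le_trans (_ : \esum_(x in [set: G]) (binexp c s m.+1
    (fun i => `|1 - z * (m.+1%:R - i%:R)| * rhos i e x)%R)%:E <= _).
  apply: le_esum => x _; rewrite lee_fin !iter_lazy//.
  (* Both powers become expectations under the same binomial law, so their difference carries the
     factor 1 - z (m.+1 - i). *)
  have -> : binexp c s m (fun i => rhos i e x) =
      binexp c s m.+1 (fun i => z * (m.+1%:R - i%:R) * rhos i e x)%R.
    transitivity (z * (m.+1%:R * c) * binexp c s m (fun i => rhos i e x))%R.
      by rewrite mulVf// mul1r.
    rewrite -mulrA -binexp_size_bias -binexpZ.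
    by apply: eq_binexp => i; rewrite mulrA.
  rewrite -mulN1r -binexpZ -binexpD; apply: le_trans (binexp_norm _ _ _ _) _ => //.
  apply: le_binexp => // i; have r0 := (mass_rhos i me).1 x.
  rewrite -[X in (X + _)%R]mul1r mulrA mulN1r -mulrDl normrM.
  by rewrite [X in (_ * X <= _)%R]ger0_norm.
have le1 i := esum_rhos_le1 i.
apply: le_trans (esum_binexp_le _ _ (fun i => mass_rhos i me) le1) _ => //.
by rewrite lee_fin; exact: binexp_abs_deviation.
Qed.

End Lazy.
Lemma convolution_power_mul mu k m : is_pmf mu ->
  convolution_power mu (m * k) =
  iter m (fun q => convolution q (convolution_power mu k)) (convolution_power mu 0).
Proof.
move=> pmu; elim: m => [|m IHm]; first by rewrite mul0n.
by rewrite iterS -IHm mulSn addnC convolution_powerD.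
Qed.

(** The power mu^k is lazy, so its consecutive powers are close by [l1dist_lazy_le]; convolving with
    the remaining mu^r does not increase the distance. *)
Lemma zero_two_law mu k : is_pmf mu -> (0 < convolution_power mu k 1%g)%R ->
  forall eps : R, (0 < eps)%R -> exists N, forall n, (N <= n)%N ->
  l1dist (convolution_power mu (n + k)) (convolution_power mu n) <= eps%:E.
Proof.
move=> pmu nu1 eps eps0; set nu := convolution_power mu k.
have pnu : is_pmf nu by exact: convolution_power_pmf.
have mnu := pmf_mass pnu.
(* Half of the mass at 1, so that s > 0 even if nu is concentrated at 1. *)
pose c := (nu 1%g / 2)%R; pose s := (1 - c)%R.
have c0 : (0 < c)%R by rewrite divr_gt0.
have nu1le : (nu 1%g <= 1)%R.
  rewrite -lee_fin -pnu.2.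
  by apply: (@esum_ge_term _ _ (EFin \o nu)) => x; rewrite lee_fin mnu.1.
have s0 : (0 < s)%R.
  by rewrite subr_gt0 ltr_pdivrMr// mul1r (le_lt_trans nu1le)// ltr1n.
have cs1 : (c + s = 1)%R by rewrite addrC subrK.
pose e := convolution_power nu 0.
pose rho x := (s^-1 * (nu x - c * e x))%R.
have nuE : nu = (fun x => c * e x + s * rho x)%R.
  by apply/funext => x; rewrite mulrA divff ?gt_eqF// mul1r addrC subrK.
have rho0 x : (0 <= rho x)%R.
  rewrite mulr_ge0 ?invr_ge0 ?(ltW s0)// subr_ge0 /e /=.
  case: eqVneq => [->|_]; last by rewrite mulr0 mnu.1.
  by rewrite mulr1 ler_pdivrMr// ler_peMr ?mnu.1// ler1n.
have E1 : \esum_(x in [set: G]) (rho x)%:E = 1.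
  have e0 x : 0 <= (e x)%:E by rewrite lee_fin (convolution_power_pmf 0 pnu).1.
  have r0 x : 0 <= (rho x)%:E by rewrite lee_fin.
  have : \esum_(x in [set: G]) (c%:E * (e x)%:E + s%:E * (rho x)%:E) = 1.
    rewrite -pnu.2; apply: eq_esum => x _; rewrite -!EFinM -EFinD.
    by rewrite [in RHS]nuE.
  rewrite esumD; last 2 first.
  - by move=> x _; rewrite mule_ge0// lee_fin ltW.
  - by move=> x _; rewrite mule_ge0// lee_fin ltW.
  rewrite !esumZl ?lee_fin ?(ltW c0) ?(ltW s0)// (convolution_power_pmf 0 pnu).2 mule1.
  move=> /(congr1 (fun y => s^-1%:E * (y - c%:E))); rewrite addeAC subee// add0e.
  by rewrite muleA -EFinM mulVf ?gt_eqF// mul1e => ->.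
have mrho : mass_function rho by split=> //; rewrite E1 ltry.
(* This makes (eps/2)^-1 / (M.+1 * c) at most eps/2 in the bound of [l1dist_lazy_le] taken at
   eps/2. *)
pose M := Num.bound ((eps / 2)^-1 * ((eps / 2)^-1 * c^-1)).
exists (M * k)%N => n Mn.
have mP i := pmf_mass (convolution_power_pmf i pmu).
set r := (n - M * k)%N.
rewrite (_ : n + k = M.+1 * k + r)%N; last by rewrite mulSn /r; lia.
rewrite [X in l1dist _ (convolution_power mu X)](_ : n = M * k + r)%N; last by rewrite subnKC.
rewrite (convolution_powerD (M.+1 * k) r pmu) (convolution_powerD (M * k) r pmu).
apply: le_trans (l1dist_convolution_le (mP (M.+1 * k)%N) (mP (M * k)%N) (convolution_power_pmf r pmu)) _.
rewrite (convolution_power_mul k M.+1 pmu) (convolution_power_mul k M pmu).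
have e2 : (0 < eps / 2)%R by rewrite divr_gt0.
have /= := l1dist_lazy_le c0 (ltW s0) cs1 pnu mrho _ nuE M e2.
rewrite E1 => /(_ (lexx _)) /le_trans; apply.
rewrite lee_fin [leRHS](splitr eps) lerD2l.
move: e2 @M Mn @r; set e2 := (eps / 2)%R => e20 M Mn r.
have x0 : (0 <= e2^-1 * (e2^-1 * c^-1))%R.
  by rewrite !mulr_ge0 ?invr_ge0 ?(ltW e20)// ltW.
have : (e2^-1 * (e2^-1 * (c^-1 * 1)) <= M.+1%:R)%R.
  rewrite mulr1 (le_trans (ltW (archi_boundP x0)))// ler_nat.
  exact: leqnSn.
rewrite !ler_pdivrMl// => H.
have Mc : (0 < M.+1%:R * c)%R by rewrite mulr_gt0.
rewrite -[X in (X <= _)%R]mulr1 ler_pdivrMl//.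
by rewrite square_shuffle_identity.
Qed.

End ZeroTwoLaw.

(** * Limits of densities along the tail *)

Section InvariantLimit.
Context d (T : measurableType d) (R : realType) (m : {measure set T -> \bar R}).
Hypothesis m1 : m setT = 1.

Lemma limn_esupS (u : (\bar R)^nat) : limn_esup (fun n => u n.+1) = limn_esup u.
Proof.
rewrite !limn_esup_lim.
have -> : esups (fun n => u n.+1) = (fun n => esups u n.+1).
  apply/funext => n; rewrite /esups /sdrop /=; congr ereal_sup.
  apply/seteqP; split=> [_ [k /= nk <-]|_ [k /= nk <-]]; first by exists k.+1.
  by case: k nk => // k nk; exists k.
apply: cvg_lim => //; rewrite (cvg_shiftS (esups u)); exact: is_cvg_esups.
Qed.

(** The integral of the whole series is finite, hence so is the series almost everywhere. It serves
    to turn fast L^1 convergence into pointwise convergence. *)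
Lemma ae_summable (f : nat -> T -> R) : (forall l x, (0 <= f l x)%R) ->
  (forall l, measurable_fun setT (f l)) ->
  (forall l, \int[m]_x (f l x)%:E <= (1 / (2 ^ (l + 1))%:R)%:E) ->
  {ae m, forall x, cvgn (series (f ^~ x))}.
Proof.
move=> f0 mf fle.
have f0' l x : setT x -> 0 <= (f l x)%:E by move=> _; rewrite lee_fin.
have mf' l : measurable_fun setT (fun x => (f l x)%:E) by exact/measurable_EFinP.
pose F x := \sum_(0 <= l <oo) (f l x)%:E.
have F0 x : 0 <= F x by apply: nneseries_ge0 => l _ _; exact: f0'.
have mF : measurable_fun setT F.
  by apply: ge0_emeasurable_sum => // l x _ _; exact: f0'.
have iF : m.-integrable setT F.
  apply/integrableP; split => //.
  have -> : \int[m]_x `|F x| = \int[m]_x F x.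
    by apply: eq_integral => x _; rewrite gee0_abs.
  rewrite integral_nneseries//.
  apply: le_lt_trans (_ : \sum_(0 <= l <oo) ((1 / (2 ^ (l + 1))%:R)%:E : \bar R) < _).
    by apply: lee_nneseries => l *; [apply: integral_ge0 => x; exact: f0'|exact: fle].
  by rewrite (cvg_lim _ (@cvg_geometric_eseries_half R 1%R 0))// ltry.
have := integrable_ae measurableT iF; apply: filterS => x /(_ I) Fx.
apply: nnseries_is_cvg => //.
by move: Fx; rewrite (ge0_fin_numE (F0 x)).
Qed.

Variables (C : R) (V : nat -> T -> R).
Hypothesis C0 : (0 <= C)%R.
Hypothesis V0 : forall n x, (0 <= V n x)%R.
Hypothesis VC : forall n x, (V n x <= C)%R.
Hypothesis mV : forall n, measurable_fun setT (V n).

Let mVV i j : measurable_fun setT (fun x => (V i x * V j x)%:E).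
Proof. by apply/measurable_EFinP; exact: measurable_funM. Qed.

Let VV0 i j x : setT x -> 0 <= (V i x * V j x)%:E.
Proof. by move=> _; rewrite lee_fin mulr_ge0. Qed.

Let IVV i j : 0 <= \int[m]_x (V i x * V j x)%:E.
Proof. by apply: integral_ge0 => x; exact: VV0. Qed.

Lemma integral_prob_le (f : T -> \bar R) (c : R) : (forall x, 0 <= f x) ->
  measurable_fun setT f -> (forall x, f x <= c%:E) -> \int[m]_x f x <= c%:E.
Proof.
move=> f0 mf fc; have <- : \int[m]_x (cst c%:E x) = c%:E.
  by rewrite integral_cst// m1 mule1.
by apply: ge0_le_integral => // x _; rewrite (le_trans (f0 x)).
Qed.

(* Reverse martingales converge in L^2: the increments are orthogonal. *)
Lemma reverse_martingale_cauchy :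
  (forall i j, (i <= j)%N ->
    \int[m]_x (V i x * V j x)%:E = \int[m]_x (V j x * V j x)%:E) ->
  forall eps : R, (0 < eps)%R -> exists N, forall i j, (N <= i)%N -> (i <= j)%N ->
    \int[m]_x `|V i x - V j x|%:E <= eps%:E.
Proof.
move=> orth eps eps0; pose a n := fine (\int[m]_x (V n x * V n x)%:E).
have aE n : (a n)%:E = \int[m]_x (V n x * V n x)%:E.
  rewrite /a fineK// ge0_fin_numE; last exact: IVV.
  apply: (@le_lt_trans _ _ (C * C)%:E); last exact: ltry.
  by apply: integral_prob_le => // x; [exact: VV0|rewrite lee_fin ler_pM].
pose Q i j x := ((V i x - V j x) ^+ 2)%R.
have mQ i j : measurable_fun setT (fun x => (Q i j x)%:E).
  by apply/measurable_EFinP; apply: measurable_funX; exact: measurable_funB.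
have Q0 i j x : 0 <= (Q i j x)%:E by rewrite lee_fin sqr_ge0.
have QE i j : (i <= j)%N -> \int[m]_x (Q i j x)%:E = (a i - a j)%:E.
  move=> ij.
  (* The double product is moved to the other side to stay with nonnegative integrands; by
     orthogonality its integral is a j. *)
  have : \int[m]_x (Q i j x)%:E + (a j + a j)%:E = (a i + a j)%:E.
    rewrite !EFinD {1 2}(aE j) -{1 2}(orth i j ij) aE.
    rewrite [X in _ = _ + X]aE -!ge0_integralD//; do ?[by move=> x _; exact: VV0|exact: mVV].
    - apply: eq_integral => x _; rewrite -!EFinD; congr EFin.
      by rewrite /Q; exact: square_sub_identity.
    - by move=> x _; rewrite adde_ge0// VV0.
    - by apply: emeasurable_funD.
  move=> /(congr1 (fun y => y - (a j + a j)%:E)).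
  by rewrite addeK// => ->; rewrite -EFinB opprD addrACA subrr addr0.
have a_ni : {homo a : i j / (i <= j)%N >-> (j <= i)%R}.
  move=> i j ij; rewrite -subr_ge0 -lee_fin -QE//; apply: integral_ge0 => x _; exact: Q0.
have a_lb : has_lbound (range a).
  by exists 0%R => _ [n _ <-]; rewrite -lee_fin aE; exact: IVV.
have := nonincreasing_cvgn a_ni a_lb; set l := inf _ => al.
have l_le n : (l <= a n)%R by apply: ge_inf => //; exists n.
have e2 : (0 < eps / 2)%R by rewrite divr_gt0.
(* With e = eps/2 in [norm_le_square], an L^2 error of e^2 leaves e + e^-1 * e^2 = eps. *)
have e3 : (0 < (eps / 2) * (eps / 2))%R by rewrite mulr_gt0.
have /cvgrPdist_lt /(_ _ e3) [N _ HN] := al.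
exists N => i j Ni ij; pose e := (eps / 2)%R.
apply: (@le_trans _ _ (\int[m]_x (e%:E + (e^-1)%:E * (Q i j x)%:E))).
  apply: ge0_le_integral => //.
  - apply/measurable_EFinP; apply: measurableT_comp => //; exact: measurable_funB.
  - by apply: emeasurable_funD => //; exact: measurable_funeM.
  - by move=> x _; rewrite -EFinM -EFinD lee_fin norm_le_square.
rewrite ge0_integralD//; last 3 first.
- by move=> x _; rewrite lee_fin ltW.
- by move=> x _; rewrite mule_ge0// lee_fin invr_ge0 ltW.
- exact: measurable_funeM.
rewrite integral_cst// m1 mule1 ge0_integralZl//; last by rewrite lee_fin invr_ge0 ltW.
rewrite QE// -EFinM -EFinD lee_fin [leRHS](splitr eps) lerD2l ler_pdivrMl//.
have := HN i Ni; rewrite /= distrC ger0_norm ?subr_ge0// => /ltW; apply: le_trans.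
by rewrite lerD2l lerN2.
Qed.

Variable S : T -> T.
Hypothesis mS : measurable_fun setT S.

Let mSi i : measurable_fun setT (iter i S).
Proof. by elim: i => [|i IHi]; [exact: measurable_id|exact: measurableT_comp]. Qed.

Let mVS n i : measurable_fun setT (fun x => V n (iter i S x)).
Proof. exact: measurableT_comp. Qed.

(** Keeps the limit in [0, C] at every point, including where V does not converge and the upper
    limit may be meaningless. *)
Definition clip (y : R) : R := Num.max 0%R (Num.min C y).

Lemma clip_id y : (0 <= y)%R -> (y <= C)%R -> clip y = y.
Proof. by move=> y0 yC; rewrite /clip (min_idPr yC) (max_idPr y0). Qed.

Lemma clip_ge0 y : (0 <= clip y)%R.
Proof. by rewrite /clip le_max lexx. Qed.

Lemma clip_le y : (clip y <= C)%R.
Proof. by rewrite /clip ge_max C0 ge_min lexx. Qed.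

Lemma measurable_clip : measurable_fun setT clip.
Proof.
apply: measurable_maxr; first exact: measurable_cst.
by apply: measurable_minr; [exact: measurable_cst|exact: measurable_id].
Qed.

(** Along a fast subsequence V (j l) converges almost everywhere, and so does its value at each S^i
    x, to the same limit. The upper limit over i of the upper limits over l recovers this limit, and
    it is invariant everywhere because replacing x by S x only shifts i. *)
Lemma exists_invariant_limit :
  (forall eps : R, (0 < eps)%R -> exists N, forall i j, (N <= i)%N -> (i <= j)%N ->
    \int[m]_x `|V i x - V j x|%:E <= eps%:E) ->
  (forall i (eps : R), (0 < eps)%R -> exists N, forall n, (N <= n)%N ->
    \int[m]_x `|V n (iter i S x) - V n x|%:E <= eps%:E) ->
  exists (j : nat -> nat) (Psi : T -> R),
  [/\ forall l, (l <= j l)%N, measurable_fun setT Psi,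
      forall x, (0 <= Psi x <= C)%R, forall x, Psi (S x) = Psi x &
      {ae m, forall x, V (j l) x @[l --> \oo] --> Psi x}].
Proof.
move=> H1 H2; pose e l : R := (1 / (2 ^ (l + 1))%:R)%R.
have e0 l : (0 < e l)%R by rewrite divr_gt0// ltr0n expn_gt0.
have /choice [N1 HN1] : forall l, exists N, forall i j, (N <= i)%N -> (i <= j)%N ->
    \int[m]_x `|V i x - V j x|%:E <= (e l)%:E by move=> l; exact: H1.
have /choice [N2 HN2] : forall u : nat * nat, exists N, forall n, (N <= n)%N ->
    \int[m]_x `|V n (iter u.1 S x) - V n x|%:E <= (e u.2)%:E by move=> u; exact: H2.
(* From n l on, both hypotheses hold with error 2^-(l+1), the second one for all i <= l at once. *)
pose n l := maxn l (maxn (N1 l) (\max_(i < l.+1) N2 (i : nat, l))).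
have nl l : (l <= n l)%N by rewrite leq_max leqnn.
have nN1 l : (N1 l <= n l)%N by rewrite leq_max leq_max leqnn orbT.
have nN2 l i : (i <= l)%N -> (N2 (i, l) <= n l)%N.
  move=> il; rewrite !leq_max; apply/orP; right; apply/orP; right.
  exact: (leq_bigmax (Ordinal (il : (i < l.+1)%N))).
(* Partial sums dominate n and are nondecreasing in l, as the comparison of consecutive terms
   needs. *)
pose j l := (\sum_(i < l.+1) n i)%N.
have nj l : (n l <= j l)%N by rewrite /j big_ord_recr leq_addl.
have jS l : (j l <= j l.+1)%N by rewrite [j l.+1]/j big_ord_recr leq_addr.
have mD (f g : T -> R) : measurable_fun setT f -> measurable_fun setT g ->
    measurable_fun setT (fun x : T => `|f x - g x|)%R.
  by move=> mf mg; apply: measurableT_comp => //; exact: measurable_funB.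
have ae1 : {ae m, forall x, cvgn (fun l => V (j l) x)}.
  have := @ae_summable (fun l x => `|V (j l) x - V (j l.+1) x|)%R
     (fun _ _ => normr_ge0 _) (fun l => mD _ _ (mV (j l)) (mV (j l.+1)))
     (fun l => HN1 l _ _ (leq_trans (nN1 l) (nj l)) (jS l)).
  apply: filterS => x; set u := fun l => V (j l) x => cu.
  have : cvgn (series (telescope u)).
    apply: normed_cvg; rewrite (_ : [normed series _] = series (fun l => `|u l - u l.+1|)%R)//.
    by apply/funext => k; apply: eq_bigr => i _; rewrite /telescope distrC.
  move=> ct; rewrite (_ : u = fun k => (u 0%N + series (telescope u) k)%R).
    by apply: is_cvgD => //; exact: is_cvg_cst.
  by apply/funext => k; exact: eq_sum_telescope.
have ae2 i : {ae m, forall x, (V (j l) (iter i S x) - V (j l) x)%R @[l --> \oo] --> (0%R : R)}.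
  (* Starting at index l + i guarantees that i is among the iterates controlled at that index. *)
  have le2 l : \int[m]_x `|V (j (l + i)%N) (iter i S x) - V (j (l + i)%N) x|%:E <= (e l)%:E.
    apply: le_trans (HN2 (i, (l + i)%N) _ (leq_trans (nN2 _ _ (leq_addl _ _)) (nj _))) _.
    rewrite lee_fin ler_pM2l// lef_pV2 ?posrE ?ltr0n ?expn_gt0// ler_nat leq_exp2l//.
    by rewrite leq_add2r leq_addr.
  have := @ae_summable (fun l x => `|V (j (l + i)%N) (iter i S x) - V (j (l + i)%N) x|)%R
     (fun _ _ => normr_ge0 _) (fun l => mD _ _ (mVS _ i) (mV _)) le2.
  apply: filterS => x /cvg_series_cvg_0 c0.
  rewrite -(cvg_shiftn i); apply/norm_cvg0P => /=.
  exact: c0.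
have {}ae2 : {ae m, forall x, forall i, (V (j l) (iter i S x) - V (j l) x)%R @[l --> \oo] --> (0%R : R)}.
  exact: ae_foralln.
pose Phi x := limn_esup (fun i => limn_esup (fun l => (V (j l) (iter i S x))%:E)).
have mPhi : measurable_fun setT Phi.
  apply: measurable_fun_limn_esup => i; apply: measurable_fun_limn_esup => l.
  exact/measurable_EFinP.
exists j, (fun x => clip (fine (Phi x))); split.
- by move=> l; exact: leq_trans (nj l).
- apply: measurableT_comp measurable_clip _; exact: measurableT_comp.
- by move=> x; rewrite clip_ge0 clip_le.
- move=> x; congr (clip (fine _)); rewrite /Phi -[RHS]limn_esupS.
  by congr limn_esup; apply/funext => i; rewrite iterSr.
apply: filterS2 ae1 ae2 => x /cvg_ex[v Vv] V0x.
suff -> : clip (fine (Phi x)) = v by [].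
have Phix : Phi x = v%:E.
  have in1 i : limn_esup (fun l => (V (j l) (iter i S x))%:E) = v%:E.
    apply: (cvg_limn_einf_sup _).2; apply: cvg_EFin; first by near=> l.
    rewrite (_ : fine \o _ = (fun l => V (j l) (iter i S x) - V (j l) x) + (fun l => V (j l) x))%R.
      by rewrite -[v in _ --> v]add0r; exact: cvgD (V0x i) Vv.
    by apply/funext => l; rewrite /= [RHS]subrK.
  rewrite /Phi; under eq_fun do rewrite in1.
  by apply: (cvg_limn_einf_sup _).2; exact: cvg_cst.
have vE : limn (fun l => V (j l) x) = v by exact: cvg_lim.
rewrite Phix /= clip_id// -vE.
  by apply: limr_ge; [exact: cvgP Vv|near=> l].
by apply: limr_le; [exact: cvgP Vv|near=> l].
Unshelve. all: by end_near. Qed.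

End InvariantLimit.

(** The bound vanishes at 0, which gives the continuity of v ln v there, where ln itself is not
    continuous. *)
Lemma norm_mulr_ln_le (R : realType) (v : R) : (0 <= v)%R ->
  (`|v * ln v| <= v ^+ 2 + Num.sqrt v *+ 2)%R.
Proof.
rewrite le_eqVlt => /predU1P[<-|v0].
  by rewrite mul0r normr0 addr_ge0 ?sqr_ge0// mulrn_wge0// sqrtr_ge0.
set s := Num.sqrt v; have s0 : (0 < s)%R by rewrite sqrtr_gt0.
have vs : v = (s * s)%R by rewrite -expr2 sqr_sqrtr// ltW.
rewrite ler_norml; apply/andP; split.
  have : (- ln s <= s^-1)%R.
    rewrite -lnV ?posrE// (le_trans (ln_le_sub1 _)) ?invr_gt0// gerBl.
    exact: ler01.
  rewrite -(ler_pM2l s0) mulfV ?gt_eqF// => H.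
  rewrite lerNl {1 2}vs lnM ?posrE// -mulrN opprD mulrDr -mulr2n.
  apply: (@le_trans _ _ (s *+ 2)%R); last by rewrite lerDr sqr_ge0.
  by rewrite lerMn2r/= -mulrA ger_pMr.
apply: (@le_trans _ _ (v * (v - 1))%R); first by rewrite ler_pM2l// ln_le_sub1.
rewrite expr2 mulrBr mulr1 lerD2l (@le_trans _ _ 0%R) ?oppr_le0 ?(ltW v0)//.
by rewrite mulrn_wge0// ltW.
Qed.

Lemma cvg_ent (R : realType) (u : nat -> R) (y : R) : (forall n, 0 <= u n)%R ->
  u n @[n --> \oo] --> y -> ent (u n) @[n --> \oo] --> ent y.
Proof.
move=> u0 uy; apply: cvgD; last exact: cvg_cst.
apply: cvgB => //.
have : (0 <= y)%R.
  have <- : limn u = y by exact: cvg_lim.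
  by apply: limr_ge; [exact: cvgP uy|near=> l].
rewrite le_eqVlt => /predU1P[y0|y0].
  rewrite -y0 mul0r; apply/norm_cvg0P; rewrite -y0 in uy.
  apply: (@squeeze_cvgr _ _ _ _ (fun=> 0%R) (fun n => (u n ^+ 2 + Num.sqrt (u n) *+ 2)%R)).
  - by near=> n; rewrite normr_ge0 norm_mulr_ln_le.
  - exact: cvg_cst.
  - have -> : (0 : R)%R = (0 * 0 + (Num.sqrt 0 + Num.sqrt 0))%R by rewrite sqrtr0 mul0r !addr0.
    apply: cvgD; first exact: cvgM.
    by apply: cvgD; apply: continuous_cvg uy; exact: sqrt_continuous.
by apply: cvgM => //; apply: continuous_cvg uy; exact: continuous_ln.
Unshelve. all: by end_near. Qed.

Lemma ent_le (R : realType) (v c : R) : (0 <= v)%R -> (v <= c)%R -> (ent v <= c ^+ 2 + 1)%R.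
Proof.
rewrite le_eqVlt => /predU1P[<-|v0] vc.
  by rewrite /ent mul0r subr0 add0r lerDr sqr_ge0.
rewrite lerD2r (le_trans (_ : _ <= v * (v - 1))%R)//.
  by rewrite lerBlDr (le_trans (_ : _ <= v * (v - 1))%R) ?ler_pM2l ?ln_le_sub1// lerDl ltW.
rewrite mulrBr mulr1 (le_trans (_ : _ <= v ^+ 2)%R)//; first by rewrite expr2 gerBl ltW.
by rewrite lerXn2r ?nnegrE// ?(ltW v0)// (le_trans (ltW v0)).
Qed.

Lemma measurable_ent_comp d (T : measurableType d) (R : realType) (f : T -> R) :
  measurable_fun setT f -> measurable_fun setT (fun x => (ent (f x))%:E).
Proof.
by move=> mf; apply/measurable_EFinP; exact: measurableT_comp (@measurable_ent R) mf.
Qed.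

Lemma cvg_integral_bounded d (T : measurableType d) (R : realType)
    (m : {measure set T -> \bar R}) (C K : R) (V : nat -> T -> R) (Psi : T -> R)
    (phi : R -> R) (A : set T) : m setT = 1 -> measurable A ->
  (forall n x, 0 <= V n x <= C)%R -> (forall n, measurable_fun setT (V n)) ->
  measurable_fun setT Psi ->
  {ae m, forall x, V n x @[n --> \oo] --> Psi x} ->
  (forall v, 0 <= v <= C -> `|phi v| <= K)%R -> measurable_fun setT phi ->
  (forall (u : nat -> R) y, (forall n, 0 <= u n <= C)%R -> u n @[n --> \oo] --> y ->
    phi (u n) @[n --> \oo] --> phi y) ->
  \int[m]_(x in A) (phi (V n x))%:E @[n --> \oo] --> \int[m]_(x in A) (phi (Psi x))%:E.
Proof.
move=> m1 mA VC mV mPsi cV phiK mphi cphi.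
have mc (f : T -> R) : measurable_fun setT f -> measurable_fun A (fun x => (phi (f x))%:E).
  move=> mf; apply: measurable_funTS; apply/measurable_EFinP; exact: measurableT_comp.
have [] := @dominated_convergence _ _ _ m A mA (fun n x => (phi (V n x))%:E)
  (fun x => (phi (Psi x))%:E) (cst K%:E) (fun n => mc _ (mV n)) (mc _ mPsi).
- apply: filterS cV => x Vx _; apply: cvg_EFin; first by near=> n.
  exact: cphi.
- apply/integrableP; split; first exact: measurable_cst.
  rewrite integral_cst//; apply: lte_mul_pinfty => //.
  by apply: (@le_lt_trans _ _ (m setT)); [rewrite le_measure// inE|rewrite m1 ltry].
- by apply: aeW => x n _; rewrite /= lee_fin phiK.
- by [].
Unshelve. all: by end_near. Qed.

Lemma integral_indicT d (T : measurableType d) (R : realType) (m : {measure set T -> \bar R})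
  (A : set T) : measurable A -> \int[m]_x (\1_A x)%:E = m A.
Proof. by move=> mA; rewrite integral_indic// setIT. Qed.

(** * Limit of the densities along the tail *)

Section TailLimit.
Context (R : realType) (G : groupType).
Hypothesis G_countable : countable [set: G].
Context (d : measure_display) (Omega : measurableType d) (Pr : probability Omega R).
Context (X : nat -> Omega -> G) (mu : G -> R).
Hypothesis mu_pmf : is_pmf mu.
Hypothesis X_iid : iid_with_law Pr X mu.
Variable lambda : probability (borel (SubG G)) R.
Hypothesis lambda_invariant : conj_invariant lambda.
Implicit Types (p q : G -> R) (F : borel (tSubG G) -> \bar R).

Local Notation M := (path_measure G_countable X_iid lambda).
Local Notation next p := (convolution p mu).

Local Notation divergence := (divergence G_countable X_iid lambda).
Local Notation S := (@path_shift G).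

Lemma measurable_iter_shift n :
  measurable_fun setT (iter n S : borel (tSubG G) -> borel (tSubG G)).
Proof.
elim: n => [|n IHn]; first exact: measurable_id.
exact: (measurableT_comp (measurable_path_shift G_countable) IHn).
Qed.

Lemma integral_path_iter (q : nat -> G -> R) i n F : (forall j, mass_function (q j)) ->
  (forall j, next (q j) = q j.+1) -> (forall a, 0 <= F a) -> measurable_fun setT F ->
  \int[M (q i)]_a F (iter n S a) = \int[M (q (i + n)%N)]_a F a.
Proof.
move=> mq nq; elim: n F i => [F i _ _|n IHn F i F0 mF]; first by rewrite addn0.
rewrite addnS -nq.
have E := IHn (F \o S) i (fun a => F0 (S a)) (measurableT_comp mF (measurable_path_shift G_countable)).
apply: etrans E _; exact: (integral_path_shift G_countable mu_pmf X_iid lambda (mq _) F0 mF).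
Qed.

Lemma integral_cmass_div_le p q : mass_function p -> mass_function q ->
  \int[M q]_a (cmass p a / cmass q a)%:E <= \esum_(x in [set: G]) (p x)%:E.
Proof.
move=> mp mq; rewrite -(path_measure_total G_countable X_iid lambda mp) -[leRHS]mul1e -(integral_cst (M p) measurableT).
have := le_integral_cmass_ratio G_countable X_iid lambda mp mq
  (fun _ => lee01) (measurable_cst (1 : \bar R)); apply: le_trans.
by rewrite le_eqVlt; apply/orP; left; apply/eqP; apply: eq_integral => a _; rewrite mule1.
Qed.

Lemma cmass_ratio_ge0 p q a : mass_function p -> mass_function q ->
  0 <= (cmass p a / cmass q a)%:E.
Proof. by move=> mp mq; rewrite lee_fin divr_ge0// mass_ge0. Qed.

Lemma measurable_cmass_ratioE p q : mass_function p -> mass_function q ->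
  measurable_fun setT (fun a => (cmass p a / cmass q a)%:E).
Proof. by move=> mp mq; apply/measurable_EFinP; exact: measurable_cmass_ratio. Qed.

Lemma integral_cmass_div_linear_le p p' q (c : R) : (0 <= c)%R ->
  mass_function p -> mass_function p' -> mass_function q ->
  \int[M q]_a ((cmass p a / cmass q a)%:E + c%:E * (cmass p' a / cmass q a)%:E) <=
  \esum_(x in [set: G]) (p x)%:E + c%:E * \esum_(x in [set: G]) (p' x)%:E.
Proof.
move=> c0 mp mp' mq.
have m1 := measurable_cmass_ratioE mp mq; have m2 := measurable_cmass_ratioE mp' mq.
have p1 a := cmass_ratio_ge0 a mp mq; have p2 a := cmass_ratio_ge0 a mp' mq.
have cE : 0 <= c%:E by rewrite lee_fin.
have p3 a : 0 <= c%:E * (cmass p' a / cmass q a)%:E by exact: mule_ge0.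
have m3 : measurable_fun setT (fun a => c%:E * (cmass p' a / cmass q a)%:E).
  exact: measurable_funeM.
rewrite (ge0_integralD (M q) measurableT (fun a _ => p1 a) m1 (fun a _ => p3 a) m3).
rewrite (ge0_integralZl (M q) measurableT m2 (fun a _ => p2 a) cE).
by apply: leeD; [|apply: lee_wpmul2l => //]; exact: integral_cmass_div_le.
Qed.

Variables (g : G) (b : nat -> G -> R).
Hypothesis mug : (0 < mu g)%R.
Hypothesis b_pmf : forall n, is_pmf (b n).
Hypothesis b_next : forall n, next (b n) = b n.+1.
Hypothesis b_comm : forall n, convolution mu (b n) = next (b n).
Hypothesis b_asymp : forall m (eps : R), (0 < eps)%R -> exists N, forall n, (N <= n)%N ->
  l1dist (b n) (b (n + m)%N) <= eps%:E.

Local Notation C := ((mu g)^-1)%R.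
Local Notation gb n := (left_translate g (b n)).

Definition tail_ratio n (a : borel (tSubG G)) : R := (cmass (gb n) a / cmass (b n.+1) a)%R.

Let mb n : mass_function (b n). Proof. exact: pmf_mass. Qed.
Let mgb n : mass_function (gb n). Proof. exact: left_translate_mass. Qed.
Let C0 : (0 <= C)%R. Proof. by rewrite invr_ge0 ltW. Qed.

(** The origin of the constant C = 1 / mu g, uniform in n. *)
Lemma tail_dominated n x : (gb n x <= C * b n.+1 x)%R.
Proof. by rewrite -b_next -b_comm; exact: (left_translate_dominated mu_pmf (mb n) mug). Qed.

Lemma left_translate_next n : next (gb n) = gb n.+1.
Proof. by rewrite -b_next; apply: left_translate_convolution => //; exact: pmf_mass. Qed.

Lemma tail_ratio_bounds n a : (0 <= tail_ratio n a <= C)%R.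
Proof.
apply/andP; split; first by rewrite divr_ge0// mass_ge0.
have := mass_ge0 ((val a).2 0%N) (mb n.+1); rewrite le_eqVlt => /predU1P[E|q0].
  by rewrite /tail_ratio [cmass (b n.+1) a](esym E) invr0 mulr0.
by rewrite ler_pdivrMr//; exact: (le_mass _ (mgb n) (mb n.+1) C0 (tail_dominated n)).
Qed.

Lemma measurable_tail_ratio n : measurable_fun setT (tail_ratio n).
Proof. exact: measurable_cmass_ratio. Qed.

(** The V_n of the overview: the density of M (gb 0) with respect to M (b 1) on the sets that depend
    on the path only through its n-th shift. *)
Definition tail_density n (a : borel (tSubG G)) : R := tail_ratio n (iter n S a).

Lemma measurable_tail_density n : measurable_fun setT (tail_density n).
Proof. exact: measurableT_comp (measurable_tail_ratio n) (measurable_iter_shift n). Qed.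

Lemma integral_tail_ratio n F : (forall a, 0 <= F a) -> measurable_fun setT F ->
  \int[M (b n.+1)]_a ((tail_ratio n a)%:E * F a) = \int[M (gb n)]_a F a.
Proof.
move=> F0 mF.
exact: (integral_cmass_ratio_eq G_countable X_iid lambda (mgb n) (mb n.+1) C0 (tail_dominated n) F0 mF).
Qed.

Lemma integral_tail i n F : (forall a, 0 <= F a) -> measurable_fun setT F ->
  \int[M (b i)]_a F (iter n S a) = \int[M (b (i + n)%N)]_a F a.
Proof. move=> F0 mF; refine (integral_path_iter i n mb b_next F0 mF). Qed.

Lemma integral_tail_translate i n F : (forall a, 0 <= F a) -> measurable_fun setT F ->
  \int[M (gb i)]_a F (iter n S a) = \int[M (gb (i + n)%N)]_a F a.
Proof. move=> F0 mF; refine (integral_path_iter i n mgb left_translate_next F0 mF). Qed.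

Lemma integral_tail_density n F : (forall a, 0 <= F a) -> measurable_fun setT F ->
  \int[M (b 1%N)]_a ((tail_density n a)%:E * F (iter n S a)) = \int[M (gb n)]_a F a.
Proof.
move=> F0 mF; apply: etrans (integral_tail_ratio n F0 mF).
have t0 a : 0 <= (tail_ratio n a)%:E * F a.
  by rewrite mule_ge0// lee_fin; case/andP: (tail_ratio_bounds n a).
have mt : measurable_fun setT (fun a => (tail_ratio n a)%:E * F a).
  by apply: emeasurable_funM => //; apply/measurable_EFinP; exact: measurable_tail_ratio.
exact: (integral_tail 1%N n t0 mt).
Qed.

(** For i <= j the function V_j depends on the path through its i-th shift, so integrating V_i * V_j
    against M (b 1) is integrating [tail_ratio j] against M (gb j), whatever i is. *)
Lemma tail_density_orthogonal i j : (i <= j)%N ->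
  \int[M (b 1%N)]_a (tail_density i a * tail_density j a)%:E =
  \int[M (b 1%N)]_a (tail_density j a * tail_density j a)%:E.
Proof.
move=> ij; pose F k (a : borel (tSubG G)) := (tail_ratio j (iter k S a))%:E.
have F0 k a : 0 <= F k a by rewrite lee_fin; case/andP: (tail_ratio_bounds j (iter k S a)).
have mF k : measurable_fun setT (F k).
  apply/measurable_EFinP.
  exact: measurableT_comp (measurable_tail_ratio j) (measurable_iter_shift k).
transitivity (\int[M (b 1%N)]_a ((tail_density i a)%:E * F (j - i)%N (iter i S a))).
  by apply: eq_integral => a _; rewrite EFinM /F -iterD subnK.
apply: etrans (integral_tail_density i (F0 _) (mF _)) _.
transitivity (\int[M (b 1%N)]_a ((tail_density j a)%:E * F 0%N (iter j S a))); last first.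
  by apply: eq_integral => a _; rewrite EFinM.
apply: etrans (esym (integral_tail_density j (F0 _) (mF _))).
by have := integral_tail_translate i (j - i)%N (F0 0%N) (mF 0%N); rewrite subnKC.
Qed.

Lemma tail_ratio_dist_le n k a : (0 < cmass (b k.+1) a)%R ->
  (`|tail_ratio n a - tail_ratio k a| <=
   mass (fun x => `|gb n x - gb k x|) ((val a).2 0%N) / cmass (b k.+1) a +
   C * (mass (fun x => `|b n.+1 x - b k.+1 x|) ((val a).2 0%N) / cmass (b k.+1) a))%R.
Proof.
move=> q0; have /andP[r0 rC] := tail_ratio_bounds n a.
(* For quotients A/B the difference is (A_n - A_k)/B_k - (A_n/B_n) (B_n - B_k)/B_k. The denominators
   are those of index k.+1 only, and integrate well against M (b k.+1). *)
have -> : (tail_ratio n a - tail_ratio k a =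
    (cmass (gb n) a - cmass (gb k) a) / cmass (b k.+1) a -
    tail_ratio n a * ((cmass (b n.+1) a - cmass (b k.+1) a) / cmass (b k.+1) a))%R.
  have E : (cmass (gb n) a = tail_ratio n a * cmass (b n.+1) a)%R.
    have := mass_ge0 ((val a).2 0%N) (mb n.+1); rewrite le_eqVlt => /predU1P[E|q'0].
      apply/eqP; rewrite eq_le [X in (_ * X)%R](esym E) mulr0 mass_ge0// andbT.
      have := le_mass ((val a).2 0%N) (mgb n) (mb n.+1) C0 (tail_dominated n).
      by rewrite -[X in (C * X)%R]E mulr0.
    by rewrite /tail_ratio divfK// gt_eqF.
  rewrite {1}E /tail_ratio -/(tail_ratio n a).
  move: (tail_ratio n a) (cmass (b n.+1) a) (cmass (gb k) a) (cmass (b k.+1) a) q0 => u v w z z0.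
  rewrite !mulrBl divff ?gt_eqF// mulrBr mulr1 opprB mulrA addrAC.
  by rewrite [X in _ = (X - _)%R]addrC subrK.
apply: le_trans (ler_normB _ _) _; apply: lerD.
  rewrite normrM [X in (_ * X <= _)%R]ger0_norm ?invr_ge0 ?(ltW q0)//.
  by rewrite ler_wpM2r ?invr_ge0 ?(ltW q0)// mass_dist_le.
rewrite normrM (ger0_norm r0); apply: ler_pM => //.
rewrite normrM [X in (_ * X <= _)%R]ger0_norm ?invr_ge0 ?(ltW q0)//.
by rewrite ler_wpM2r ?invr_ge0 ?(ltW q0)// mass_dist_le.
Qed.

Lemma l1dist_left_translate p q : l1dist (left_translate g p) (left_translate g q) = l1dist p q.
Proof.
have := wsum_translate g (fun x => `|p x - q x|)%R (fun=> 1 : \bar R).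
rewrite /wsum; under eq_esum do rewrite mule1.
by under [X in _ = X]eq_esum do rewrite mule1.
Qed.

(** Both terms are functions of the shift by n + m, namely the ratios of indices n and n + m there.
    Under M (b (n + m).+1) the quotients of coset masses integrate to at most the l1 distances. *)
Lemma tail_density_shift_le m n :
  \int[M (b 1%N)]_a `|tail_density n (iter m S a) - tail_density (n + m)%N a|%:E <=
  l1dist (b n) (b (n + m)%N) + C%:E * l1dist (b n.+1) (b (n + m).+1).
Proof.
pose F (a : borel (tSubG G)) := `|tail_ratio n a - tail_ratio (n + m)%N a|%:E.
have F0 a : 0 <= F a by rewrite lee_fin.
have mF : measurable_fun setT F.
  apply/measurable_EFinP; apply: measurableT_comp => //.
  by apply: measurable_funB; exact: measurable_tail_ratio.
have := integral_tail 1%N (n + m)%N F0 mF; rewrite add1n => E.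
apply: (@le_trans _ _ (\int[M (b (n + m).+1)]_a F a)).
  rewrite -E le_eqVlt; apply/orP; left; apply/eqP; apply: eq_integral => a _.
  by rewrite /F /tail_density iterD.
pose dg x := `|gb n x - gb (n + m)%N x|%R; pose db x := `|b n.+1 x - b (n + m).+1 x|%R.
have mdg : mass_function dg by exact: mass_function_dist.
have mdb : mass_function db by exact: mass_function_dist.
have mq := mb (n + m).+1.
rewrite -(l1dist_left_translate (b n)).
apply: le_trans (integral_cmass_div_linear_le C0 mdg mdb mq).
have m1 := measurable_cmass_ratioE mdg mq; have m2 := measurable_cmass_ratioE mdb mq.
have CE : 0 <= C%:E by rewrite lee_fin.
apply: ae_ge0_le_integral.
- exact: measurableT.
- by move=> a _; exact: F0.
- exact: mF.
- move=> a _; apply: adde_ge0; first exact: (cmass_ratio_ge0 a mdg mq).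
  by apply: mule_ge0; [exact: CE|exact: (cmass_ratio_ge0 a mdb mq)].
- by apply: emeasurable_funD; [exact: m1|apply: measurable_funeM; exact: m2].
- apply: filterS (cmass_gt0_ae G_countable X_iid lambda mq) => a qa _.
  rewrite -EFinM -EFinD lee_fin; exact: (tail_ratio_dist_le n qa).
Qed.

Lemma integral_tail_density_invariant n (I : set (borel (tSubG G))) : measurable I ->
  S @^-1` I = I -> \int[M (b 1%N)]_(a in I) (tail_density n a)%:E = M (gb 0%N) I.
Proof.
move=> mI SI; have SnI k : iter k S @^-1` I = I.
  by elim: k => [//|k IHk]; rewrite -[RHS]IHk -[X in _ = _ @^-1` X]SI.
have gbI : M (gb n) I = M (gb 0%N) I.
  elim: n => [//|n <-]; rewrite -left_translate_next -[in RHS]SI.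
  by rewrite (path_measure_shift G_countable mu_pmf X_iid lambda (mgb n) mI).
have i0 (a : borel (tSubG G)) : 0 <= (\1_I a)%:E :> \bar R by rewrite lee_fin.
have mi : measurable_fun setT (fun a : borel (tSubG G) => (\1_I a)%:E : \bar R).
  by apply/measurable_EFinP; exact: measurable_indic.
rewrite integral_mkcond.
apply: etrans (etrans (integral_tail_density n i0 mi) (etrans (integral_indicT (M (gb n)) mI) gbI)).
apply: eq_integral => a _; rewrite patchE indicE.
have -> : (iter n S a \in I) = (a \in I) by rewrite -[in RHS](SnI n); apply/idP/idP; rewrite !inE.
by case: ifP => _; rewrite ?mule1 ?mule0.
Qed.

(** Psi is the density of M (gb 0) with respect to M (b 1) on invariant sets. Since the densities
    stay in [0, C], their [ent] integrals, which are the divergences, converge along the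
    subsequence, and by monotonicity to the infimum. *)
Lemma exists_tail_limit :
  {homo (fun n => divergence (gb n) (b n.+1)) : i j / (i <= j)%N >-> j <= i} ->
  exists Psi : borel (tSubG G) -> R,
  [/\ measurable_fun setT Psi, forall a, (0 <= Psi a <= C)%R,
      forall a, Psi (S a) = Psi a,
      \int[M (b 1%N)]_a (ent (Psi a))%:E =
        ereal_inf (range (fun n => divergence (gb n) (b n.+1))) &
      forall I : set (borel (tSubG G)), measurable I -> S @^-1` I = I ->
        \int[M (b 1%N)]_(a in I) (Psi a)%:E = M (gb 0%N) I].
Proof.
move=> D_ni; have m1 := path_measure_setT G_countable X_iid lambda (b_pmf 1%N).
have V0 n a : (0 <= tail_density n a)%R by case/andP: (tail_ratio_bounds n (iter n S a)).
have VC n a : (tail_density n a <= C)%R by case/andP: (tail_ratio_bounds n (iter n S a)).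
have V0C n a : (0 <= tail_density n a <= C)%R by rewrite V0 VC.
have mV := measurable_tail_density.
have H1 := reverse_martingale_cauchy m1 V0 VC mV tail_density_orthogonal.
have mVS n i : measurable_fun setT (fun a : borel (tSubG G) => tail_density n (iter i S a)).
  exact: measurableT_comp (mV n) (measurable_iter_shift i).
have H2 i (eps : R) : (0 < eps)%R -> exists N, forall n, (N <= n)%N ->
    \int[M (b 1%N)]_a `|tail_density n (iter i S a) - tail_density n a|%:E <= eps%:E.
  move=> eps0; have e2 : (0 < eps / 2)%R by rewrite divr_gt0.
  have e3 : (0 < eps / 2 / 2)%R by rewrite divr_gt0.
  (* The factor mu g compensates the constant C in front of the second distance of
     [tail_density_shift_le]. *)
  have e3' : (0 < mu g * (eps / 2 / 2))%R by rewrite mulr_gt0.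
  have [N1 HN1] := H1 _ e2; have [N2 HN2] := b_asymp i e3.
  have [N3 HN3] := b_asymp i e3'.
  exists (N1 + N2 + N3)%N => n Nn.
  apply: (@le_trans _ _ (\int[M (b 1%N)]_a
      (`|tail_density n (iter i S a) - tail_density (n + i)%N a|%:E +
       `|tail_density n a - tail_density (n + i)%N a|%:E))).
    apply: ge0_le_integral => //.
    - by apply/measurable_EFinP; apply: measurableT_comp => //; exact: measurable_funB.
    - by apply: emeasurable_funD; apply/measurable_EFinP; apply: measurableT_comp => //; exact: measurable_funB.
    - by move=> a _; rewrite -EFinD lee_fin [X in (_ <= _ + X)%R]distrC ler_distD.
  rewrite ge0_integralD//; last 2 first.
  - by apply/measurable_EFinP; apply: measurableT_comp => //; exact: measurable_funB.
  - by apply/measurable_EFinP; apply: measurableT_comp => //; exact: measurable_funB.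
  have -> : eps = (eps / 2 / 2 + C * (mu g * (eps / 2 / 2)) + eps / 2)%R.
    by rewrite mulKf ?gt_eqF// -!splitr.
  rewrite !EFinD [(C * _)%:E]EFinM; apply: leeD; last by apply: HN1; lia.
  apply: le_trans (tail_density_shift_le i n) _; apply: leeD; first by apply: HN2; lia.
  by apply: lee_wpmul2l; rewrite ?lee_fin//; rewrite -addSn; apply: HN3; lia.
have [j [Psi [jl mPsi PsiC PsiS cPsi]]] := exists_invariant_limit C0 V0 VC mV
  (measurable_path_shift G_countable) H1 H2.
have Vj0C l a : (0 <= tail_density (j l) a <= C)%R by exact: V0C.
have jy : j l @[l --> \oo] --> \oo.
  by apply/cvgnyPge => N; near=> l; apply: leq_trans (jl l); near: l; exact: nbhs_infty_ge.
exists Psi; split => //.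
  have := cvg_integral_bounded m1 measurableT Vj0C (fun l => mV (j l)) mPsi cPsi
    (K := (C ^+ 2 + 1)%R) (phi := @ent R) _ (@measurable_ent R) _.
  move=> /(_ _ _)/cvg_lim <- //; last 2 first.
  - by move=> v /andP[v0 vC]; rewrite ger0_norm ?ent_ge0// ent_le.
  - by move=> u y u0 uy; apply: cvg_ent => // n; case/andP: (u0 n).
  have E l : \int[M (b 1%N)]_a (ent (tail_density (j l) a))%:E =
      divergence (gb (j l)) (b (j l).+1).
    have e0 a : 0 <= (ent (tail_ratio (j l) a))%:E.
      by rewrite lee_fin ent_ge0//; case/andP: (tail_ratio_bounds (j l) a).
    exact: (integral_tail 1%N (j l) e0 (measurable_ent_comp (measurable_tail_ratio (j l)))).
  apply: etrans (congr1 (fun u : nat -> \bar R => limn u) (funext E)) _.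
  apply: cvg_lim; first exact: ereal_hausdorff.
  exact: (cvg_comp _ _ jy (ereal_nonincreasing_cvgn D_ni)).
move=> I mI SI.
have := cvg_integral_bounded m1 mI Vj0C (fun l => mV (j l)) mPsi cPsi
    (K := C) (phi := id) _ _ _.
move=> /(_ _ _ _)/cvg_lim <- //; last by move=> v /andP[v0 vC]; rewrite ger0_norm.
apply: etrans (congr1 (fun u : nat -> \bar R => limn u) (funext (fun l => integral_tail_density_invariant (j l) mI SI))) _.
by apply: cvg_lim; [exact: ereal_hausdorff|exact: cvg_cst].
Unshelve. all: by end_near. Qed.

End TailLimit.

(** * The Poisson boundary *)

Lemma measurable_lne (R : realType) : measurable_fun setT (@lne R).
Proof.
have -> : @lne R = fun x => if x <= 0 then -oo else if x == +oo then +oo else (ln (fine x))%:E.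
  apply/funext => x; have [x0|] := leP x 0; first exact: le0_lneNy.
  by case: x => [r||]//; rewrite lte_fin => r0; rewrite lne_EFin.
apply: measurable_fun_ifT => //; first exact: measurable_fun_lee.
apply: measurable_fun_ifT => //.
  exact: measurable_fun_eqe.
apply/measurable_EFinP; apply: measurableT_comp => //; exact: measurable_fine.
Qed.

(** * Entropy of a nonsingular transformation with bounded density *)

Section Density.
Context d (B : measurableType d) (R : realType) (nu : probability B R).
Local Open Scope charge_scope.

Lemma density_dominates (eta : probability B R) (f : B -> R) : measurable_fun setT f ->
  (forall A, measurable A -> eta A = \int[nu]_(x in A) (f x)%:E) -> eta `<< nu.
Proof.
move=> mf H; apply/null_content_dominatesP => A mA nuA.
rewrite H// null_set_integral//; apply: measurable_funTS; exact/measurable_EFinP.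
Qed.

Lemma integral_density (eta : probability B R) (f : B -> R) (F : B -> \bar R) :
  measurable_fun setT f -> (forall x, 0 <= f x)%R ->
  (forall A, measurable A -> eta A = \int[nu]_(x in A) (f x)%:E) ->
  (forall x, 0 <= F x) -> measurable_fun setT F ->
  \int[eta]_x F x = \int[nu]_x (F x * (f x)%:E).
Proof.
move=> mf f0 H F0 mF; have dom := density_dominates mf H.
have mfE : measurable_fun setT (EFin \o f) by exact/measurable_EFinP.
rewrite -(Radon_Nikodym_SigmaFinite.change_of_variables dom F0 measurableT mF).
set r := Radon_Nikodym_SigmaFinite.f _ _.
have ir : nu.-integrable setT r by exact: Radon_Nikodym_SigmaFinite.f_integrable.
have mr := measurable_int _ ir.
apply: ge0_ae_eq_integral => //.
- exact: emeasurable_funM.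
- exact: emeasurable_funM.
- by move=> x _; rewrite mule_ge0//; exact: Radon_Nikodym_SigmaFinite.f_ge0.
- by move=> x _; rewrite mule_ge0// lee_fin.
have : ae_eq nu setT r (EFin \o f).
  apply: integral_ae_eq => // A _ mA.
  by rewrite -[RHS]H//; apply/esym; exact: Radon_Nikodym_SigmaFinite.f_integral.
by apply: filterS => x /(_ I) E _; rewrite E.
Qed.

Variables (T Ti : {mfun B >-> B}) (f : B -> R) (C : R).
Hypothesis TK : cancel T Ti.
Hypothesis T_nonsingular : forall A : set B, measurable A ->
  nu (T @^-1` A) = 0 <-> nu A = 0.
Hypothesis mf : measurable_fun setT f.
Hypothesis f0C : forall x, (0 <= f x <= C)%R.
Hypothesis T_law : forall A : set B, measurable A -> nu (T @^-1` A) = \int[nu]_(x in A) (f x)%:E.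

Let f0 x : (0 <= f x)%R. Proof. by case/andP: (f0C x). Qed.

Let mT : measurable_fun setT T. Proof. exact: measurable_funPT. Qed.

Let mTi : measurable_fun setT Ti. Proof. exact: measurable_funPT. Qed.

Lemma integral_comp_density (F : B -> \bar R) : (forall x, 0 <= F x) -> measurable_fun setT F ->
  \int[nu]_x F (T x) = \int[nu]_x (F x * (f x)%:E).
Proof.
move=> F0 mF; rewrite -(@integral_density (distribution nu T))//.
by rewrite ge0_integral_pushforward// preimage_setT.
Qed.

(** The preimage under T of the zero set of f has mass equal to the integral of f over that set,
    which is 0; nonsingularity transfers this to the set itself. *)
Lemma density_gt0_ae : {ae nu, forall x, (0 < f x)%R}.
Proof.
have mZ : measurable [set x | f x = 0%R].
  by have := mf measurableT (measurable_set1 0%R); rewrite setTI; congr measurable; apply/seteqP.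
exists [set x | f x = 0%R]; split => //; last first.
  by move=> x /= /negP; rewrite lt0r f0 andbT negbK => /eqP.
apply/T_nonsingular => //; rewrite T_law//; apply: integral0_eq => x /= ->.
by [].
Qed.

Lemma density_comp_gt0_ae : {ae nu, forall x, (0 < f (T x))%R}.
Proof.
have [N [mN N0 NP]] := density_gt0_ae; exists (T @^-1` N); split.
- by rewrite -[X in measurable X]setTI; exact: mT.
- exact/T_nonsingular.
- by move=> x /= fx; exact: NP.
Qed.

Lemma measurable_comp_invf : measurable_fun setT (fun x => ((f (T x))^-1)%:E).
Proof.
apply/measurable_EFinP; apply: measurableT_comp (@measurable_inv R) _.
exact: measurableT_comp mf mT.
Qed.

(** With f the density of the image of nu under T, the image under the inverse has density 1 / f(T
    x): the change of variables brings back a factor f that cancels it where f > 0. *)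
Lemma inverse_lawE (A : set B) : measurable A ->
  distribution nu Ti A = \int[nu]_(x in A) ((f (T x))^-1)%:E.
Proof.
move=> mA; pose F y := ((\1_(Ti @^-1` A) y) * (f y)^-1)%:E : \bar R.
have mTA : measurable (Ti @^-1` A) by rewrite -[X in measurable X]setTI; exact: mTi.
have F0 y : 0 <= F y by rewrite lee_fin mulr_ge0// invr_ge0.
have mF : measurable_fun setT F.
  apply/measurable_EFinP; apply: measurable_funM; first exact: measurable_indic.
  exact: measurableT_comp (@measurable_inv R) mf.
rewrite integral_mkcond; transitivity (\int[nu]_x F (T x)); last first.
  apply: eq_integral => x _; rewrite /F patchE indicE.
  have -> : (T x \in Ti @^-1` A) = (x \in A) by apply/idP/idP; rewrite !inE /= TK.
  by case: ifP => _; rewrite ?mul1r ?mul0r.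
rewrite integral_comp_density//.
transitivity (\int[nu]_x (\1_(Ti @^-1` A) x)%:E); first by rewrite integral_indic// setIT.
apply: ge0_ae_eq_integral => //.
- by apply/measurable_EFinP; exact: measurable_indic.
- by apply: emeasurable_funM => //; exact/measurable_EFinP.
- by move=> y _; rewrite mule_ge0// lee_fin.
- apply: filterS density_gt0_ae => y fy _.
  by rewrite /F -EFinM -mulrA mulVf ?mulr1// gt_eqF.
Qed.

Lemma integral_comp_density_signed (phi : B -> R) : measurable_fun setT phi ->
  \int[nu]_x (phi (T x))%:E = \int[nu]_x (phi x * f x)%:E.
Proof.
move=> mphi; have mphiE : measurable_fun setT (EFin \o phi) by exact/measurable_EFinP.
rewrite integralE [RHS]integralE; congr (_ - _).
  rewrite -[RHS](_ : \int[nu]_x ((EFin \o phi)^\+ x * (f x)%:E) = _).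
    rewrite -(integral_comp_density (F := (EFin \o phi)^\+))//; last exact: measurable_funepos.
    by apply: eq_integral => x _; rewrite !funeposE.
  by apply: eq_integral => x _; rewrite !funeposE /= -!EFin_max -EFinM maxr_pMl// mul0r.
rewrite -[RHS](_ : \int[nu]_x ((EFin \o phi)^\- x * (f x)%:E) = _).
  rewrite -(integral_comp_density (F := (EFin \o phi)^\-))//; last exact: measurable_funeneg.
  by apply: eq_integral => x _; rewrite !funenegE.
by apply: eq_integral => x _; rewrite !funenegE /= -!EFin_max -EFinM maxr_pMl// mul0r mulNr.
Qed.

Lemma integral_density1 : \int[nu]_x (f x)%:E = 1.
Proof. by rewrite -T_law// preimage_setT probability_setT. Qed.

Lemma integrable_bounded (phi : B -> R) (K : R) : measurable_fun setT phi ->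
  (forall x, `|phi x| <= K)%R -> nu.-integrable setT (EFin \o phi).
Proof.
move=> mphi phiK; apply: (le_integrable measurableT _ (g := cst K%:E)).
- exact/measurable_EFinP.
- by move=> x _; rewrite /= lee_fin (le_trans (phiK x))// ler_norm.
- exact: finite_measure_integrable_cst.
Qed.

Lemma integral_mulr_ln_density : \int[nu]_x (ln (f x) * f x)%:E = \int[nu]_x (ent (f x))%:E.
Proof.
have C0 : (0 <= C)%R by case/andP: (f0C point) => /le_trans h /h.
have i1 : nu.-integrable setT (EFin \o (fun x => ent (f x))).
  apply: (@integrable_bounded _ (C ^+ 2 + 1)%R).
    exact: measurableT_comp (@measurable_ent R) mf.
  by move=> x; case/andP: (f0C x) => fx fC; rewrite ger0_norm ?ent_ge0// ent_le.
have i2 : nu.-integrable setT (EFin \o f).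
  by apply: (@integrable_bounded _ C) => // x; case/andP: (f0C x) => fx fC; rewrite ger0_norm.
have i3 : nu.-integrable setT (EFin \o cst (1 : R)%R).
  by apply: (@integrable_bounded _ 1%R) => // x; rewrite normr1.
transitivity (\int[nu]_x ((ent (f x))%:E + ((f x)%:E - 1))).
  by apply: eq_integral => x _; rewrite -EFinB -EFinD /ent mulrC -[X in (X + _)%R]addrA [(- _ + 1)%R]addrC -[(f x - 1)%R]opprB addrK.
rewrite integralD//; last exact: integrableB.
rewrite (integralB measurableT i2 i3) integral_density1.
have -> : \int[nu]_x (EFin \o cst (1 : R)%R) x = 1.
  by rewrite (integral_cst nu measurableT 1) [X in _ * X](@probability_setT _ _ _ nu) mule1.
by rewrite subee// adde0.
Qed.

(** Almost everywhere -ln of the derivative at x is ln f(T x). Its integral becomes that of f ln f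
    by change of variables, and the terms - f + 1 of [ent] cancel because f integrates to 1. *)
Lemma furstenberg_density :
  \int[nu]_x (- lne ('d (charge_of_finite_measure (distribution nu Ti)) '/d nu x)) =
  \int[nu]_x (ent (f x))%:E.
Proof.
set r := 'd _ '/d _.
have dom : distribution nu Ti `<< nu.
  by apply: (density_dominates (f := fun x => (f (T x))^-1)%R) => [|A mA]; [exact/measurable_EFinP/measurable_comp_invf|exact: inverse_lawE].
have ir : nu.-integrable setT r by exact: Radon_Nikodym_integrable.
have mr := measurable_int _ ir.
have rE : ae_eq nu setT r (fun x => ((f (T x))^-1)%:E).
  apply: integral_ae_eq => //; first exact: measurable_comp_invf.
  by move=> A _ mA; rewrite -Radon_Nikodym_integral// -inverse_lawE.
have mlnf : measurable_fun setT (fun x => ln (f x)) by exact: measurableT_comp (@measurable_ln R) mf.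
rewrite -integral_mulr_ln_density -(integral_comp_density_signed mlnf).
apply: ae_eq_integral => //.
- by apply: measurableT_comp => //; apply: measurableT_comp (@measurable_lne R) mr.
- by apply/measurable_EFinP; exact: measurableT_comp mlnf mT.
- apply: filterS2 rE density_comp_gt0_ae => x /(_ I) rx fTx _.
  by rewrite rx lneV// oppeK lne_EFin.
Qed.

End Density.

(* A function whose rational level sets come from [B] factors through [B]: take the supremum of the levels. *)
Lemma exists_factor d d' (T : measurableType d) (B : measurableType d') (R : realType)
    (m : {measure set T -> \bar R}) (pi : T -> B) (Psi : T -> R) (C : R) : (0 <= C)%R ->
  (forall a, 0 <= Psi a <= C)%R ->
  (forall q : rat, exists A : set B, measurable A /\
    {ae m, forall a, A (pi a) <-> (ratr q < Psi a)%R}) ->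
  exists f : B -> R, [/\ measurable_fun setT f, forall x, (0 <= f x <= C)%R &
    {ae m, forall a, f (pi a) = Psi a}].
Proof.
move=> C0 PsiC level; pose r n : rat := odflt 0%R (unpickle n).
have /choice [A HA] : forall n, exists A : set B, measurable A /\
    {ae m, forall a, A (pi a) <-> (ratr (r n) < Psi a)%R} by move=> n; exact: level.
pose h n x : \bar R := if x \in A n then (ratr (r n))%:E else -oo.
have mh n : measurable_fun setT (h n).
  apply: measurable_fun_ifT => //; apply: (measurable_fun_bool true).
  rewrite setTI (_ : _ @^-1` _ = A n); first exact: (HA n).1.
  by apply/seteqP; split=> x /= H; [exact: set_mem H|exact: mem_set H].
exists (fun x => clip C (fine (esups (h ^~ x) 0%N))); split.
- apply: measurableT_comp; first exact: measurable_clip.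
  apply: measurableT_comp => //; exact: (measurable_fun_esups mh 0%N).
- by move=> x; rewrite clip_ge0 clip_le.
have : {ae m, forall a, forall n, A n (pi a) <-> (ratr (r n) < Psi a)%R}.
  by apply: ae_foralln => n; exact: (HA n).2.
apply: filterS => a Aa.
suff -> : esups (h ^~ (pi a)) 0%N = (Psi a)%:E by case/andP: (PsiC a) => *; rewrite /= clip_id.
apply/eqP; rewrite eq_le; apply/andP; split.
  apply: ge_ereal_sup => _ [n _ <-]; rewrite /h; case: ifP => [|_]; last exact: leNye.
  by rewrite inE => /Aa; rewrite lee_fin => /ltW.
apply/lee_subgt0Pr => e e0.
have /rat_in_itvoo [q] : (Psi a - e < Psi a)%R by rewrite gtrBl.
rewrite in_itv => /andP[eq qPsi].
have [n rn] : exists n, r n = q by exists (pickle q); rewrite /r pickleK.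
apply: le_trans (_ : (ratr q)%:E <= _); first by rewrite lee_fin ltW.
apply: ereal_sup_ubound; exists n => //; rewrite /h rn.
by case: ifPn => //; rewrite notin_setE; case; apply/Aa; rewrite rn.
Qed.

(** * Transfer from invariant sets to the boundary *)

Section BoundaryEntropy.
Context (R : realType) (G : groupType).
Hypothesis G_countable : countable [set: G].
Context (d : measure_display) (Omega : measurableType d) (Pr : probability Omega R).
Context (X : nat -> Omega -> G) (mu : G -> R).
Hypothesis mu_pmf : is_pmf mu.
Hypothesis X_iid : iid_with_law Pr X mu.
Variable lambda : probability (borel (SubG G)) R.
Hypothesis lambda_invariant : conj_invariant lambda.
Implicit Types (p q : G -> R) (F : borel (tSubG G) -> \bar R).

Local Notation M := (path_measure G_countable X_iid lambda).
Local Notation next p := (convolution p mu).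

Local Notation path_law := (path_law G_countable X_iid lambda).
Local Notation divergence := (divergence G_countable X_iid lambda).
Local Notation S := (@path_shift G).

Lemma P_intE (E : set (borel (tSubG G))) : measurable E ->
  P_int Pr X lambda E = path_law 1%g E.
Proof.
move=> mE; rewrite path_lawE//; apply: eq_integral => K _.
congr (Pr _); apply/seteqP; split=> w /=; rewrite /path_from /=;
  by congr (E (coset_path _ _)); apply/funext => n; rewrite mul1g.
Qed.

Lemma measurable_act_preimage g (E : set (borel (tSubG G))) : measurable E ->
  measurable (act_tSubG g @^-1` E : set (borel (tSubG G))).
Proof.
by move=> mE; rewrite -[X in measurable X]setTI; exact: measurable_act_tSubG.
Qed.

Lemma path_law1_act g (E : set (borel (tSubG G))) : measurable E ->
  path_law 1%g (act_tSubG g @^-1` E) = path_law g E.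
Proof. by move=> mE; rewrite (path_law_act _ _ lambda_invariant g 1%g mE) mulg1. Qed.

(** Nullity for all translates of the law started at 1 is nullity for every starting point x, hence
    for every M p. *)
Lemma null_path_setP x (E : set (borel (tSubG G))) : measurable E ->
  null_path_set (P_int Pr X lambda) E -> path_law x E = 0.
Proof.
move=> mE /(_ x); rewrite P_intE; last exact: measurable_act_preimage.
by rewrite path_law1_act.
Qed.

Lemma path_measure_null p (E : set (borel (tSubG G))) : mass_function p ->
  (forall x, path_law x E = 0) -> M p E = 0.
Proof.
move=> mp E0; rewrite (path_measureE _ _ _ _ mp).
by apply: esum1 => x _; rewrite E0 mule0.
Qed.

Lemma path_shift_act g (a : tSubG G) : S (act_tSubG g a) = act_tSubG g (S a).
Proof. exact: val_inj. Qed.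

Lemma measure_setY0 d0 (T : measurableType d0) (m : {measure set T -> \bar R}) (A A' : set T) :
  measurable A -> measurable A' -> m (A `+` A') = 0 -> m A = m A'.
Proof.
have le E E' : measurable E -> measurable E' -> m (E `+` E') = 0 -> m E <= m E'.
  move=> mE mE' Y0; have mY : measurable (E `+` E').
    by rewrite setY_def; apply: measurableU; exact: measurableD.
  apply: (@le_trans _ _ (m (E' `|` (E `+` E')))).
    apply: le_measure; rewrite ?inE//; first exact: measurableU.
    by move=> a Ea; have [?|?] := pselect (E' a); [left|right; rewrite setY_def; left].
  by apply: le_trans (measureU2 m mE' mY) _; rewrite -[leRHS]adde0 -[in leRHS]Y0.
by move=> mA mA' Y0; apply/eqP; rewrite eq_le !le// setYC.
Qed.

Context (d' : measure_display) (B : measurableType d') (nu : probability B R).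
Context (act : G -> {mfun B >-> B}).
Context (D : set (borel (tSubG G))) (bnd : borel (tSubG G) -> B).
Hypothesis boundary : is_poisson_boundary (P_int Pr X lambda) act nu D bnd.

Let mD : measurable D. Proof. exact: bnd_dom_measurable boundary. Qed.

(** A total version of [bnd]; the complement of D is null from every starting point because D is
    carried into itself by the group. *)
Definition extended_bnd (a : borel (tSubG G)) : B := if a \in D then bnd a else point.

Lemma measurable_extended_bnd : measurable_fun setT extended_bnd.
Proof.
apply: measurable_fun_if => //.
- apply: (measurable_fun_bool true); rewrite setTI (_ : _ @^-1` _ = D) //.
  by apply/seteqP; split=> x /= H; [exact: set_mem H|exact: mem_set H].
- rewrite setTI (_ : _ @^-1` _ = D); first exact: (bnd_measurable boundary).
  by apply/seteqP; split=> x /= H; [exact: set_mem H|exact: mem_set H].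
Qed.

Lemma measurable_bnd_preimage (A : set B) : measurable A -> measurable (D `&` bnd @^-1` A).
Proof. by move=> mA; exact: (bnd_measurable boundary). Qed.

Lemma path_law_domC x : path_law x (~` D) = 0.
Proof.
rewrite -path_law1_act; last exact: measurableC.
apply/eqP; rewrite eq_le measure_ge0 andbT.
have <- : path_law 1%g (~` D) = 0.
  by rewrite -P_intE; [exact: (bnd_dom_conull boundary)|exact: measurableC].
apply: le_measure; rewrite ?inE.
- by apply: measurable_act_preimage; exact: measurableC.
- exact: measurableC.
- by move=> a /= nDa Da; apply: nDa; exact: (bnd_dom_invariant boundary).
Qed.

Lemma path_law_extended_bnd x (A : set B) : measurable A ->
  path_law x (extended_bnd @^-1` A) = path_law x (D `&` bnd @^-1` A).
Proof.
move=> mA; have mE : measurable (extended_bnd @^-1` A).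
  by rewrite -[X in measurable X]setTI; exact: measurable_extended_bnd.
apply: measure_setY0 => //; first exact: measurable_bnd_preimage.
apply/eqP; rewrite eq_le measure_ge0 andbT -(path_law_domC x); apply: le_measure; rewrite ?inE.
- by rewrite setY_def; apply: measurableU; apply: measurableD => //; exact: measurable_bnd_preimage.
- exact: measurableC.
- move=> a; rewrite setY_def => -[] [/= H1 H2] Da.
    by apply: H2; split => //=; move: H1; rewrite /extended_bnd mem_set.
  by apply: H2; rewrite /extended_bnd mem_set//; case: H1.
Qed.

(** Equivariance of the boundary map: moving the boundary point by g is starting the path at K g. *)
Lemma nu_act (A : set B) g : measurable A ->
  nu (act g @^-1` A) = path_law g (extended_bnd @^-1` A).
Proof.
move=> mA; have mgA : measurable (act g @^-1` A).
  by rewrite -[X in measurable X]setTI; exact: measurable_funPT.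
rewrite path_law_extended_bnd// -path_law1_act; last exact: measurable_bnd_preimage.
rewrite (bnd_law boundary mgA) P_intE; last exact: measurable_bnd_preimage.
apply: measure_setY0.
- exact: measurable_bnd_preimage.
- by apply: measurable_act_preimage; exact: measurable_bnd_preimage.
apply/eqP; rewrite eq_le measure_ge0 andbT -(path_law_domC 1%g); apply: le_measure; rewrite ?inE.
- rewrite setY_def; apply: measurableU; apply: measurableD;
    do ?[exact: measurable_bnd_preimage|by apply: measurable_act_preimage; exact: measurable_bnd_preimage].
- exact: measurableC.
- move=> a; rewrite setY_def => -[] [/= H1 H2] Da.
    apply: H2; case: H1 => _ H1; split; first exact: (bnd_dom_invariant boundary).
    by rewrite /= (bnd_equivariant boundary).
  by apply: H2; split => //; case: H1 => _; rewrite /= (bnd_equivariant boundary).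
Qed.

Lemma ae_extended_bnd p (A : set B) (I : set (borel (tSubG G))) : mass_function p ->
  measurable A -> measurable I ->
  null_path_set (P_int Pr X lambda) ((D `&` bnd @^-1` A) `+` I) ->
  {ae M p, forall a, A (extended_bnd a) <-> I a}.
Proof.
move=> mp mA mI nY; set Y := _ `+` _ in nY.
have mY : measurable Y.
  by rewrite /Y setY_def; apply: measurableU; apply: measurableD => //; exact: measurable_bnd_preimage.
have mN : measurable (~` D `|` Y) by apply: measurableU => //; exact: measurableC.
exists (~` D `|` Y); split => //.
  apply: path_measure_null => // x; apply/eqP; rewrite eq_le measure_ge0 andbT.
  apply: le_trans (measureU2 (path_law x) (measurableC mD) mY) _.
  have e1 : path_law x (~` D) <= 0 by rewrite path_law_domC.
  have e2 : path_law x Y <= 0 by rewrite (null_path_setP x mY nY).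
  by rewrite -[leRHS]adde0; exact: (leeD e1 e2).
move=> a /= nA; have [Da|] := pselect (D a); last by left.
right; rewrite /Y setY_def; move: nA; rewrite /extended_bnd mem_set// => nA.
have [Aa|nAa] := pselect (A (bnd a)).
  by left; split => // Ia; apply: nA.
right; split; last by case.
by apply: contrapT => nIa; apply: nA.
Qed.

Lemma invariant_pullback p (A : set B) : mass_function p -> measurable A ->
  exists I : set (borel (tSubG G)), [/\ measurable I, S @^-1` I = I,
    forall x, path_law x (extended_bnd @^-1` A) = path_law x I &
    {ae M p, forall a, A (extended_bnd a) <-> I a}].
Proof.
move=> mp mA; have [I [mI SI nY]] := bnd_pullback_invariant boundary mA.
exists I; split => //; last exact: ae_extended_bnd.
move=> x; rewrite path_law_extended_bnd//; apply: measure_setY0 => //.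
  exact: measurable_bnd_preimage.
apply: null_path_setP => //; rewrite setY_def.
by apply: measurableU; apply: measurableD => //; exact: measurable_bnd_preimage.
Qed.

Variables (g : G) (b : nat -> G -> R).
Hypothesis mug : (0 < mu g)%R.
Hypothesis b_pmf : forall n, is_pmf (b n).
Hypothesis b_next : forall n, next (b n) = b n.+1.
Hypothesis b_comm : forall n, convolution mu (b n) = next (b n).
Hypothesis b_asymp : forall m (eps : R), (0 < eps)%R -> exists N, forall n, (N <= n)%N ->
  l1dist (b n) (b (n + m)%N) <= eps%:E.
Hypothesis b_invariant : forall I : set (borel (tSubG G)), measurable I -> S @^-1` I = I ->
  M (b 0%N) I = path_law 1%g I.

Let mb n : mass_function (b n). Proof. exact: pmf_mass. Qed.

Lemma path_measure1_invariant (I : set (borel (tSubG G))) : measurable I -> S @^-1` I = I ->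
  M (b 1%N) I = path_law 1%g I.
Proof.
move=> mI SI; rewrite -b_next -(path_measure_shift G_countable mu_pmf X_iid lambda (mb 0%N) mI) SI.
exact: b_invariant.
Qed.

Lemma path_measure_translate_invariant (I : set (borel (tSubG G))) :
  measurable I -> S @^-1` I = I -> M (left_translate g (b 0%N)) I = path_law g I.
Proof.
move=> mI SI; rewrite -(path_measure_act G_countable X_iid lambda_invariant g (mb 0%N) mI).
rewrite b_invariant ?path_law1_act//; first exact: measurable_act_preimage.
by rewrite -[in RHS]SI; apply/seteqP; split=> a /=; rewrite path_shift_act.
Qed.

(** The measure nu is also the image of M (b 1): a boundary set pulls back to a shift-invariant set
    up to null sets, and on such sets M (b 1) agrees with the law started at 1. *)
Lemma integral_boundary (F : B -> \bar R) : (forall x, 0 <= F x) -> measurable_fun setT F ->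
  \int[nu]_x F x = \int[M (b 1%N)]_a F (extended_bnd a).
Proof.
move=> F0 mF; have mE := measurable_extended_bnd.
rewrite -[RHS](@ge0_integral_pushforward _ _ _ _ _ _ mE _ setT F)//.
apply: (@eq_measure_integral _ B R setT (law (M (b 1%N)) mE) nu F) => A mA _.
have [I [mI SI AI aeI]] := invariant_pullback (mb 1%N) mA.
apply: etrans (bnd_law boundary mA) _; rewrite P_intE; last exact: measurable_bnd_preimage.
rewrite -path_law_extended_bnd// AI -path_measure1_invariant//.
rewrite (path_measureE _ _ _ _ (mb 1%N)); apply/esym.
apply: etrans (path_measureE G_countable X_iid lambda (extended_bnd @^-1` A) (mb 1%N)) _.
by congr wsum; apply/funext => x; exact: AI.
Qed.

Lemma boundary_entropy :
  {homo (fun n => divergence (left_translate g (b n)) (b n.+1)) : i j / (i <= j)%N >-> j <= i} ->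
  \int[nu]_x (- lne (Radon_Nikodym (charge_of_finite_measure (nu_comp act nu g)) nu x)) =
  ereal_inf (range (fun n => divergence (left_translate g (b n)) (b n.+1))).
Proof.
move=> D_ni; pose C := ((mu g)^-1)%R.
have C0 : (0 <= C)%R by rewrite invr_ge0 ltW.
have [Psi [mPsi PsiC PsiS <- PsiI]] := exists_tail_limit mu_pmf
  mug b_pmf b_next b_comm b_asymp D_ni.
(* The superlevel sets of Psi are exactly invariant, so each comes from the boundary; this is what
   lets Psi factor through it. *)
have level (q : rat) : exists A : set B, measurable A /\
    {ae M (b 1%N), forall a, A (extended_bnd a) <-> (ratr q < Psi a)%R}.
  pose I : set (borel (tSubG G)) := [set a | (ratr q < Psi a)%R].
  have mI : measurable I.
    have := mPsi measurableT _ (measurable_itv `]ratr q, +oo[).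
    by rewrite setTI; congr measurable; apply/seteqP; split=> a /=; rewrite in_itv/= andbT.
  have SI : S @^-1` I = I by apply/seteqP; split=> a; rewrite /I /= PsiS.
  have [A [mA nY]] := bnd_invariant_pullback boundary mI SI.
  by exists A; split => //; exact: (ae_extended_bnd (mb 1%N) mA mI nY).
have [f [mf f0C fPsi]] := exists_factor C0 PsiC level.
have [act1 actM] := bnd_action boundary.
have f0 x : (0 <= f x)%R by case/andP: (f0C x).
rewrite (@furstenberg_density _ B R nu (act g) (act g^-1%g) f C)//.
- rewrite integral_boundary.
  + apply: ae_eq_integral => //.
    * exact: measurableT_comp (measurable_ent_comp mf) measurable_extended_bnd.
    * exact: measurable_ent_comp.
    * by apply: filterS fPsi => a fa _; rewrite fa.
  + by move=> x; rewrite lee_fin ent_ge0.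
  + exact: measurable_ent_comp.
- by move=> x; rewrite -actM mulVg act1.
- by move=> A mA; exact: (bnd_nonsingular boundary).
(* What remains is that f is the density of the image of nu under g. With I the invariant set
   matching A, the mass is that of I under the law started at g, hence under M (gb 0), which is the
   integral of Psi over I. *)
move=> A mA; rewrite nu_act//.
have [I [mI SI AI aeI]] := invariant_pullback (mb 1%N) mA.
rewrite AI -path_measure_translate_invariant// -PsiI// [LHS]integral_mkcond [RHS]integral_mkcond.
have mfA : measurable_fun setT ((fun x => (f x)%:E) \_ A).
  by apply/(measurable_restrictT _ mA); apply: measurable_funTS; exact/measurable_EFinP.
have fA0 x : 0 <= ((fun x => (f x)%:E) \_ A) x.
  by rewrite patchE; case: ifP => _ //; rewrite lee_fin.
rewrite (integral_boundary fA0 mfA); apply: ae_eq_integral => //.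
- by apply/(measurable_restrictT _ mI); apply: measurable_funTS; exact/measurable_EFinP.
- exact: measurableT_comp mfA measurable_extended_bnd.
- apply: filterS2 fPsi aeI => a fa Aa _; rewrite !patchE fa.
  suff -> : (a \in I) = (extended_bnd a \in A) by [].
  by apply/idP/idP; rewrite !inE => /Aa.
Qed.

End BoundaryEntropy.

(** * Entropy of the random walk on the coset spaces *)

Section Differences.
Context (R : realType).
Implicit Types (u v : nat -> R) (l : R).

Lemma nonincreasing_ge_limit u l n : {homo u : i j / (i <= j)%N >-> (j <= i)%R} ->
  u k @[k --> \oo] --> l -> (l <= u n)%R.
Proof.
move=> u_ni ul; have <- : limn u = l by exact: cvg_lim.
by apply: limr_le; [exact: cvgP ul|near=> k; apply: u_ni; near: k; exact: nbhs_infty_ge].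
Unshelve. all: by end_near. Qed.

Lemma nonincreasing_nonneg_cvg u : {homo u : i j / (i <= j)%N >-> (j <= i)%R} ->
  (forall n, 0 <= u n)%R -> exists l, u n @[n --> \oo] --> l.
Proof.
move=> u_ni u0; exists (inf (range u)); apply: nonincreasing_cvgn => //.
by exists 0%R => _ [n _ <-].
Qed.

Lemma mean_difference u n :
  arithmetic_mean (telescope u) n = (n.+1%:R^-1 * (u n.+1 - u 0%N))%R.
Proof. by rewrite /arithmetic_mean telescopeK. Qed.

Lemma mean_difference_cvg u l : (u n.+1 - u n)%R @[n --> \oo] --> l ->
  (n.+1%:R^-1 * (u n.+1 - u 0%N))%R @[n --> \oo] --> l.
Proof.
move=> ul; rewrite (_ : (fun n => _) = arithmetic_mean (telescope u)).
  exact: (@cesaro _ (telescope u)).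
by apply/funext => n; rewrite mean_difference.
Qed.

Lemma limit_le_mean_difference u l n : {homo telescope u : i j / (i <= j)%N >-> (j <= i)%R} ->
  (u n.+1 - u n)%R @[n --> \oo] --> l -> (l <= n.+1%:R^-1 * (u n.+1 - u 0%N))%R.
Proof.
move=> u_ni ul; rewrite ler_pdivlMl//.
elim: n => [|n IHn]; first by rewrite mul1r; exact: (nonincreasing_ge_limit 0%N u_ni).
have := lerD IHn (nonincreasing_ge_limit n.+1 u_ni ul).
by rewrite /telescope [X in (_ <= X)%R]addrC addrA subrK -[n.+2%:R]natr1 mulrDl mul1r.
Qed.

(** By Cesaro, the limit of the increments of u - v is also the limit of (u - v)(n) / n, which is 0
    for a bounded gap. *)
Lemma bounded_gap_limits u v l l' (K : R) : (u n.+1 - u n)%R @[n --> \oo] --> l ->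
  (v n.+1 - v n)%R @[n --> \oo] --> l' -> (forall n, `|u n - v n| <= K)%R -> l = l'.
Proof.
move=> ul vl K_uv; pose w n := (u n - v n)%R.
have wl : (w n.+1 - w n)%R @[n --> \oo] --> (l - l')%R.
  rewrite (_ : (fun n => _) = (fun n => (u n.+1 - u n) - (v n.+1 - v n))%R); first exact: cvgB.
  by apply/funext => n; rewrite /w opprD addrACA -opprD.
have {}wl := mean_difference_cvg wl.
have w0 : (n.+1%:R^-1 * (w n.+1 - w 0%N))%R @[n --> \oo] --> (0 : R)%R.
  apply/norm_cvg0P; apply: (@squeeze_cvgr _ _ _ _ (fun=> 0%R) (fun n => n.+1%:R^-1 * (K + K))%R).
  - near=> n; rewrite normr_ge0/= normrM ger0_norm ?invr_ge0// ler_wpM2l ?invr_ge0//.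
    by apply: le_trans (ler_normB _ _) _; exact: (lerD (K_uv _) (K_uv _)).
  - exact: cvg_cst.
  - rewrite -[X in _ --> X](mul0r (K + K)%R); apply: cvgM; last exact: cvg_cst.
    exact: cvg_harmonic.
by apply/eqP; rewrite -subr_eq0; apply/eqP; exact: (cvg_unique _ wl w0).
Unshelve. all: by end_near. Qed.

Lemma esum_telescope u l : {homo u : i j / (i <= j)%N >-> (j <= i)%R} ->
  u n @[n --> \oo] --> l -> \esum_(i in [set: nat]) (u i - u i.+1)%:E = (u 0%N - l)%:E.
Proof.
move=> u_ni ul; rewrite -nneseries_esumT; last first.
  by move=> n; rewrite lee_fin subr_ge0 u_ni.
apply: cvg_lim => //; rewrite (_ : (fun n => _) = (fun n => (u 0%N - u n)%:E)).
  by apply: cvg_EFin; [near=> n|apply: cvgB => //; exact: cvg_cst].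
apply/funext => n; rewrite sumEFin; congr EFin.
elim: n => [|n IHn]; first by rewrite big_geq// subrr.
by rewrite big_nat_recr//= IHn addrA subrK.
Unshelve. all: by end_near. Qed.

End Differences.

Section CosetEntropy.
Context (R : realType) (G : groupType).
Implicit Types (p : G -> R) (K : SubG G).

Lemma coset_lawE p K y : mass_function p ->
  coset_law p (val K) (rcoset_by (val K) y) = mass p (rcoset_by (val K) y).
Proof.
move=> mp; rewrite /coset_law /mass; congr fine; rewrite esum_mkcond; apply: eq_esum => x _.
have -> : (x \in rcoset_by (val K) @^-1` [set rcoset_by (val K) y]) = rcoset_by (val K) y x.
  apply/idP/idP => [/set_mem/= <-|yx]; first exact: rcoset_by_refl.
  by apply/mem_set; rewrite /= (rcoset_byE yx).
by case: ifP; rewrite ?mule1 ?mule0.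
Qed.

(** The mass of each coset is redistributed over its group elements, which turns the sum over cosets
    into a sum over G, comparable with integrals of -ln kappa_p. *)
Lemma coset_entropyE p K : is_pmf p ->
  entropy (rcosets_by (val K)) (coset_law p (val K)) =
  wsum p (fun x => (- ln (mass p (rcoset_by (val K) x)))%:E).
Proof.
move=> pp; have mp := pmf_mass pp.
pose L (C : subsets G) : \bar R := (- ln (mass p C))%:E.
have L0 C : 0 <= L C by rewrite lee_fin oppr_ge0 ln_le0// mass_le1.
pose F C x : \bar R := if C == rcoset_by (val K) x then L C else 0.
have F0 C x : 0 <= F C x by rewrite /F; case: ifP.
transitivity (wsum p (fun x => \esum_(C in [set: subsets G]) F C x)); last first.
  by apply: eq_wsum => // x _; exact: esum_indic1.
rewrite wsum_esum// /entropy esum_mkcond; apply: eq_esum => C _.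
case: ifPn => [|nC]; last first.
  apply/esym/esum1 => x _; rewrite /F; case: eqP => [E|]; last by rewrite mule0.
  by case/negP: nC; rewrite inE E; exists x.
rewrite inE => -[y _ <-]; rewrite coset_lawE// -mulrN EFinM massE//.
rewrite [wsum p (F _)](_ : _ = wsum p (fun x => L (rcoset_by (val K) y) * (rcoset_by (val K) y x)%:R%:E)).
  have C0 x : 0 <= (rcoset_by (val K) y x)%:R%:E :> \bar R by rewrite lee_fin ler0n.
  by apply: etrans (esym (wsumZ mp (L0 _) C0)); exact: muleC.
congr wsum; apply/funext => x; rewrite /F.
have -> : (rcoset_by (val K) y == rcoset_by (val K) x) = rcoset_by (val K) y x.
  apply/eqP/idP => [->|/rcoset_byE//]; exact: rcoset_by_refl.
by case: (rcoset_by _ _ _); rewrite ?mule1 ?mule0.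
Qed.

End CosetEntropy.

Section DecreasingSums.
Context (R : realType) (G : groupType) (p : G -> R).
Variables (D : nat -> G -> \bar R) (c : nat -> R).
Hypothesis mp : mass_function p.
Hypothesis D0 : forall n g, 0 <= D n g.
Hypothesis D_ni : forall g, (0 < p g)%R -> {homo D ^~ g : i j / (i <= j)%N >-> j <= i}.
Hypothesis Dc : forall n, wsum p (D n) = (c n)%:E.

Let D_fin n g : (0 < p g)%R -> D n g \is a fin_num.
Proof.
move=> pg; rewrite ge0_fin_numE//; have : (p g)%:E * D n g < +oo.
  apply: le_lt_trans (_ : (c n)%:E < _); last exact: ltry.
  rewrite -Dc; apply: (@esum_ge_term _ _ (fun x => (p x)%:E * D n x)) => x.
  by rewrite mule_ge0// lee_fin mp.1.
by case: (D n g) => [r||]//; rewrite ?ltry// gt0_muley ?lte_fin// ltxx.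
Qed.

(* Monotone convergence for the increments [D n - D n.+1], whose sum telescopes. *)
Lemma wsum_inf_decreasing l : c n @[n --> \oo] --> l ->
  wsum p (fun g => ereal_inf (range (D ^~ g))) = l%:E.
Proof.
move=> cl; pose dd g n : R := fine (D n g).
have ddE g n : (0 < p g)%R -> (dd g n)%:E = D n g.
  by move=> pg; rewrite /dd fineK// D_fin.
(* The absolute value keeps the gap nonnegative off the support of p, where no monotonicity is
   assumed. *)
pose gap n g : \bar R := `|dd g n - dd g n.+1|%:E.
have gapE n g : (0 < p g)%R -> D n g = gap n g + D n.+1 g.
  move=> pg; rewrite /gap ger0_norm; first by rewrite -!ddE// -EFinD subrK.
  by rewrite subr_ge0 -lee_fin !ddE//; exact: D_ni.
have gap0 n g : 0 <= gap n g by rewrite lee_fin.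
have inf0 g : 0 <= ereal_inf (range (D ^~ g)).
  by apply: le_ereal_inf_tmp => _ [n _ <-].
have D0E g : (0 < p g)%R ->
    D 0%N g = ereal_inf (range (D ^~ g)) + \esum_(n in [set: nat]) gap n g.
  move=> pg.
  have dd_ni : {homo dd g : i j / (i <= j)%N >-> (j <= i)%R}.
    by move=> i j ij; rewrite -lee_fin !ddE//; exact: D_ni.
  have dd0 n : (0 <= dd g n)%R by rewrite -lee_fin ddE.
  have [y ddy] := nonincreasing_nonneg_cvg dd_ni dd0.
  have -> : ereal_inf (range (D ^~ g)) = y%:E.
    have c1 := ereal_nonincreasing_cvgn (D_ni pg).
    have c2 : (dd g n)%:E @[n --> \oo] --> y%:E by apply: cvg_EFin => //; near=> n.
    rewrite (_ : (fun n => (dd g n)%:E) = D ^~ g) in c2.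
      exact: (cvg_unique (@ereal_hausdorff R) c1 c2).
    by apply/funext => n; rewrite ddE.
  have := esum_telescope dd_ni ddy.
  rewrite (_ : \esum_(i in [set: nat]) _ = \esum_(n in [set: nat]) gap n g).
    by move=> ->; rewrite -EFinD -ddE// addrC subrK.
  by apply: eq_esum => n _; rewrite /gap ger0_norm// subr_ge0 dd_ni.
have wgap n : wsum p (gap n) = (c n - c n.+1)%:E.
  have := Dc n.
  rewrite (eq_wsum mp (F' := fun g => gap n g + D n.+1 g)); last by move=> g pg; exact: gapE.
  rewrite wsumD// Dc => /(congr1 (fun y => y - (c n.+1)%:E)).
  by rewrite addeK// => ->; rewrite -EFinB.
have c_ni : {homo c : i j / (i <= j)%N >-> (j <= i)%R}.
  move=> i j ij; rewrite -lee_fin -!Dc; apply: le_wsum => // g pg.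
  exact: D_ni.
have := Dc 0%N.
rewrite (eq_wsum mp (F' := fun g => ereal_inf (range (D ^~ g)) +
  \esum_(n in [set: nat]) gap n g)); last by move=> g pg; exact: D0E.
rewrite wsumD//; last by move=> g; apply: esum_ge0.
rewrite wsum_esum//; under [X in _ + X]eq_esum do rewrite wgap.
rewrite (esum_telescope c_ni cl).
move=> /(congr1 (fun y => y - (c 0%N - l)%:E)).
by rewrite addeK// => ->; rewrite -EFinB opprB addrC subrK.
Unshelve. all: by end_near. Qed.

End DecreasingSums.

(** * Averages of consecutive convolution powers *)

Section Averages.
Context (R : realType) (G : groupType) (mu : G -> R) (k : nat).
Hypothesis mu_pmf : is_pmf mu.
Hypothesis k_gt0 : (0 < k)%N.
Implicit Types p q r : G -> R.

(** The beta_n of the overview. *)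
Definition average n : G -> R := mixture k (fun i => convolution_power mu (n + i)).

Let mP i : is_pmf (convolution_power mu i). Proof. exact: convolution_power_pmf. Qed.

Lemma average_pmf n : is_pmf (average n).
Proof. exact: mixture_pmf. Qed.

Lemma average_next n : convolution (average n) mu = average n.+1.
Proof. by rewrite /average convolution_mixture. Qed.

Lemma convolution_power_comm n : convolution mu (convolution_power mu n) = convolution_power mu n.+1.
Proof.
rewrite -add1n (convolution_powerD 1 n mu_pmf) [convolution_power mu 1]/=.
by rewrite (convolution1p (pmf_mass mu_pmf) mu_pmf).
Qed.

Lemma average_comm n : convolution mu (average n) = convolution (average n) mu.
Proof.
rewrite average_next /average mixture_convolution//; congr mixture.
by apply/funext => i; rewrite convolution_power_comm.
Qed.

Lemma l1dist_triangle p q r : l1dist p r <= l1dist p q + l1dist q r.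
Proof.
rewrite /l1dist -esumD; do ?by move=> x _; rewrite lee_fin.
by apply: le_esum => x _; rewrite -EFinD lee_fin ler_distD.
Qed.

Lemma average_sub n x : (average n.+1 x - average n x =
  k%:R^-1 * (convolution_power mu (n + k) x - convolution_power mu n x))%R.
Proof.
rewrite /average /mixture -mulrBr; congr (_ * _)%R.
have -> : (\sum_(i < k) convolution_power mu (n.+1 + i) x =
    \sum_(i < k) convolution_power mu (n + i.+1) x)%R.
  by apply: eq_bigr => i _; rewrite addnS.
have E : (\sum_(i < k) convolution_power mu (n + i.+1) x + convolution_power mu (n + 0) x =
    \sum_(i < k) convolution_power mu (n + i) x + convolution_power mu (n + k) x)%R.
  transitivity (\sum_(i < k.+1) convolution_power mu (n + i) x)%R.
    by rewrite big_ord_recl/= addrC.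
  by rewrite big_ord_recr.
rewrite addn0 in E; rewrite -[X in (X - _)%R](addrK (convolution_power mu n x)) E.
by rewrite addrAC [X in (X - _)%R]addrAC subrr add0r.
Qed.

Lemma l1dist_average_next n :
  l1dist (average n) (average n.+1) <=
  l1dist (convolution_power mu (n + k)) (convolution_power mu n).
Proof.
apply: le_esum => x _; rewrite lee_fin distrC average_sub normrM ler_piMl//.
by rewrite ger0_norm ?invr_ge0// invf_le1 ?ler1n// ltr0n.
Qed.

Lemma average_asymp : (0 < convolution_power mu k 1%g)%R ->
  forall m (eps : R), (0 < eps)%R -> exists N, forall n, (N <= n)%N ->
  l1dist (average n) (average (n + m)%N) <= eps%:E.
Proof.
move=> mu1; elim=> [|m IHm] eps eps0.
  exists 0%N => n _; rewrite addn0 /l1dist esum1 ?lee_fin ?ltW// => x _.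
  by rewrite subrr normr0.
have e2 : (0 < eps / 2)%R by rewrite divr_gt0.
have [N1 HN1] := IHm _ e2; have [N2 HN2] := zero_two_law mu_pmf mu1 e2.
exists (N1 + N2)%N => n Nn.
apply: le_trans (l1dist_triangle _ (average (n + m)%N) _) _.
rewrite (splitr eps) EFinD; apply: leeD; first by apply: HN1; lia.
by rewrite addnS; apply: le_trans (l1dist_average_next _) _; apply: HN2; lia.
Qed.

End Averages.

Lemma lee_eq (R : realType) (x y x' y' : \bar R) : x = x' -> y = y' -> x' <= y' -> x <= y.
Proof. by move=> -> ->. Qed.

Lemma eq_sub_fin (R : realType) (a b : R) (x y w : \bar R) : a%:E = x -> b%:E = y ->
  x = w + y -> (a - b)%:E = w.
Proof. by move=> <- <-; rewrite EFinB => ->; rewrite addeK. Qed.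

Lemma ereal_inf_limit (R : realType) (u : nat -> \bar R) (l : \bar R) :
  (forall n, l <= u n) -> u n @[n --> \oo] --> l -> ereal_inf (range u) = l.
Proof.
move=> lu ul; apply/eqP; rewrite eq_le; apply/andP; split; last first.
  by apply: le_ereal_inf_tmp => _ [n _ <-].
have <- : limn u = l by exact: cvg_lim.
apply: lime_ge; first exact: cvgP ul.
by apply: nearW => n; apply: ereal_inf_lbound; exists n.
Qed.

Lemma dist_le_fin (R : realType) (u v K : R) (x : \bar R) : u%:E = x ->
  v%:E <= x <= (v + K)%:E -> (`|u - v| <= K)%R.
Proof.
by move=> <-; rewrite !lee_fin => /andP[vu uK]; rewrite ger0_norm ?subr_ge0// lerBlDl.
Qed.

Lemma eq_lee_fin (R : realType) (a b : R) (x : \bar R) : b%:E = x -> (a <= b)%R -> a%:E <= x.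
Proof. by move=> <- ab; rewrite lee_fin. Qed.

Lemma eq_leeD (R : realType) (a b y : R) (x : \bar R) : a%:E = x -> (a + b <= y)%R ->
  x + b%:E <= y%:E.
Proof. by move=> <- aby; rewrite -EFinD lee_fin. Qed.

Section Mean.
Context (R : realType) (k : nat).
Hypothesis k_gt0 : (0 < k)%N.

Lemma mean_cst (z : R) : (k%:R^-1)%:E * \sum_(i < k) z%:E = z%:E.
Proof.
rewrite sumEFin sumr_const card_ord -EFinM -(mulr_natl z) mulrA mulVf ?mul1r//.
by rewrite pnatr_eq0 -lt0n.
Qed.

Lemma mean_bounds (t : nat -> \bar R) (x y : R) : (forall i, (i < k)%N -> x%:E <= t i <= y%:E) ->
  x%:E <= (k%:R^-1)%:E * \sum_(i < k) t i <= y%:E.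
Proof.
move=> H; have ki0 : 0 <= (k%:R^-1 : R)%:E by rewrite lee_fin invr_ge0 ler0n.
rewrite -[x%:E]mean_cst -[y%:E]mean_cst.
by apply/andP; split; apply: lee_wpmul2l => //; apply: lee_sum => i _; case/andP: (H i (ltn_ord i)).
Qed.

End Mean.

(** * The entropy formula *)

Section EntropyFormula.
Context (R : realType) (G : groupType).
Hypothesis G_countable : countable [set: G].
Context (d : measure_display) (Omega : measurableType d) (Pr : probability Omega R).
Context (X : nat -> Omega -> G) (mu : G -> R).
Hypothesis mu_pmf : is_pmf mu.
Hypothesis X_iid : iid_with_law Pr X mu.
Variable lambda : probability (borel (SubG G)) R.
Hypothesis lambda_invariant : conj_invariant lambda.

Local Notation M := (path_measure G_countable X_iid lambda).
Local Notation next p := (convolution p mu).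

Hypothesis mu_admissible : admissible mu.
Hypothesis mu_entropy : entropy [set: G] mu < +oo.
Local Notation cross_entropy := (cross_entropy G_countable X_iid lambda).
Local Notation divergence := (divergence G_countable X_iid lambda).
Local Notation path_law := (path_law G_countable X_iid lambda).

Lemma measurable_coset_entropy n :
  measurable_fun setT (fun K : borel (SubG G) => coset_entropy mu n K).
Proof.
have pn := convolution_power_pmf n mu_pmf; have mn := pmf_mass pn.
set p := convolution_power mu n in pn mn *.
rewrite (_ : (fun K => _) = (fun K => wsum p (fun x => (- ln (mass p (rcoset_by (val K) x)))%:E))); last first.
  by apply/funext => K; exact: coset_entropyE.
apply: measurable_fun_esum => //.
  by move=> x K; rewrite mule_ge0// lee_fin ?mn.1// oppr_ge0 ln_le0// mass_le1.
move=> x; apply: emeasurable_funM; first exact: measurable_cst.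
have mc : measurable_fun setT
    (fun K : borel (SubG G) => coset_path K (fun=> x) : borel (tSubG G)).
  apply: measurable_fun_coset_path => // k g.
  have [->|xg] := eqVneq x g.
    by rewrite (_ : [set _ | _] = setT)//; apply/seteqP; split.
  rewrite (_ : [set _ | _] = set0)//; apply/seteqP; split => // K /= E.
  by rewrite E eqxx in xg.
exact: measurableT_comp (measurable_nlcmass G_countable mn) mc.
Qed.

Lemma coset_entropy_ge0 n (K : SubG G) : 0 <= coset_entropy mu n K.
Proof.
have pn := convolution_power_pmf n mu_pmf.
rewrite /coset_entropy coset_entropyE//; apply: wsum_ge0; first exact: pmf_mass.
by move=> x; rewrite lee_fin oppr_ge0 ln_le0// mass_le1.
Qed.

Lemma integral_coset_entropy n :
  \int[lambda]_K coset_entropy mu n K =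
  cross_entropy (convolution_power mu n) (convolution_power mu n).
Proof.
have pn := convolution_power_pmf n mu_pmf; have mn := pmf_mass pn.
have E := integral_path_measure_subgroups G_countable X_iid lambda mn
  (fun a => nlcmass_ge0 a pn) (measurable_nlcmass G_countable mn).
refine (etrans _ (esym E)).
apply: eq_integral => K _; rewrite /coset_entropy coset_entropyE//.
congr wsum; apply/funext => x; apply/esym.
transitivity (\int[Pr]_w (cst (- ln (mass (convolution_power mu n) (rcoset_by (val (K : SubG G)) x)))%:E w)).
  by apply: eq_integral => w _; rewrite /path_from cmass_coset_path /= mulg1.
by rewrite integral_cst// [X in _ * X](@probability_setT _ _ _ Pr) mule1.
Qed.

Lemma entropy_power_fin n : entropy [set: G] (convolution_power mu n) < +oo.
Proof.
elim: n => [|n IHn].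
  rewrite entropyE wsum_power0; last by move=> x; exact: nlpmf_ge0 (convolution_power_pmf 0 mu_pmf).
  exact: ltry.
apply: le_lt_trans (entropy_next mu_pmf (convolution_power_pmf n mu_pmf)) _.
exact: lte_add_pinfty.
Qed.

Lemma cross_entropy_power_fin n :
  cross_entropy (convolution_power mu n) (convolution_power mu n) < +oo.
Proof.
have pn := convolution_power_pmf n mu_pmf.
exact: le_lt_trans (cross_entropy_le_entropy _ _ _ pn) (entropy_power_fin n).
Qed.

Lemma cross_entropy_power0 :
  cross_entropy (convolution_power mu 0) (convolution_power mu 0) = 0.
Proof.
have p0 := convolution_power_pmf 0 mu_pmf.
apply/eqP; rewrite eq_le cross_entropy_ge0// andbT.
apply: le_trans (cross_entropy_le_entropy _ _ _ p0) _.
rewrite entropyE wsum_power0; last by move=> x; exact: nlpmf_ge0.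
by rewrite /= eqxx ln1 oppr0.
Qed.

Lemma integral_coset_entropy_sub m n :
  \int[lambda]_K (coset_entropy mu m K - coset_entropy mu n K) =
  cross_entropy (convolution_power mu m) (convolution_power mu m) -
  cross_entropy (convolution_power mu n) (convolution_power mu n).
Proof.
have ii k : lambda.-integrable setT (fun K => coset_entropy mu k K).
  apply/integrableP; split; first exact: measurable_coset_entropy.
  have -> : \int[lambda]_K `|coset_entropy mu k K| = \int[lambda]_K coset_entropy mu k K.
    by apply: eq_integral => K _; rewrite gee0_abs// coset_entropy_ge0.
  by rewrite integral_coset_entropy; exact: cross_entropy_power_fin.
by rewrite integralB// !integral_coset_entropy.
Qed.

Section IncrementSequence.
Variable q : nat -> G -> R.
Hypothesis q_pmf : forall n, is_pmf (q n).
Hypothesis q_next : forall n, next (q n) = q n.+1.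
Hypothesis q_comm : forall n, convolution mu (q n) = next (q n).
Hypothesis q_fin : forall n, cross_entropy (q n) (q n) < +oo.

Local Notation D n g := (divergence (left_translate g (q n)) (q n.+1)).

Definition self_entropy n : R := fine (cross_entropy (q n) (q n)).

Local Notation L := self_entropy.

Lemma self_entropyE n : (L n)%:E = cross_entropy (q n) (q n).
Proof. by rewrite /self_entropy fineK// cross_entropy_fin_num. Qed.

Opaque self_entropy.

Let D_ge0 n g : 0 <= D n g.
Proof. by apply: divergence_ge0; [apply: left_translate_mass|]; exact: pmf_mass. Qed.

Lemma self_entropy_increment n : (L n.+1 - L n)%:E = wsum mu (fun g => D n g).
Proof.
have E := cross_entropy_increment G_countable mu_pmf X_iid lambda_invariant (q_pmf n) (q_comm n).
rewrite (q_next n) in E.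
exact: (eq_sub_fin (self_entropyE n.+1) (self_entropyE n) E).
Qed.

Lemma divergence_decreasing g : (0 < mu g)%R ->
  {homo (fun n => D n g) : i j / (i <= j)%N >-> j <= i}.
Proof.
move=> mug i j /subnKC <-; elim: (j - i)%N => [|n IHn]; first by rewrite addn0.
rewrite addnS; apply: le_trans IHn.
have := divergence_next_le mu_pmf lambda_invariant (q_pmf (i + n)%N) (q_comm (i + n)%N) mug.
by rewrite (q_next (i + n)%N) (q_next (i + n).+1%N); apply; exact: q_fin.
Qed.

Lemma self_entropy_increment_ge0 n : (0 <= L n.+1 - L n)%R.
Proof. by rewrite -lee_fin self_entropy_increment wsum_ge0//; exact: pmf_mass. Qed.

Lemma self_entropy_increment_decreasing :
  {homo telescope L : i j / (i <= j)%N >-> (j <= i)%R}.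
Proof.
move=> i j ij; suff : (L j.+1 - L j)%:E <= (L i.+1 - L i)%:E by rewrite lee_fin.
apply: (lee_eq (self_entropy_increment j) (self_entropy_increment i)).
apply: le_wsum; first exact: pmf_mass.
by move=> g mug; exact: divergence_decreasing.
Qed.

Lemma wsum_inf_divergence l : (L n.+1 - L n)%R @[n --> \oo] --> l ->
  wsum mu (fun g => ereal_inf (range (fun n => D n g))) = l%:E.
Proof.
move=> Ll.
exact: (wsum_inf_decreasing (pmf_mass mu_pmf) D_ge0 divergence_decreasing
  (fun n => esym (self_entropy_increment n)) Ll).
Qed.

End IncrementSequence.

Local Notation L := self_entropy.
Local Notation muP := (convolution_power mu).

Let muP_pmf n : is_pmf (muP n). Proof. exact: convolution_power_pmf. Qed.
Let muP_next n : next (muP n) = muP n.+1. Proof. by []. Qed.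
Let muP_comm n : convolution mu (muP n) = next (muP n).
Proof. exact: convolution_power_comm. Qed.
Let muP_fin n : cross_entropy (muP n) (muP n) < +oo.
Proof. exact: cross_entropy_power_fin. Qed.

Section AverageEntropy.
Variable k : nat.
Hypothesis k_gt0 : (0 < k)%N.
Local Notation avg := (average mu k).

Let avg_pmf n : is_pmf (avg n). Proof. exact: average_pmf. Qed.

(** The entropy of the average is the mean over i < k of L(mu^(n+i), avg). Each term is at least
    L(mu^(n+i), mu^(n+i)), and exceeds it by at most ln k because mu^(n+i) <= k avg. In turn these
    self entropies lie between that of mu^n and that value plus k c, where c is the first, hence
    largest, increment. *)
Lemma average_entropy_bounds : exists K : R, forall n,
  (L muP n)%:E <= cross_entropy (avg n) (avg n) <= (L muP n + K)%:E.
Proof.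
pose c := (L muP 1 - L muP 0)%R.
have c0 : (0 <= c)%R := self_entropy_increment_ge0 muP_pmf muP_next muP_comm muP_fin 0.
have Lc n : (L muP n.+1 - L muP n <= c)%R.
  exact: (self_entropy_increment_decreasing muP_pmf muP_next muP_comm muP_fin (leq0n n)).
have L_incr n i : (L muP n <= L muP (n + i)%N <= L muP n + i%:R * c)%R.
  elim: i => [|i /andP[IH1 IH2]]; first by rewrite addn0 mul0r addr0 lexx.
  rewrite addnS; apply/andP; split.
    apply: le_trans IH1 _; rewrite -subr_ge0.
    exact: (self_entropy_increment_ge0 muP_pmf muP_next muP_comm muP_fin).
  have := Lc (n + i)%N; rewrite lerBlDr => /le_trans; apply.
  by rewrite -[i.+1%:R]natr1 mulrDl mul1r addrA [leRHS]addrC lerD2l.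
have arith (u v : R) i : (i < k)%N -> (v <= u + i%:R * c)%R ->
    (v + ln k%:R <= u + (k%:R * c + ln k%:R))%R.
  move=> ik vu; rewrite addrA lerD2r (le_trans vu)// lerD2l ler_wpM2r// ler_nat.
  exact: ltnW.
exists (k%:R * c + ln k%:R)%R => n.
have k1 : (1 <= k%:R :> R)%R by rewrite ler1n.
have mE := integral_path_mixture G_countable X_iid lambda k_gt0 (fun i => muP_pmf (n + i)%N)
  (fun a => nlcmass_ge0 a (avg_pmf n)) (measurable_nlcmass G_countable (pmf_mass (avg_pmf n))).
have bounds i : (i < k)%N ->
    (L muP n)%:E <= cross_entropy (muP (n + i)%N) (avg n) <= (L muP n + (k%:R * c + ln k%:R))%:E.
  move=> ik; have /andP[L1 L2] := L_incr n i.
  have dom x : (muP (n + i)%N x <= k%:R * avg n x)%R.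
    exact: (mixture_le x (fun j => pmf_mass (muP_pmf (n + j)%N)) ik).
  have LE := self_entropyE muP_pmf muP_fin (n + i)%N.
  apply/andP; split.
    apply: le_trans (cross_entropy_self_le G_countable X_iid lambda (muP_pmf _) (avg_pmf n) (ler0n _ k) dom).
    exact: (eq_lee_fin LE L1).
  apply: le_trans (cross_entropy_dominated G_countable X_iid lambda (muP_pmf _) (avg_pmf n) k1 dom) _.
  exact: (eq_leeD LE (arith _ _ _ ik L2)).
have := mean_bounds k_gt0 bounds.
by rewrite -[X in _ <= X <= _ -> _]mE.
Qed.

End AverageEntropy.

Context (d' : measure_display) (B : measurableType d') (nu : probability B R).
Context (act : G -> {mfun B >-> B}).
Context (D : set (borel (tSubG G))) (bnd : borel (tSubG G) -> B).
Hypothesis boundary : is_poisson_boundary (P_int Pr X lambda) act nu D bnd.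

(** On invariant sets the measure of mu^(n+1) equals that of mu^n, by the shift, so all powers and
    their averages give the mass of the law started at 1. *)
Lemma average_invariant k (I : set (borel (tSubG G))) : (0 < k)%N -> measurable I ->
  @path_shift G @^-1` I = I -> M (average mu k 0) I = path_law 1%g I.
Proof.
move=> k0 mI SI; have mP n := pmf_mass (muP_pmf n).
have E n : wsum (muP n) (path_law ^~ I) = path_law 1%g I.
  elim: n => [|n IHn]; first by rewrite wsum_power0// => x; exact: measure_ge0.
  have := path_measure_shift G_countable mu_pmf X_iid lambda (mP n) mI.
  rewrite SI (path_measureE _ _ _ _ (mP n)) IHn muP_next => ->.
  by rewrite (path_measureE _ _ _ _ (mP n.+1)).
rewrite (path_measureE _ _ _ _ (pmf_mass (average_pmf mu_pmf k0 0))).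
rewrite /average wsum_mixture//.
under eq_bigr do rewrite E.
have [r ->] : exists r : R, path_law 1%g I = r%:E.
  exists (fine (path_law 1%g I)); rewrite fineK// ge0_fin_numE ?measure_ge0//.
  have P1 : path_law 1%g setT = 1.
    rewrite -(path_measure_setT G_countable X_iid lambda (muP_pmf 0)).
    rewrite (path_measureE _ _ _ _ (mP 0%N)) wsum_power0// => x; exact: measure_ge0.
  apply: (@le_lt_trans _ _ (path_law 1%g setT)); last by rewrite P1 ltry.
  by apply: le_measure; rewrite ?inE.
exact: mean_cst.
Qed.

Lemma furstenberg_entropyE l : (L muP n.+1 - L muP n)%R @[n --> \oo] --> l ->
  furstenberg_entropy mu act nu = l%:E.
Proof.
move=> Ll; have [k k0 mu1] := admissible_power mu_pmf mu_admissible 1%g.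
have avg_pmf := average_pmf mu_pmf k0.
have avg_next n := average_next mu_pmf k0 n.
have avg_comm n := average_comm mu_pmf k0 n.
have [K bounds] := average_entropy_bounds k0.
have avg_fin n : cross_entropy (average mu k n) (average mu k n) < +oo.
  by case/andP: (bounds n) => _ /le_lt_trans; apply; exact: ltry.
pose c := telescope (L (average mu k)).
have c_ni := self_entropy_increment_decreasing avg_pmf avg_next avg_comm avg_fin.
have c0 := self_entropy_increment_ge0 avg_pmf avg_next avg_comm avg_fin.
have [l' cl'] := nonincreasing_nonneg_cvg c_ni c0.
(* The two entropy sequences stay within K of each other, so their increments have the same
   limit. *)
have ll' : l' = l.
  apply: (bounded_gap_limits (K := K) cl' Ll) => n.
  exact: (dist_le_fin (self_entropyE avg_pmf avg_fin n) (bounds n)).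
rewrite -ll' -(wsum_inf_divergence avg_pmf avg_next avg_comm avg_fin cl').
rewrite /furstenberg_entropy /pmf_integral.
set Phi := (fun g : G => \int[nu]_x _).
set Di := (fun g : G => ereal_inf _).
have PhiE g : (0 < mu g)%R -> Phi g = Di g.
  move=> mug; apply: (boundary_entropy mu_pmf lambda_invariant boundary mug avg_pmf avg_next avg_comm
    (average_asymp mu_pmf k0 mu1)).
    by move=> I; exact: average_invariant.
  exact: (divergence_decreasing avg_pmf avg_next avg_comm avg_fin mug).
have Di0 g : 0 <= Di g.
  apply: le_ereal_inf_tmp => _ [n _ <-].
  by apply: divergence_ge0; [apply: left_translate_mass|]; exact: pmf_mass.
have mmu := pmf_mass mu_pmf.
rewrite -[X in X - _]/(wsum mu Phi^\+) -[X in _ - X]/(wsum mu Phi^\-).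
(* On the support of mu the boundary terms are infima of divergences, hence nonnegative, so the
   negative part contributes nothing. *)
have -> : wsum mu Phi^\+ = wsum mu Di.
  by apply: eq_wsum => // g mug; rewrite funeposE PhiE//; apply/max_idPl.
have -> : wsum mu Phi^\- = wsum mu (cst 0).
  by apply: eq_wsum => // g mug; rewrite funenegE PhiE//; apply/max_idPr; rewrite oppe_le0.
by rewrite wsum_cst// mul0e sube0.
Qed.

Lemma entropy_formula :
  let h := furstenberg_entropy mu act nu in
  let H n (K : borel (SubG G)) := coset_entropy mu n K in
  [/\ (n.+1%:R^-1)%:E * \int[lambda]_K H n.+1 K @[n --> \oo] --> h,
      h = ereal_inf
            [set (n%:R^-1)%:E * \int[lambda]_K H n K | n in [set n | (0 < n)%N]],
      \int[lambda]_K (H n.+1 K - H n K) @[n --> \oo] --> h &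
      h = ereal_inf
            [set \int[lambda]_K (H n K - H n.-1 K) | n in [set n | (0 < n)%N]]].
Proof.
move=> h H.
have c_ni := self_entropy_increment_decreasing muP_pmf muP_next muP_comm muP_fin.
have c0 := self_entropy_increment_ge0 muP_pmf muP_next muP_comm muP_fin.
have [l cl] := nonincreasing_nonneg_cvg c_ni c0.
have hl : h = l%:E by exact: furstenberg_entropyE.
have LE n : cross_entropy (muP n) (muP n) = (L muP n)%:E by rewrite (self_entropyE muP_pmf muP_fin n).
(* This identifies (L n.+1 - L 0) / n.+1, the mean of the increments, with the entropy rate of the
   first limit. *)
have L0 : L muP 0 = 0%R.
  by apply: EFin_inj; rewrite -LE; exact: cross_entropy_power0.
have HE n : (n%:R^-1)%:E * \int[lambda]_K H n K = (n%:R^-1 * L muP n)%:E.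
  by rewrite /H (integral_coset_entropy n) LE.
have HdE n : \int[lambda]_K (H n.+1 K - H n K) = (L muP n.+1 - L muP n)%:E.
  by rewrite /H (integral_coset_entropy_sub n.+1 n) !LE.
have cvg_mean : (n.+1%:R^-1)%:E * \int[lambda]_K H n.+1 K @[n --> \oo] --> h.
  rewrite hl (_ : (fun n => _) = (fun n => (n.+1%:R^-1 * (L muP n.+1 - L muP 0))%:E)).
    by apply: cvg_EFin; [near=> n|exact: mean_difference_cvg cl].
  by apply/funext => n; rewrite HE L0 subr0.
have cvg_diff : \int[lambda]_K (H n.+1 K - H n K) @[n --> \oo] --> h.
  rewrite hl (_ : (fun n => _) = (fun n => (L muP n.+1 - L muP n)%:E)).
    by apply: cvg_EFin; [near=> n|exact: cl].
  by apply/funext => n.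
have shift_range (u : nat -> \bar R) : [set u n | n in [set n | (0 < n)%N]] = range (fun n => u n.+1).
  by apply/seteqP; split=> [_ [[//|n] _ <-]|_ [n _ <-]]; [exists n|exists n.+1].
split => //.
- rewrite shift_range; apply/esym/ereal_inf_limit => // n.
  by rewrite hl HE lee_fin; have := limit_le_mean_difference n c_ni cl; rewrite L0 subr0.
- rewrite (shift_range (fun n => \int[lambda]_K (H n K - H n.-1 K))).
  apply/esym/ereal_inf_limit => // n.
  by rewrite hl HdE lee_fin; exact: (nonincreasing_ge_limit n c_ni cl).
Unshelve. all: by end_near. Qed.

End EntropyFormula.

Theorem theorem3p1 (R : realType) (G : groupType)
    (G_countable : countable [set: G])
    (mu : G -> R) (mu_pmf : is_pmf mu) (mu_admissible : admissible mu)
    (mu_entropy : entropy [set: G] mu < +oo)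
    (d : measure_display) (Omega : measurableType d) (Pr : probability Omega R)
    (X : nat -> Omega -> G) (X_iid : iid_with_law Pr X mu)
    (lambda : probability (borel (SubG G)) R)
    (lambda_invariant : conj_invariant lambda)
    (d' : measure_display) (B : measurableType d') (nu : probability B R)
    (act : G -> {mfun B >-> B})
    (D : set (borel (tSubG G))) (bnd : borel (tSubG G) -> B)
    (boundary : is_poisson_boundary (P_int Pr X lambda) act nu D bnd) :
  let h := furstenberg_entropy mu act nu in
  let H n (K : borel (SubG G)) := coset_entropy mu n K in
  [/\ (n.+1%:R^-1)%:E * \int[lambda]_K H n.+1 K @[n --> \oo] --> h,
      h = ereal_inf
            [set (n%:R^-1)%:E * \int[lambda]_K H n K | n in [set n | (0 < n)%N]],
      \int[lambda]_K (H n.+1 K - H n K) @[n --> \oo] --> h &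
      h = ereal_inf
            [set \int[lambda]_K (H n K - H n.-1 K) | n in [set n | (0 < n)%N]]].
Proof. exact: (entropy_formula G_countable mu_pmf X_iid lambda_invariant mu_admissible mu_entropy boundary). Qed.
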